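(* Let $a=(a_j)_{j\in\mathbb{Z}}\in\ell^1(\mathbb{Z})$ be a complex valued sequence satisfying assumptions (A1), (A2) and (A3) listed in the context, with associated data $K$, $\underline{\kappa}_k,\underline{z}_k,\alpha_k,\mu_k,\beta_k$ ($1\le k\le K$). Then for all integers $s_1,\dots,s_K\in\mathbb{N}$ there exist, for each $k\in\{1,\dots,K\}$, a family of polynomials $(\mathscr{P}^k_\sigma)_{\sigma\in\{1,\dots,s_k\}}$ in $\mathbb{C}[X,Y]$, and two positive constants $C,c$, such that for all $n\in\mathbb{N}^*$ and $j\in\mathbb{Z}$, $$\left|\mathscr{G}_j^n-\sum_{k=1}^K\sum_{\sigma=1}^{s_k}\frac{\underline{z}_k^n\underline{\kappa}_k^j}{n^{\frac{\sigma}{2\mu_k}}}\left(\mathscr{P}^k_\sigma\left(X_{n,j,k},\frac{d}{dx}\right)H_{2\mu_k}^{\beta_k}\right)(X_{n,j,k})\right|\le\sum_{k=1}^K\frac{C}{n^{\frac{s_k+1}{2\mu_k}}}\exp\left(-c|X_{n,j,k}|^{\frac{2\mu_k}{2\mu_k-1}}\right),$$ where $X_{n,j,k}=\dfrac{n\alpha_k-j}{n^{\frac{1}{2\mu_k}}}$.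
   Context: Notation: $\mathbb{N}=\{0,1,2,\dots\}$, $\mathbb{N}^*=\mathbb{N}\setminus\{0\}$, $\mathbb{S}^1=\{z\in\mathbb{C}:|z|=1\}$. For a sequence $a$, its symbol is $F(\kappa)=\sum_{j\in\mathbb{Z}}a_j\kappa^j$, $\kappa\in\mathbb{S}^1$. Assumptions: (A1) $a$ is finitely supported and has at least two nonzero coefficients. (A2) There is a finite set of distinct points $\{\underline{\kappa}_1,\dots,\underline{\kappa}_K\}\subset\mathbb{S}^1$, $K\ge1$, such that $\underline{z}_k:=F(\underline{\kappa}_k)\in\mathbb{S}^1$ for all $k$ and $|F(\kappa)|<1$ for all $\kappa\in\mathbb{S}^1\setminus\{\underline{\kappa}_1,\dots,\underline{\kappa}_K\}$. Moreover for each $k$ there exist a nonzero real number $\alpha_k$, an integer $\mu_k\ge1$ and a complex number $\beta_k$ with positive real part such that, as $\xi\to0$, $F(\underline{\kappa}_ke^{i\xi})=\underline{z}_k\exp(-i\alpha_k\xi-\beta_k\xi^{2\mu_k}+O(|\xi|^{2\mu_k+1}))$. (A3) For all $k\in\{1,\dots,K\}$, the set $\mathcal{I}_k=\{\nu\in\{1,\dots,K\}:\underline{z}_\nu=\underline{z}_k\}$ has one or two elements; if it has two distinct elements $\nu_1,\nu_2$, then $\alpha_{\nu_1}\alpha_{\nu_2}<0$. The operator $\mathscr{L}_a$ is $(\mathscr{L}_au)_j=\sum_{l\in\mathbb{Z}}a_lu_{j+l}$, and $\mathscr{G}_j^n:=(\mathscr{L}_a^n\delta)_j$ with $\delta=(\delta_{j,0})_{j\in\mathbb{Z}}$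 the discrete Dirac mass. For $\mu\in\mathbb{N}^*$ and $\beta\in\mathbb{C}$ with positive real part, $H_{2\mu}^\beta(x)=\frac{1}{2\pi}\int_{\mathbb{R}}e^{ixu}e^{-\beta u^{2\mu}}du$, $x\in\mathbb{R}$. For $P=\sum_{p,q}c_{p,q}X^pY^q\in\mathbb{C}[X,Y]$, $\left(P(x,\frac{d}{dx})H_{2\mu}^\beta\right)(x)=\sum_{p,q}c_{p,q}x^p(H_{2\mu}^\beta)^{(q)}(x)$. Empty sums are zero. *)

(* Defs.v *)
From HB Require Import structures.
From mathcomp Require Import all_boot all_order all_algebra.
From mathcomp Require Import all_classical all_reals all_analysis.
From mathcomp Require Import complex.

Set Implicit Arguments.
Unset Strict Implicit.
Unset Printing Implicit Defensive.

Import Order.TTheory GRing.Theory Num.Theory.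
Import numFieldNormedType.Exports.

Local Open Scope classical_set_scope.
Local Open Scope complex_scope.
Local Open Scope ring_scope.

(* Unqualified, Re and Im would be the R[i]-valued 'Re and 'Im of Num. *)
Local Notation Re := complex.Re.
Local Notation Im := complex.Im.

Definition cexp (R : realType) (z : R[i]) : R[i] :=
  (expR (Re z))%:C * (cos (Im z) +i* sin (Im z)).

(* Derivatives and Lebesgue integrals of functions R -> R[i] are taken
   componentwise. *)
Definition cderiven (R : realType) (q : nat) (f : R -> R[i]) (x : R) : R[i] :=
  derive1n q (fun t => Re (f t)) x +i* derive1n q (fun t => Im (f t)) x.

Definition cintegral (R : realType) (f : R -> R[i]) : R[i] :=
  Rintegral (@lebesgue_measure R) setT (fun u => Re (f u)) +i*
  Rintegral (@lebesgue_measure R) setT (fun u => Im (f u)).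

(* Sums over all of int are finite-support sums, i.e. \sum_(_ \in _) takes the
   value 0 on a family with infinite support. The sums below are meant for a
   finitely supported sequence a, for which they are the usual series. *)
Definition symbol (R : realType) (a : int -> R[i]) (kappa : R[i]) : R[i] :=
  \sum_(j \in [set: int]) a j * kappa ^ j.

Definition conv_op (R : realType) (a u : int -> R[i]) (j : int) : R[i] :=
  \sum_(l \in [set: int]) a l * u (j + l).

Definition dirac_seq (R : realType) (j : int) : R[i] := (j == 0)%:R.

Definition green (R : realType) (a : int -> R[i]) (n : nat) (j : int) : R[i] :=
  iter n (conv_op a) (@dirac_seq R) j.

Definition Hfun (R : realType) (mu : nat) (beta : R[i]) (x : R) : R[i] :=
  (((2 * pi)^-1 : R))%:C *
  cintegral (fun u : R =>
    cexp ('i%C * (x * u)%:C) * cexp (- (beta * (u ^+ (2 * mu))%:C))).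

(* A polynomial of C[X, Y] is encoded as a polynomial in Y with coefficients in
   C[X]: P`_q`_p is the coefficient of X^p Y^q. *)
Definition poly_diff (R : realType) (P : {poly {poly R[i]}})
    (f : R -> R[i]) (x : R) : R[i] :=
  \sum_(q < size P) \sum_(p < size P`_q)
    P`_q`_p * (x ^+ p)%:C * cderiven q f x.

Definition ell1 (R : realType) (a : int -> R[i]) : Prop :=
  summable [set: int] (fun j => (Re `|a j|)%:E).

Definition assumption_A1 (R : realType) (a : int -> R[i]) : Prop :=
  finite_set [set j | a j != 0] /\
  exists j1 j2 : int, [/\ j1 != j2, a j1 != 0 & a j2 != 0].

(* In A2_expansion the function r is the O(|xi|^(2 mu_k + 1)) remainder. *)
Record assumption_A2 (R : realType) (a : int -> R[i]) (K : nat)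
    (kappa z : 'I_K -> R[i]) (alpha : 'I_K -> R) (mu : 'I_K -> nat)
    (beta : 'I_K -> R[i]) : Prop := {
  A2_K_gt0 : (0 < K)%N;
  A2_kappa_inj : injective kappa;
  A2_kappa_circle : forall k, `|kappa k| = 1;
  A2_zE : forall k, z k = symbol a (kappa k);
  A2_z_circle : forall k, `|z k| = 1;
  A2_lt1 : forall x : R[i], `|x| = 1 -> (forall k, x != kappa k) ->
    `|symbol a x| < 1;
  A2_alpha_neq0 : forall k, alpha k != 0;
  A2_mu_gt0 : forall k, (0 < mu k)%N;
  A2_beta_gt0 : forall k, 0 < Re (beta k);
  A2_expansion : forall k, exists (r : R -> R[i]) (M : R),
    \forall xi \near nbhs (0 : R),
      `|r xi| <= (M * `|xi| ^+ (2 * mu k).+1)%:C /\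
      symbol a (kappa k * cexp ('i%C * xi%:C)) =
        z k * cexp (- ('i%C * (alpha k * xi)%:C)
                    - beta k * (xi ^+ (2 * mu k))%:C + r xi)
}.

Definition assumption_A3 (R : realType) (K : nat) (z : 'I_K -> R[i])
    (alpha : 'I_K -> R) : Prop :=
  forall k : 'I_K,
    (#|[pred nu | z nu == z k]| = 1%N \/ #|[pred nu | z nu == z k]| = 2%N) /\
    (forall nu1 nu2 : 'I_K, z nu1 = z k -> z nu2 = z k -> nu1 != nu2 ->
       alpha nu1 * alpha nu2 < 0).

Definition Xvar (R : realType) (alpha : R) (mu : nat) (n : nat) (j : int) : R :=
  (n%:R * alpha - j%:~R) / n%:R `^ ((2 * mu)%:R)^-1.

(* Main.v *)
(* Write F for the symbol. By Fourier inversion, 2 pi G^n_j is the integral of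
   F(e^{-it})^n e^{-ijt} over a period. Away from the points kappa_k the integrand is
   exponentially small in n. Near kappa_k = e^{-i theta_k}, with m = 2 mu_k,
   tau = n^{-1/m} and t = theta_k + tau u, it equals
     z_k^n kappa_k^j e^{iXu} e^{-beta u^m} g(tau u)^n,
   where g is entire and g(zeta) = 1 + O(zeta^{m+1}). Since n tau^m = 1, the binomial
   formula expands g(tau u)^n in powers of tau with coefficients polynomial in u:
   the coefficient of tau^sigma becomes a differential operator applied to H, and the
   remainder is O(tau^s) times a factor absorbed by the Gaussian. Moving the segment
   of integration into the complex plane yields the decay in X. When |j| is much
   larger than n, G^n_j vanishes and the main terms themselves obey the bound. *)

Require Import Defs.
From HB Require Import structures.
From mathcomp Require Import all_boot all_order all_algebra.
From mathcomp Require Import all_classical all_reals all_analysis.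
From mathcomp Require Import complex.
From mathcomp Require finmap.
From mathcomp Require Import measurable_realfun ring lra zify.

Set Implicit Arguments.
Unset Strict Implicit.
Unset Printing Implicit Defensive.

Import Order.TTheory GRing.Theory Num.Theory.
Import numFieldNormedType.Exports.

Local Open Scope classical_set_scope.
Local Open Scope complex_scope.
Local Open Scope ring_scope.

(** The bound must be uniform in n and j, with decay measured by y = |X|^(1/(m-1)), although the
    local integral only covers |u| <= T = eps/tau. A shift of height comparable to y has to stay
    where the expansion of g(tau u)^n is valid, and its vertical sides have to be negligible; both
    hold when y is at most a multiple of T. Since (tau y)^(m-1) = |alpha - j/n|, this amounts to |n
    alpha - j| = O(n), which is why values of j beyond a multiple of n are treated apart. The rate
    n^(-(s+1)/m) is tau^s from the expansion times the Jacobian tau. The model e^(i alpha zeta -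
    beta zeta^m) is divided out of the symbol itself and no logarithm is taken, so g is entire and
    no branch has to be tracked; its flatness, known for real zeta only, passes to complex zeta
    through its Taylor polynomial. Fractions such as c/2 and c/4 of an exponent split one Gaussian
    factor: one share pays for integrability or polynomial growth, one for powers of tau, one for
    decay in y. *)

Local Notation Re := complex.Re.
Local Notation Im := complex.Im.
Local Notation normc := Normc.normc.

(** * Modulus and exponential of complex numbers *)

Section ComplexBasics.
Context {R : realType}.
Implicit Types (z w : R[i]) (x y : R).

Lemma normcE z : `|z| = (normc z)%:C.
Proof. by []. Qed.

Lemma normc_sqr z : normc z ^+ 2 = Re z ^+ 2 + Im z ^+ 2.
Proof. by case: z => a b /=; rewrite sqr_sqrtr// addr_ge0 ?sqr_ge0. Qed.

Lemma normc_ge0 z : 0 <= normc z.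
Proof. by case: z => a b /=; exact: sqrtr_ge0. Qed.

Lemma normcM z w : normc (z * w) = normc z * normc w.
Proof. exact: Normc.normcM. Qed.

Lemma normcV z : normc z^-1 = (normc z)^-1.
Proof. exact: Normc.normcV. Qed.

Lemma normc1 : normc (1 : R[i]) = 1.
Proof. exact: Normc.normc1. Qed.

Lemma normc0 : normc (0 : R[i]) = 0.
Proof. exact: Normc.normc0. Qed.

Lemma normcX z n : normc (z ^+ n) = normc z ^+ n.
Proof. by elim: n => [|n IH]; rewrite ?expr0 ?normc1// !exprS normcM IH. Qed.

Lemma normcD z w : normc (z + w) <= normc z + normc w.
Proof. exact: le_normcD. Qed.

Lemma normcN z : normc (- z) = normc z.
Proof. exact: complex.normcN. Qed.

Lemma normcB z w : normc (z - w) <= normc z + normc w.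
Proof. by rewrite -(normcN w); exact: normcD. Qed.

Lemma normcBC z w : normc (z - w) = normc (w - z).
Proof. by rewrite -normcN opprB. Qed.

Lemma normc_sum I (r : seq I) (P : pred I) (F : I -> R[i]) :
  normc (\sum_(i <- r | P i) F i) <= \sum_(i <- r | P i) normc (F i).
Proof.
elim/big_rec2: _ => [|i y x _ H]; first by rewrite normc0.
by apply: le_trans (normcD _ _) _; rewrite lerD2l.
Qed.

Lemma normc_real x : normc x%:C = `|x|.
Proof. by rewrite /= expr0n /= addr0 sqrtr_sqr. Qed.

Lemma normc_Re z : `|Re z| <= normc z.
Proof.
by case: z => a b /=; rewrite -[leLHS]sqrtr_sqr ler_sqrt ?lerDl ?addr_ge0 ?sqr_ge0.
Qed.

Lemma normc_Im z : `|Im z| <= normc z.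
Proof.
by case: z => a b /=; rewrite -[leLHS]sqrtr_sqr ler_sqrt ?lerDr ?addr_ge0 ?sqr_ge0.
Qed.

Lemma normc_ReIm z : normc z <= `|Re z| + `|Im z|.
Proof.
rewrite -(@ler_pXn2r _ 2)// ?nnegrE ?normc_ge0 ?addr_ge0//.
by rewrite normc_sqr sqrrD !real_normK ?num_real// lerD2r lerDl mulrn_wge0 ?mulr_ge0.

Qed.

Lemma reD z w : Re (z + w) = Re z + Re w.
Proof. by case: z w => a b [c d]. Qed.

Lemma imD z w : Im (z + w) = Im z + Im w.
Proof. by case: z w => a b [c d]. Qed.

Lemma reM z w : Re (z * w) = Re z * Re w - Im z * Im w.
Proof. by case: z w => a b [c d]. Qed.

Lemma imM z w : Im (z * w) = Re z * Im w + Im z * Re w.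
Proof. by case: z w => a b [c d]. Qed.

Lemma reN z : Re (- z) = - Re z.
Proof. by case: z. Qed.

Lemma imN z : Im (- z) = - Im z.
Proof. by case: z. Qed.

Lemma complexP z w : Re z = Re w -> Im z = Im w -> z = w.
Proof. by case: z w => a b [c d] /= -> ->. Qed.

Lemma realcM x y : (x * y)%:C = x%:C * y%:C :> R[i].
Proof. exact: rmorphM. Qed.

Lemma realcD x y : (x + y)%:C = x%:C + y%:C :> R[i].
Proof. exact: rmorphD. Qed.

Lemma realcX x n : (x ^+ n)%:C = x%:C ^+ n :> R[i].
Proof. exact: rmorphXn. Qed.

Lemma realcV x : (x^-1)%:C = x%:C^-1 :> R[i].
Proof. exact: fmorphV. Qed.

Lemma cexpD z w : cexp (z + w) = cexp z * cexp w.
Proof.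
case: z w => a b [c d]; rewrite /cexp /= expRD sinD cosD.
by apply: complexP; rewrite /=; ring.
Qed.

Lemma cexp0 : cexp (0 : R[i]) = 1.
Proof. by rewrite /cexp /= expR0 cos0 sin0 mul1r. Qed.

Lemma cexpN z : cexp (- z) = (cexp z)^-1.
Proof.
have H : cexp z * cexp (- z) = 1 by rewrite -cexpD subrr cexp0.
have nz : cexp z != 0.
  by apply/eqP => h; move: H; rewrite h mul0r => /eqP; rewrite eq_sym oner_eq0.
by apply: (mulfI nz); rewrite H divff.
Qed.

Lemma normc_cexp z : normc (cexp z) = expR (Re z).
Proof.
rewrite /cexp normcM normc_real ger0_norm ?expR_ge0//= cos2Dsin2 sqrtr1 mulr1//.
Qed.

Lemma cexpMn z n : cexp z ^+ n = cexp (n%:R * z).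
Proof.
elim: n => [|n IH]; first by rewrite mul0r cexp0.
by rewrite exprS IH -cexpD -[in n.+1%:R]addn1 natrD mulrDl mul1r addrC.
Qed.

Lemma cexpMz z (j : int) : cexp z ^ j = cexp (j%:~R * z).
Proof.
case: j => n; first by rewrite -exprnP cexpMn.
by rewrite NegzE -exprnN cexpMn -cexpN rmorphN /= mulNr.
Qed.

Lemma normc_zpow z (j : int) : normc z = 1 -> normc (z ^ j) = 1.
Proof.
move=> h; case: j => n; first by rewrite -exprnP normcX h expr1n.
by rewrite NegzE -exprnN normcV normcX h expr1n invr1.
Qed.

End ComplexBasics.

(** * Complex-valued functions of a real variable: derivatives *)

Section ComplexDerivative.
Context {R : realType}.
Implicit Types (f g : R -> R[i]) (t : R) (z w d : R[i]).

Definition cder f t d :=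
  is_derive t (1 : R) (fun u => Re (f u)) (Re d) /\
  is_derive t (1 : R) (fun u => Im (f u)) (Im d).

Lemma cder_eq f t d d' : cder f t d -> d = d' -> cder f t d'.
Proof. by move=> + <-. Qed.

Lemma cder_cst z t : cder (fun=> z) t 0.
Proof. by split; exact: is_derive_cst. Qed.

Lemma cderD f g t d e : cder f t d -> cder g t e ->
  cder (fun u => f u + g u) t (d + e).
Proof.
move=> [f1 f2] [g1 g2]; split.
  rewrite (_ : (fun u => Re (f u + g u)) =
    (fun u => Re (f u)) + (fun u => Re (g u))); last first.
    by apply/funext => u; rewrite reD.
  by apply: (is_derive_eq (is_deriveD f1 g1)); rewrite reD.
rewrite (_ : (fun u => Im (f u + g u)) =
  (fun u => Im (f u)) + (fun u => Im (g u))); last first.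
  by apply/funext => u; rewrite imD.
by apply: (is_derive_eq (is_deriveD f2 g2)); rewrite imD.
Qed.

Lemma cderM f g t d e : cder f t d -> cder g t e ->
  cder (fun u => f u * g u) t (d * g t + f t * e).
Proof.
move=> [f1 f2] [g1 g2]; split.
  rewrite (_ : (fun u => Re (f u * g u)) =
    (fun u => Re (f u)) * (fun u => Re (g u)) -
    (fun u => Im (f u)) * (fun u => Im (g u))); last first.
    by apply/funext => u; rewrite reM.
  apply: (is_derive_eq (is_deriveB (is_deriveM f1 g1) (is_deriveM f2 g2))).
  by rewrite reD !reM /GRing.scale /=; ring.
rewrite (_ : (fun u => Im (f u * g u)) =
  (fun u => Re (f u)) * (fun u => Im (g u)) +
  (fun u => Im (f u)) * (fun u => Re (g u))); last first.
  by apply/funext => u; rewrite imM.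
apply: (is_derive_eq (is_deriveD (is_deriveM f1 g2) (is_deriveM f2 g1))).
by rewrite imD !imM /GRing.scale /=; ring.
Qed.

Lemma cder_cexp f t d : cder f t d ->
  cder (fun u => cexp (f u)) t (d * cexp (f t)).
Proof.
move=> [f1 f2]; split.
  rewrite (_ : (fun u => Re (cexp (f u))) =
    (expR \o (fun u => Re (f u))) * (cos \o (fun u => Im (f u)))); last first.
    by apply/funext => u; rewrite /cexp reM /= mul0r subr0.
  apply: is_derive_eq; rewrite /cexp !reM !imM /GRing.scale /=; ring.
rewrite (_ : (fun u => Im (cexp (f u))) =
  (expR \o (fun u => Re (f u))) * (sin \o (fun u => Im (f u)))); last first.
  by apply/funext => u; rewrite /cexp imM /= mul0r addr0.
apply: is_derive_eq; rewrite /cexp imM !reM !imM /GRing.scale /=; ring.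
Qed.

Lemma cder_realc t : cder (fun u => u%:C) t 1.
Proof. by split => /=; [exact: is_derive_id | exact: is_derive_cst]. Qed.

Lemma cder_line z w t : cder (fun u => z + u%:C * w) t w.
Proof.
apply: cder_eq.
  apply: cderD; first exact: cder_cst.
  by apply: cderM; [exact: cder_realc|exact: cder_cst].
by rewrite mul1r mulr0 addr0 add0r.
Qed.

(** The mean value theorem is applied to the real and the imaginary part, each at its own
    intermediate point; hence the factor 2. *)
Lemma cder_mean_value f (f' : R -> R[i]) (a b M : R) : a <= b ->
  (forall t, cder f t (f' t)) ->
  (forall t, a <= t <= b -> normc (f' t) <= M) ->
  normc (f b - f a) <= 2 * (M * (b - a)).
Proof.
move=> ab df Mf.
have main (h h' : R -> R) : (forall t, is_derive t (1 : R) h (h' t)) ->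
    (forall t, a <= t <= b -> `|h' t| <= M) -> `|h b - h a| <= M * (b - a).
  move=> dh Mh.
  have [|c cab ->] := @MVT_segment R h h' a b ab.
  - by apply: derivable_within_continuous => x _; apply: (@ex_derive _ _ _ _ _ _ _ (dh x)).
  - rewrite normrM (ger0_norm (_ : 0 <= b - a)) ?subr_ge0//.
    by rewrite ler_wpM2r ?subr_ge0// Mh// -in_itv.
apply: le_trans (normc_ReIm _) _; rewrite mulr_natl mulr2n lerD//.
  rewrite reD reN; apply: (main (fun t => Re (f t)) (fun t => Re (f' t))).
    by move=> t; case: (df t).
  by move=> t /Mf; apply: le_trans; exact: normc_Re.
rewrite imD imN; apply: (main (fun t => Im (f t)) (fun t => Im (f' t))).
  by move=> t; case: (df t).
by move=> t /Mf; apply: le_trans; exact: normc_Im.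
Qed.

Lemma cder_continuous f : (forall t, exists d, cder f t d) ->
  continuous (fun t => Re (f t)) /\ continuous (fun t => Im (f t)).
Proof.
move=> df; split => t; have [d [d1 d2]] := df t;
  apply: differentiable_continuous; apply/derivable1_diffP.
  exact: (@ex_derive _ _ _ _ _ _ _ d1).
exact: (@ex_derive _ _ _ _ _ _ _ d2).
Qed.

End ComplexDerivative.

(** * Entire functions and their Taylor polynomials *)

Section Entire.
Context {R : realType}.
Implicit Types (f g : R[i] -> R[i]) (z w : R[i]).

(* A class of entire functions for which existence of the derivative, stability
   under differentiation and boundedness on discs follow by structural induction. *)
Inductive ent : (R[i] -> R[i]) -> Prop :=
| ent_cst z : ent (fun=> z)
| ent_id : ent (fun z => z)
| ent_add f g : ent f -> ent g -> ent (fun z => f z + g z)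
| ent_mul f g : ent f -> ent g -> ent (fun z => f z * g z)
| ent_cexp f : ent f -> ent (fun z => cexp (f z)).

Lemma ent_opp f : ent f -> ent (fun z => - f z).
Proof.
move=> ef; rewrite (_ : (fun z => - f z) = (fun z => (-1) * f z)).
  by apply: ent_mul => //; exact: ent_cst.
by apply/funext => z; rewrite mulN1r.
Qed.

Lemma ent_sub f g : ent f -> ent g -> ent (fun z => f z - g z).
Proof. by move=> ef eg; apply: ent_add => //; exact: ent_opp. Qed.

Lemma ent_exp f n : ent f -> ent (fun z => f z ^+ n).
Proof.
move=> ef; elim: n => [|n IH].
  by rewrite (_ : (fun z => f z ^+ 0) = (fun=> 1)); first exact: ent_cst.
rewrite (_ : (fun z => f z ^+ n.+1) = (fun z => f z * f z ^+ n)).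
  exact: ent_mul.
by apply/funext => z; rewrite exprS.
Qed.

Lemma ent_sum I (r : seq I) (F : I -> R[i] -> R[i]) :
  (forall i, ent (F i)) -> ent (fun z => \sum_(i <- r) F i z).
Proof.
move=> eF; elim: r => [|i r IH].
  rewrite (_ : (fun z => _) = (fun=> 0)); first exact: ent_cst.
  by apply/funext => z; rewrite big_nil.
rewrite (_ : (fun z => _) = (fun z => F i z + \sum_(j <- r) F j z)).
  exact: ent_add.
by apply/funext => z; rewrite big_cons.
Qed.

Lemma ent_horner (p : {poly R[i]}) : ent (fun z => p.[z]).
Proof.
rewrite (_ : (fun z => _) = (fun z => \sum_(i < size p) p`_i * z ^+ i)).
  apply: ent_sum => i; apply: ent_mul; first exact: ent_cst.
  by apply: ent_exp; exact: ent_id.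
by apply/funext => z; rewrite horner_coef.
Qed.

Lemma ent_comp f g : ent f -> ent g -> ent (fun z => f (g z)).
Proof.
move=> + eg; elim=> //.
- by move=> z; exact: ent_cst.
- by move=> f1 f2 _ h1 _ h2; exact: ent_add h1 h2.
- by move=> f1 f2 _ h1 _ h2; exact: ent_mul h1 h2.
- by move=> f1 _ h1; exact: ent_cexp h1.
Qed.

Lemma ent_bounded f (r : R) : ent f ->
  exists2 M, 0 <= M & forall z, normc z <= r -> normc (f z) <= M.
Proof.
elim=> [w||g h _ [M M0 HM] _ [N N0 HN]|g h _ [M M0 HM] _ [N N0 HN]|g _ [M M0 HM]].
- by exists (normc w) => //; exact: normc_ge0.
- by exists `|r| => // z /le_trans; apply; exact: ler_norm.
- exists (M + N) => [|z zr]; first exact: addr_ge0.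
  by apply: le_trans (normcD _ _) _; rewrite lerD ?HM ?HN.
- exists (M * N) => [|z zr]; first exact: mulr_ge0.
  by rewrite normcM ler_pM ?normc_ge0 ?HM ?HN.
- exists (expR M) => [|z zr]; first exact: expR_ge0.
  rewrite normc_cexp ler_expR (le_trans _ (HM z zr))//.
  by rewrite (le_trans (ler_norm _)) ?normc_Re.
Qed.

(** One function f' serves every direction w. This complex linearity in w carries the Cauchy-Riemann
    equations, and [contour_shift] uses it by comparing the directions 1 and i eta. *)
Lemma ent_derivative f : ent f -> exists2 f', ent f' &
  forall z w t, cder (fun t => f (z + t%:C * w)) t (w * f' (z + t%:C * w)).
Proof.
elim=> [w||g h eg [g' eg' dg] eh [h' eh' dh]|g h eg [g' eg' dg] eh [h' eh' dh]|g eg [g' eg' dg]].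
- exists (fun=> 0); first exact: ent_cst.
  by move=> *; rewrite mulr0; exact: cder_cst.
- exists (fun=> 1); first exact: ent_cst.
  by move=> *; rewrite mulr1; exact: cder_line.
- exists (fun z => g' z + h' z); first exact: ent_add.
  move=> z w t; apply: cder_eq; first exact: (cderD (dg z w t) (dh z w t)).
  by rewrite mulrDr.
- exists (fun z => g' z * h z + g z * h' z).
    by apply: ent_add; apply: ent_mul.
  move=> z w t; apply: cder_eq; first exact: (cderM (dg z w t) (dh z w t)).
  by rewrite /=; ring.
- exists (fun z => g' z * cexp (g z)).
    by apply: ent_mul => //; exact: ent_cexp.
  move=> z w t; apply: cder_eq; first exact: (cder_cexp (dg z w t)).
  by rewrite mulrA.
Qed.

Lemma cder_horner (p : {poly R[i]}) z w t :
  cder (fun t => p.[z + t%:C * w]) t (w * p^`().[z + t%:C * w]).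
Proof.
elim/poly_ind: p => [|p c IH].
  rewrite (_ : (fun t => _) = (fun=> 0)).
    by apply: cder_eq (cder_cst _ _) _; rewrite deriv0 horner0 mulr0.
  by apply/funext => u; rewrite horner0.
rewrite (_ : (fun t => _) =
  (fun t => p.[z + t%:C * w] * (z + t%:C * w) + c)); last first.
  by apply/funext => u; rewrite hornerMXaddC.
apply: cder_eq.
  by apply: cderD; [exact: cderM IH (cder_line _ _ _)|exact: cder_cst].
by rewrite derivD derivC derivM derivX mulr1 !hornerE; ring.
Qed.

(** Induction on N: a polynomial approximating f' is integrated with constant term f(0), and the
    mean value inequality on the segment from 0 to z gains one factor |z|. *)
Lemma ent_taylor f (N : nat) : ent f -> exists (p : {poly R[i]}) (C : R),
  0 <= C /\ forall z, normc z <= 1 -> normc (f z - p.[z]) <= C * normc z ^+ N.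
Proof.
elim: N f => [|N IH] f ef.
  have [M M0 HM] := ent_bounded 1 ef.
  by exists 0, M; split => // z /HM; rewrite horner0 subr0 expr0 mulr1.
have [f' ef' df] := ent_derivative ef.
have [p' [C [C0 HC]]] := IH _ ef'.
pose p : {poly R[i]} :=
  \poly_(i < (size p').+1) (if i is j.+1 then p'`_j / j.+1%:R else f 0).
have p0 : p.[0] = f 0 by rewrite horner_coef0 coef_poly.
have dp : p^`() = p'.
  apply/polyP => i; rewrite coef_deriv coef_poly ltnS.
  case: ltnP => hi; last by rewrite mul0rn nth_default.
  by rewrite -[LHS]mulr_natr mulfVK// pnatr_eq0.
exists p, (2 * C); split; first by rewrite mulr_ge0.
move=> z z1.
pose h t := f (0 + t%:C * z) - p.[0 + t%:C * z].
have -> : f z - p.[z] = h 1 - h 0.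
  by rewrite /h !add0r !rmorph1 !rmorph0 !mul1r !mul0r p0 subrr subr0.
have dh t : cder h t (z * f' (0 + t%:C * z) - z * p'.[0 + t%:C * z]).
  apply: cderD; first exact: df.
  rewrite -dp (_ : (fun t => - _) = (fun t => (-1) * p.[0 + t%:C * z])); last first.
    by apply/funext => u; rewrite mulN1r.
  apply: cder_eq; first exact: cderM (cder_cst _ _) (cder_horner _ _ _ _).
  by rewrite mul0r add0r mulN1r.
apply: le_trans (cder_mean_value (M := C * normc z ^+ N.+1) ler01 dh _) _.
  move=> t /andP[t0 t1]; rewrite -mulrBr normcM add0r exprS mulrCA.
  rewrite ler_wpM2l ?normc_ge0//.
  have tz : normc (t%:C * z) <= normc z.
    by rewrite normcM normc_real ger0_norm// ler_piMl ?normc_ge0.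
  apply: le_trans (HC _ (le_trans tz z1)) _.
  by rewrite ler_wpM2l// lerXn2r ?nnegrE ?normc_ge0.
by rewrite subr0 mulr1 mulrA.
Qed.

End Entire.

(** * Integrals of complex-valued functions *)

Section ComplexIntegral.
Context {R : realType}.
Implicit Types (f g : R -> R[i]) (D E : set (measurableTypeR R)).
Local Notation mu := (@lebesgue_measure R).

Definition ccont f :=
  continuous (fun u => Re (f u)) /\ continuous (fun u => Im (f u)).

Definition cintegrable (D : set (measurableTypeR R)) f :=
  mu.-integrable D (EFin \o (fun u => Re (f u))) /\
  mu.-integrable D (EFin \o (fun u => Im (f u))).

Definition cI (D : set (measurableTypeR R)) f : R[i] :=
  Rintegral mu D (fun u => Re (f u)) +i* Rintegral mu D (fun u => Im (f u)).

(** A universal integrable majorant with integral pi: once a function is bounded pointwise by a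
    multiple of it, integrability and an explicit bound on the integral follow together. *)
Definition kern (u : R) : R := (1 + u ^+ 2)^-1.

Lemma kern_gt0 u : 0 < kern u.
Proof. by rewrite invr_gt0 ltr_pwDl// sqr_ge0. Qed.

Lemma kern_continuous : continuous kern.
Proof. exact: continuous_oneDsqrV. Qed.

Lemma integral_kern : (\int[mu]_x (kern x)%:E)%E = (pi : R)%:E.
Proof.
rewrite ge0_symfun_integralT.
- rewrite -set_itvcy integral0y_oneDsqr -EFinM; congr EFin.
  by rewrite mulrC divfK.
- by move=> x; rewrite ltW// kern_gt0.
- exact: kern_continuous.
- by move=> x; rewrite /kern /= sqrrN.
Qed.

Lemma integrable_kern : mu.-integrable setT (EFin \o kern).
Proof.
apply/integrableP; split.
  apply/measurable_EFinP; exact: continuous_measurable_fun kern_continuous.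
rewrite [ltLHS](_ : _ = (pi : R)%:E) ?ltry// -integral_kern.
by apply: eq_integral => x _ /=; rewrite ger0_norm// ltW// kern_gt0.
Qed.

Lemma cintegrable_dominated D f M : measurable D -> ccont f ->
  (forall u, D u -> normc (f u) <= M * kern u) -> cintegrable D f.
Proof.
move=> mD [cf1 cf2] Mf.
have ik : mu.-integrable D (EFin \o (fun u => M * kern u)).
  rewrite (_ : _ \o _ = (fun u => M%:E * (EFin \o kern) u)%E); last first.
    by apply/funext.
  apply: integrableZl => //; exact: integrableS integrable_kern.
have H (h : R -> R) : continuous h -> (forall u, `|h u| <= normc (f u)) ->
    mu.-integrable D (EFin \o h).
  move=> ch hf; apply: le_integrable ik => //.
    apply/measurable_EFinP; apply: measurable_funTS.
    exact: continuous_measurable_fun.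
  move=> u Du /=; rewrite lee_fin; apply: le_trans (hf u) _.
  by apply: le_trans (Mf _ Du) (ler_norm _).
by split; apply: H => // u; [exact: normc_Re|exact: normc_Im].
Qed.

(* The factor 2 comes from estimating real and imaginary parts separately. *)
Lemma cI_dominated D f M : measurable D -> ccont f -> 0 <= M ->
  (forall u, D u -> normc (f u) <= M * kern u) ->
  normc (cI D f) <= 2 * (M * pi).
Proof.
move=> mD cf M0 Mf; have [if1 if2] := cintegrable_dominated mD cf Mf.
have ik : mu.-integrable D (EFin \o (fun u => M * kern u)).
  rewrite (_ : _ \o _ = (fun u => M%:E * (EFin \o kern) u)%E); last first.
    by apply/funext.
  apply: integrableZl => //; exact: integrableS integrable_kern.
have ikD : mu.-integrable D (EFin \o kern) by exact: integrableS integrable_kern.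
have kD : Rintegral mu D kern <= pi.
  rewrite -lee_fin /Rintegral fineK; last exact: integrable_fin_num.
  rewrite -integral_kern; apply: ge0_subset_integral => //.
  - by apply/measurable_EFinP; exact: continuous_measurable_fun kern_continuous.
  - by move=> x _; rewrite lee_fin ltW// kern_gt0.
have H (h : R -> R) : mu.-integrable D (EFin \o h) ->
    (forall u, `|h u| <= normc (f u)) -> `|Rintegral mu D h| <= M * pi.
  move=> ih hf; apply: le_trans (@le_normr_Rintegral _ _ R mu D h mD ih) _.
  apply: (@le_trans _ _ (Rintegral mu D (fun u => M * kern u))).
    apply: le_Rintegral => //.
      exact: (integrable_norm ih).
    by move=> u Du; apply: le_trans (hf u) (Mf _ Du).
  by rewrite RintegralZl// ler_wpM2l.
apply: le_trans (normc_ReIm _) _; rewrite mulr_natl mulr2n lerD//.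
  by apply: H => // u; exact: normc_Re.
by apply: H => // u; exact: normc_Im.
Qed.

Lemma eq_cI D f g : (forall u, D u -> f u = g u) -> cI D f = cI D g.
Proof.
by move=> fg; apply: complexP => /=; apply: (@eq_Rintegral _ _ R mu D) => u; rewrite inE => /fg ->.
Qed.

Lemma cintegrableS D E f : measurable D -> measurable E -> D `<=` E ->
  cintegrable E f -> cintegrable D f.
Proof. by move=> mD mE DE [f1 f2]; split; exact: (integrableS mE mD DE). Qed.

Lemma cintegrableD D f g : measurable D -> cintegrable D f -> cintegrable D g ->
  cintegrable D (fun u => f u + g u).
Proof.
move=> mD [f1 f2] [g1 g2]; split.
  rewrite (_ : _ \o _ = ((EFin \o (fun u => Re (f u))) \+ (EFin \o (fun u => Re (g u))))%E).
    exact: integrableD.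
  by apply/funext => u /=; rewrite reD.
rewrite (_ : _ \o _ = ((EFin \o (fun u => Im (f u))) \+ (EFin \o (fun u => Im (g u))))%E).
  exact: integrableD.
by apply/funext => u /=; rewrite imD.
Qed.

Lemma integrable_realZ D (h : R -> R) (a : R) : measurable D ->
  mu.-integrable D (EFin \o h) -> mu.-integrable D (EFin \o (fun u => a * h u)).
Proof.
move=> mD ih; rewrite (_ : _ \o _ = (fun u => a%:E * (EFin \o h) u)%E).
  exact: integrableZl.
by apply/funext.
Qed.

Lemma cintegrableZ D f z : measurable D -> cintegrable D f ->
  cintegrable D (fun u => z * f u).
Proof.
move=> mD [f1 f2]; split.
  rewrite (_ : _ \o _ = ((EFin \o (fun u => Re z * Re (f u))%R) \+
    (EFin \o (fun u => (- Im z) * Im (f u))%R))%E).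
    by apply: integrableD => //; exact: integrable_realZ.
  by apply/funext => u /=; rewrite reM mulNr.
rewrite (_ : _ \o _ = ((EFin \o (fun u => Re z * Im (f u))%R) \+
  (EFin \o (fun u => Im z * Re (f u))%R))%E).
  by apply: integrableD => //; exact: integrable_realZ.
by apply/funext => u /=; rewrite imM.
Qed.

Lemma cI_D D f g : measurable D -> cintegrable D f -> cintegrable D g ->
  cI D (fun u => f u + g u) = cI D f + cI D g.
Proof.
move=> mD [f1 f2] [g1 g2]; apply: complexP => /=.
  by under eq_Rintegral do rewrite reD; rewrite RintegralD.
by under eq_Rintegral do rewrite imD; rewrite RintegralD.
Qed.

Lemma cI_Z D f z : measurable D -> cintegrable D f ->
  cI D (fun u => z * f u) = z * cI D f.
Proof.
move=> mD [f1 f2]; apply: complexP; rewrite ?reM ?imM /=.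
  under eq_Rintegral do rewrite reM.
  by rewrite RintegralB ?RintegralZl//; exact: integrable_realZ.
under eq_Rintegral do rewrite imM.
by rewrite RintegralD ?RintegralZl//; exact: integrable_realZ.
Qed.

Lemma cI0 D : cI D (fun=> 0) = 0.
Proof. by rewrite /cI /= /Rintegral integral0. Qed.

Lemma cintegrable0 D : measurable D -> cintegrable D (fun=> 0).
Proof. by move=> mD; split; exact: integrable0. Qed.

Lemma cI_sum D I (r : seq I) (F : I -> R -> R[i]) : measurable D ->
  (forall i, cintegrable D (F i)) ->
  cintegrable D (fun u => \sum_(i <- r) F i u) /\
  cI D (fun u => \sum_(i <- r) F i u) = \sum_(i <- r) cI D (F i).
Proof.
move=> mD iF; elim: r => [|i r [IH1 IH2]].
  rewrite (_ : (fun _ => _) = (fun=> 0)); last first.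
    by apply/funext => u; rewrite big_nil.
  by rewrite big_nil cI0; split => //; exact: cintegrable0.
rewrite (_ : (fun _ => _) = (fun u => F i u + \sum_(j <- r) F j u)); last first.
  by apply/funext => u; rewrite big_cons.
by rewrite big_cons; split; [exact: cintegrableD|rewrite cI_D// IH2].
Qed.

Lemma cI_setU D E f : measurable D -> measurable E ->
  cintegrable (D `|` E) f -> [disjoint D & E] ->
  cI (D `|` E) f = cI D f + cI E f.
Proof.
move=> mD mE [f1 f2] DE; apply: complexP => /=; exact: Rintegral_setU.
Qed.

Lemma cI_setD D E f : measurable D -> measurable E -> D `<=` E ->
  cintegrable E f -> cI E f = cI D f + cI (E `\` D) f.
Proof.
move=> mD mE DE fi; rewrite -cI_setU//.
- by rewrite setDUK.
- exact: measurableD.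
- by rewrite setDUK.
- by apply/disj_setPS => x [] ? [].
Qed.

Lemma ccont_cintegrable f a b : ccont f -> cintegrable `[a, b] f.
Proof.
move=> [c1 c2]; split; apply: continuous_compact_integrable;
  by [exact: segment_compact|exact: continuous_subspaceT].
Qed.

Lemma cI_FTC (F f : R -> R[i]) a b : a <= b -> ccont f ->
  (forall t, cder F t (f t)) -> cI `[a, b] f = F b - F a.
Proof.
rewrite le_eqVlt => /predU1P[<- _ _|ab [c1 c2] dF].
  by rewrite subrr set_itv1 /cI !Rintegral_set1.
have H (G g : R -> R) : continuous g -> (forall t, is_derive t (1:R) G (g t)) ->
    Rintegral mu `[a, b] g = G b - G a.
  move=> cg dG; have cG : continuous G.
    move=> t; apply: differentiable_continuous; apply/derivable1_diffP.
    exact: (@ex_derive _ _ _ _ _ _ _ (dG t)).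
  rewrite /Rintegral (@continuous_FTC2 _ g G)//.
  - exact: continuous_subspaceT.
  - split.
    + by move=> x _; exact: (@ex_derive _ _ _ _ _ _ _ (dG x)).
    + by apply: cvg_at_right_filter; exact: cG.
    + by apply: cvg_at_left_filter; exact: cG.
  - by move=> x _; rewrite derive1E; exact: (@derive_val _ _ _ _ _ _ _ (dG x)).
apply: complexP; rewrite ?reD ?imD ?reN ?imN /=.
  by apply: (H (fun t => Re (F t))) => // t; case: (dF t).
by apply: (H (fun t => Im (F t))) => // t; case: (dF t).
Qed.

End ComplexIntegral.

(** * Differentiation under the integral, contour shift, affine substitution *)

Section ParametricIntegral.
Context {R : realType}.
Local Notation mu := (@lebesgue_measure R).

(** The majorant is asked for only when |x - s| <= 1, so it may depend on s; this matters for entire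
    integrands, which are bounded on discs only. *)
Lemma cder_cI (D : set (measurableTypeR R)) (F F' : R -> R -> R[i])
    (G : R -> R) (s : R) : measurable D ->
  (forall x, cintegrable D (F x)) ->
  (forall x y, D y -> cder (F ^~ y) x (F' x y)) ->
  mu.-integrable D (EFin \o G) -> (forall y, 0 <= G y) ->
  (forall x y, `|x - s| <= 1 -> D y -> normc (F' x y) <= G y) ->
  cder (fun x => cI D (F x)) s (cI D (F' s)).
Proof.
move=> mD iF dF iG G0 GF.
have Is : `]s - 1, s + 1[%classic s.
  by rewrite /= in_itv /= ltrBlDr !ltrDl ltr01.
have main (f f' : R -> R -> R) :
    (forall x, mu.-integrable D (EFin \o f x)) ->
    (forall x y, D y -> is_derive x (1 : R) (f ^~ y) (f' x y)) ->
    (forall x y, `|x - s| <= 1 -> D y -> `|f' x y| <= G y) ->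
    is_derive s (1 : R) (fun x => Rintegral mu D (f x)) (Rintegral mu D (f' s)).
  move=> fi df fG.
  have df1 x y : `]s - 1, s + 1[%classic x -> D y -> derivable (f ^~ y) x 1.
    by move=> _ Dy; exact: (@ex_derive _ _ _ _ _ _ _ (df x y Dy)).
  have p1 x y : D y -> partial1of2 f x y = f' x y.
    by move=> Dy; rewrite partial1of2E; exact: (@derive_val _ _ _ _ _ _ _ (df x y Dy)).
  have G_ub x y : `]s - 1, s + 1[%classic x -> D y -> `|partial1of2 f x y| <= G y.
    rewrite /= in_itv /= => /andP[x1 x2] Dy; rewrite p1// fG// ler_distl.
    by rewrite !ltW.
  apply: DeriveDef.
    exact: (derivable_under_integral mD Is (fun x _ => fi x) df1 G0 iG G_ub).
  rewrite -derive1E.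
  rewrite (differentiation_under_integral mD Is (fun x _ => fi x) df1 G0 iG G_ub).
  by apply: (@eq_Rintegral _ _ R mu D) => y; rewrite inE => /p1 ->.
split => /=.
  apply: (main (fun x y => Re (F x y)) (fun x y => Re (F' x y))).
  - by move=> x; case: (iF x).
  - by move=> x y Dy; case: (dF x y Dy).
  - by move=> x y xs Dy; apply: le_trans (normc_Re _) (GF _ _ xs Dy).
apply: (main (fun x y => Im (F x y)) (fun x y => Im (F' x y))).
- by move=> x; case: (iF x).
- by move=> x y Dy; case: (dF x y Dy).
- by move=> x y xs Dy; apply: le_trans (normc_Im _) (GF _ _ xs Dy).
Qed.

Lemma ent_ccont (f : R[i] -> R[i]) z w : ent f ->
  ccont (fun t : R => f (z + t%:C * w)).
Proof.
move=> /ent_derivative[f' _ df]; apply: cder_continuous => t.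
by eexists; exact: df.
Qed.

Lemma integrable_cst_itv (M a b : R) : mu.-integrable `[a, b] (EFin \o cst M).
Proof.
apply: continuous_compact_integrable; first exact: segment_compact.
by apply: continuous_subspaceT => x; exact: cst_continuous.
Qed.

(* Cauchy's theorem on the rectangle [-T, T] x [0, eta], with the vertical sides
   only estimated. *)
Lemma contour_shift (f : R[i] -> R[i]) (T eta M : R) : ent f -> 0 <= T ->
  (forall s, 0 <= s <= 1 ->
    normc (f (T%:C + (s * eta)%:C * 'i)) <= M /\
    normc (f ((- T)%:C + (s * eta)%:C * 'i)) <= M) ->
  normc (cI `[- T, T] (fun u => f (u%:C + eta%:C * 'i)) -
         cI `[- T, T] (fun u => f u%:C)) <= 4 * (`|eta| * M).
Proof.
move=> ef T0 Mf; have [f' ef' df] := ent_derivative ef.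
(* [Psi s] is the integral along the line of height s eta. The s-derivative of [F] is i eta times
   its u-derivative, so the derivative of [Psi] integrates to the endpoint values in [Psi']. Two
   endpoints and the factor 2 of the mean value inequality make the constant 4. *)
pose F (s u : R) := f (u%:C + s%:C * (eta%:C * 'i)).
pose F' (s u : R) := (eta%:C * 'i) * f' (u%:C + s%:C * (eta%:C * 'i)).
pose Psi s := cI `[- T, T] (F s).
pose Psi' s := 'i%C * eta%:C * (F s T - F s (- T)).
have cF s : ccont (F s).
  have := @ent_ccont f (s%:C * (eta%:C * 'i)) 1 ef.
  rewrite (_ : (fun t => _) = F s)//.
  by apply/funext => t; rewrite /F mulr1 addrC.
have cF' s : ccont (F' s).
  have := @ent_ccont (fun z => (eta%:C * 'i) * f' z) (s%:C * (eta%:C * 'i)) 1.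
  rewrite (_ : (fun t => _) = F' s).
    by apply; apply: ent_mul => //; exact: ent_cst.
  by apply/funext => t; rewrite /F' mulr1 addrC.
have dPsi s : cder Psi s (Psi' s).
  have [N N0 HN] := ent_bounded (T + (`|s| + 1) * `|eta|) ef'.
  have -> : Psi' s = cI `[- T, T] (F' s).
    rewrite (@cI_FTC _ (fun t => 'i * eta%:C * F s t))//.
    - by rewrite /Psi' mulrBr.
    - by rewrite lerNl; lra.
    move=> t; apply: cder_eq; first apply: cderM; first exact: cder_cst.
      have := df (s%:C * (eta%:C * 'i)) 1 t.
      rewrite (_ : (fun t => _) = F s); last first.
        by apply/funext => u; rewrite /F mulr1 addrC.
      exact.
    by rewrite mul0r add0r mul1r mulr1 /F' addrC (mulrC 'i%C).
  apply: (@cder_cI _ _ _ (cst (`|eta| * N))).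
  - exact: measurable_itv.
  - by move=> x; exact: ccont_cintegrable.
  - by move=> x y _; exact: df.
  - exact: integrable_cst_itv.
  - by move=> y; rewrite /= mulr_ge0.
  - move=> x y xs; rewrite /= in_itv /= => yT.
    rewrite /F' !normcM normc_real (_ : normc 'i = 1); last first.
      by rewrite /= expr0n add0r expr1n sqrtr1.
    rewrite mulr1 ler_wpM2l// HN// (le_trans (normcD _ _))// lerD//.
      by rewrite normc_real ler_norml.
    rewrite !normcM !normc_real (_ : normc 'i = 1); last first.
      by rewrite /= expr0n add0r expr1n sqrtr1.
    rewrite mulr1 ler_wpM2r// -[x](subrK s) (le_trans (ler_normD _ _))//.
    by rewrite addrC lerD2l.
have -> : cI `[- T, T] (fun u => f (u%:C + eta%:C * 'i)) = Psi 1.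
  by apply: eq_cI => u _; rewrite /F mul1r.
have -> : cI `[- T, T] (fun u => f u%:C) = Psi 0.
  by apply: eq_cI => u _; rewrite /F mul0r addr0.
have -> : 4 * (`|eta| * M) = 2 * ((`|eta| * (2 * M)) * (1 - 0)).
  by rewrite subr0; ring.
apply: (cder_mean_value ler01 dPsi) => t t01.
have [H1 H2] := Mf _ t01.
rewrite /Psi' !normcM normc_real (_ : normc 'i = 1); last first.
  by rewrite /= expr0n add0r expr1n sqrtr1.
rewrite mul1r ler_wpM2l// (le_trans (normcB _ _))// mulr_natl mulr2n.
by rewrite /F mulrA -realcM lerD.
Qed.

Lemma cI_affine (f : R -> R[i]) (tau theta a b : R) : 0 < tau -> a <= b ->
  ccont f ->
  cI `[theta + tau * a, theta + tau * b] f =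
  tau%:C * cI `[a, b] (fun u => f (theta + tau * u)).
Proof.
move=> t0 ab [c1 c2].
have main (h : R -> R) : continuous h ->
    Rintegral mu `[theta + tau * a, theta + tau * b] h =
    tau * Rintegral mu `[a, b] (fun u => h (theta + tau * u)).
  move=> ch.
  have cl : continuous (fun u : R => theta + tau * u).
    by move=> u; apply: cvgD; [exact: cvg_cst|apply: cvgMl_tmp; exact: cvg_id].
  have il (u : R) : is_derive u (1 : R) (fun u : R => theta + tau * u) tau.
    have -> : (fun u : R => theta + tau * u) = cst theta + tau *: id.
      by apply/funext.
    apply: (is_derive_eq (is_deriveD (is_derive_cst theta u 1)
      (is_deriveZ tau (is_derive_id u 1)))).
    by rewrite add0r /GRing.scale /= mulr1.
  have dl : derive1 (fun u : R => theta + tau * u) = cst tau.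
    apply/funext => u; rewrite derive1E.
    exact: (@derive_val _ _ _ _ _ _ _ (il u)).
  rewrite /Rintegral.
  rewrite (@integration_by_substitution_increasing _ (fun u => theta + tau * u) h a b)//.
  - rewrite dl -[RHS](@RintegralZl _ _ _ mu)//.
    + by congr fine; apply: eq_integral => u _ /=; rewrite mulrC.
    + apply: continuous_compact_integrable; first exact: segment_compact.
      apply: continuous_subspaceT => x; apply: continuous_comp; first exact: cl.
      exact: ch.
  - by move=> x y _ _ xy; rewrite ltrD2l ltr_pM2l.
  - by rewrite dl => x _; exact: cst_continuous.
  - by rewrite dl; exact: is_cvg_cst.
  - by rewrite dl; exact: is_cvg_cst.
  - split.
    + by move=> x _; exact: (@ex_derive _ _ _ _ _ _ _ (il x)).
    + by apply: cvg_at_right_filter; exact: cl.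
    + by apply: cvg_at_left_filter; exact: cl.
  - exact: continuous_subspaceT.
apply: complexP; rewrite ?reM ?imM /= mul0r ?subr0 ?addr0.
  exact: (main (fun u => Re (f u))).
exact: (main (fun u => Im (f u))).
Qed.

End ParametricIntegral.

(** * Powers against exponentials *)

Section GaussianBounds.
Context {R : realType}.
Implicit Types (u x y c : R) (v z : R[i]) (m n q : nat).

Lemma normc_subX (a b : R[i]) (r : R) n : normc a <= r -> normc b <= r ->
  normc (a ^+ n.+1 - b ^+ n.+1) <= n.+1%:R * normc (a - b) * r ^+ n.
Proof.
move=> ar br; have r0 : 0 <= r := le_trans (normc_ge0 a) ar.
elim: n => [|n IH]; first by rewrite !expr1 expr0 mulr1 mul1r.
have -> : a ^+ n.+2 - b ^+ n.+2 = a * (a ^+ n.+1 - b ^+ n.+1) + (a - b) * b ^+ n.+1.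
  by rewrite !(exprS _ n.+1); ring.
apply: le_trans (normcD _ _) _; rewrite !normcM normcX.
rewrite [n.+2%:R](_ : _ = n.+1%:R + 1); last by rewrite -natr1.
rewrite !mulrDl mul1r; apply: lerD.
  apply: (@le_trans _ _ (r * (n.+1%:R * normc (a - b) * r ^+ n))).
    by apply: ler_pM; rewrite ?normc_ge0.
  by rewrite exprS mulrCA.
by rewrite ler_wpM2l ?normc_ge0// lerXn2r ?nnegrE ?normc_ge0.
Qed.

(** The base 2 + v is chosen because 1 + |u| and 1 + u^2 are both at most 2 + |u|^m when m >= 2. *)
Lemma poly_le_expR c (M : nat) : 0 < c ->
  exists2 C : R, 0 <= C & forall v : R, 0 <= v -> (2 + v) ^+ M <= C * expR (c * v).
Proof.
(* Chosen so that 2 + v <= k (1 + c v / (M+1)), to which 1 + x <= e^x applies before taking the M-th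
   power. With M+1 in place of M the case M = 0 involves no division by zero. *)
move=> c0; pose k : R := 2 + M.+1%:R / c.
have k0 : 0 < k by rewrite addr_gt0// divr_gt0.
exists (k ^+ M) => [|v v0]; first by rewrite exprn_ge0// ltW.
have H : 2 + v <= k * expR (c / M.+1%:R * v).
  apply: (@le_trans _ _ (k * (1 + c / M.+1%:R * v))).
    have -> : k * (1 + c / M.+1%:R * v) =
        2 + M.+1%:R / c + 2 * (c / M.+1%:R * v) + v.
      have : M.+1%:R != 0 :> R by rewrite pnatr_eq0.
      rewrite /k; move: (M.+1%:R : R) => N N0; field.
      by rewrite N0 gt_eqF.
    have h1 : 0 <= M.+1%:R / c by rewrite divr_ge0// ltW.
    have h2 : 0 <= c / M.+1%:R * v by rewrite mulr_ge0// divr_ge0// ltW.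
    move: h1 h2; move: (M.+1%:R / c) (c / M.+1%:R * v) => p q p0 q0; lra.
  by rewrite ler_wpM2l ?(ltW k0)// expR_ge1Dx.
apply: (@le_trans _ _ ((k * expR (c / M.+1%:R * v)) ^+ M)).
  by rewrite lerXn2r ?nnegrE ?addr_ge0// mulr_ge0 ?expR_ge0// ltW.
rewrite exprMn ler_wpM2l ?exprn_ge0 ?(ltW k0)//.
rewrite -expRM_natl ler_expR.
rewrite (_ : _ * _ = M%:R / M.+1%:R * (c * v)); last first.
  by rewrite !mulrA (mulrAC _ _ c).
rewrite ler_piMl ?mulr_ge0 ?(ltW c0)//.
by rewrite ler_pdivrMr// mul1r ler_nat.
Qed.

Lemma ler_1pow x m : 0 <= x -> (1 <= m)%N -> x <= 1 + x ^+ m.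
Proof.
move=> x0 m1; have [x1|x1] := leP x 1.
  by rewrite (le_trans x1)// lerDl exprn_ge0.
by rewrite -[leLHS]add0r lerD// ler_eXnr// ltW.
Qed.

Lemma ler_sqr_pow x m : (2 <= m)%N -> 1 + x ^+ 2 <= 2 + `|x| ^+ m.
Proof.
move=> m2; rewrite -real_normK ?num_real//.
rewrite -[2 in leRHS]/(1 + 1) -addrA lerD2l.
have [x1|x1] := leP `|x| 1.
  apply: (@le_trans _ _ 1); first by rewrite exprn_ile1.
  by rewrite lerDl exprn_ge0.
by rewrite -[leLHS]add0r lerD// ler_weXn2l// ltW.
Qed.

(** [poly_le_expR] is used with exponent M+1: the additional factor absorbs the 1 + u^2 of the
    kernel. *)
Lemma gauss_kern c m (M : nat) : 0 < c -> (2 <= m)%N ->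
  exists2 C : R, 0 <= C &
  forall u, (1 + `|u|) ^+ M * expR (- (c * `|u| ^+ m)) <= C * kern u.
Proof.
move=> c0 m2; have [C C0 HC] := poly_le_expR M.+1 c0.
exists C => // u; rewrite /kern ler_pdivlMr ?ltr_pwDl ?sqr_ge0//.
rewrite expRN mulrAC ler_pdivrMr ?expR_gt0//.
have um : 0 <= `|u| ^+ m by rewrite exprn_ge0.
apply: le_trans (HC _ um); rewrite (exprSr (2 + _)).
apply: ler_pM; rewrite ?exprn_ge0 ?addr_ge0 ?sqr_ge0//.
  rewrite lerXn2r ?nnegrE ?addr_ge0//.
  by rewrite -[2]/(1 + 1) -addrA lerD2l ler_1pow// ltnW.
exact: ler_sqr_pow.
Qed.

Lemma exprDn_le x y m : 0 <= x -> 0 <= y ->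
  (x + y) ^+ m <= 2 ^+ m * (x ^+ m + y ^+ m).
Proof.
wlog xy : x y / x <= y => [H x0 y0|x0 y0].
  have [/ltW xy|xy] := ltP x y; first exact: H.
  by rewrite addrC [x ^+ m + _]addrC; exact: H.
apply: (@le_trans _ _ ((2 * y) ^+ m)).
  by rewrite lerXn2r ?nnegrE ?addr_ge0 ?mulr_ge0// mulr_natl mulr2n lerD.
by rewrite exprMn ler_wpM2l ?exprn_ge0// lerDr exprn_ge0.
Qed.

Lemma normc_powm_le v m :
  normc v ^+ m <= 2 ^+ m * (`|Re v| ^+ m + `|Im v| ^+ m).
Proof.
apply: le_trans (exprDn_le m (normr_ge0 (Re v)) (normr_ge0 (Im v))).
by rewrite lerXn2r ?nnegrE ?normc_ge0 ?addr_ge0// normc_ReIm.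
Qed.

Lemma normc_poly_le_expR c m (M : nat) : 0 < c -> (1 <= m)%N ->
  exists2 C : R, 0 <= C & forall v,
    (1 + normc v) ^+ M <= C * expR (c * (`|Re v| ^+ m + `|Im v| ^+ m)).
Proof.
move=> c0 m1; have [C C0 HC] := poly_le_expR M c0.
exists (2 ^+ M * C) => [|v]; first by rewrite mulr_ge0// exprn_ge0.
have s0 : 0 <= `|Re v| ^+ m + `|Im v| ^+ m by rewrite addr_ge0// exprn_ge0.
rewrite -mulrA; apply: le_trans (_ : 2 ^+ M * (2 + _) ^+ M <= _); last first.
  by apply: ler_wpM2l; [rewrite exprn_ge0|exact: HC].
rewrite -exprMn lerXn2r ?nnegrE ?addr_ge0 ?mulr_ge0 ?normc_ge0 ?addr_ge0//.
have h1 := ler_1pow (normr_ge0 (Re v)) m1.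
have h2 := ler_1pow (normr_ge0 (Im v)) m1.
have h3 := normc_ReIm v.
move: s0 h1 h2 h3; set a := `|Re v|; set b := `|Im v|.
set a' := a ^+ m; set b' := b ^+ m; lra.
Qed.

(** In the cone |Im v| <= k |Re v|, beta v^m is a perturbation of beta (Re v)^m, whose real part is
    Re beta |Re v|^m because m is even. Outside it |v| is at most a multiple of |Im v|, and the C1
    term dominates both |beta v^m| and c1 |Re v|^m. *)
Lemma Re_pow_ge (beta : R[i]) m : 0 < Re beta -> ~~ odd m -> (1 < m)%N ->
  exists c1 C1 : R, [/\ 0 < c1, 0 <= C1 & forall v,
    c1 * `|Re v| ^+ m - C1 * `|Im v| ^+ m <= Re (beta * v ^+ m)].
Proof.
case: m => // m b0 em m1.
set b := Re beta in b0 *; set nb := normc beta.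
have nb0 : 0 <= nb by exact: normc_ge0.
(* The exponent is now m+1. The last summand of the denominator makes the perturbation in the cone
   cost at most half of b; the summand b/2 gives k <= 1, hence |v| <= 2 |Re v| there. *)
pose k := b / 2 / (1 + b / 2 + nb * m.+1%:R * 2 ^+ m).
have d0 : 0 < 1 + b / 2 + nb * m.+1%:R * 2 ^+ m.
  by rewrite ltr_pwDl ?mulr_ge0 ?exprn_ge0// addr_gt0// divr_gt0.
have k0 : 0 < k by rewrite divr_gt0// divr_gt0.
have k1 : k <= 1.
  rewrite ler_pdivrMr// mul1r.
  have : 0 <= nb * m.+1%:R * 2 ^+ m by rewrite !mulr_ge0 ?exprn_ge0.
  by lra.
have kb : nb * m.+1%:R * 2 ^+ m * k <= b / 2.
  rewrite /k mulrCA ger_pMr ?divr_gt0// ler_pdivrMr// mul1r.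
  by lra.
exists (b / 2), (nb * (1 + k^-1) ^+ m.+1 + b / 2 * k^-1 ^+ m.+1).
split; first by rewrite divr_gt0.
  rewrite addr_ge0// mulr_ge0 ?exprn_ge0// ?addr_ge0 ?invr_ge0 ?(ltW k0)//.
  by rewrite divr_ge0// ltW.
move=> v; set x := Re v; set y := Im v.
have [yx|xy] := leP `|y| (k * `|x|).
  have vx : normc v <= 2 * `|x|.
    apply: le_trans (normc_ReIm _) _; rewrite mulr_natl mulr2n lerD2l.
    by apply: le_trans yx _; rewrite ler_piMl.
  have xx : normc x%:C <= 2 * `|x|.
    by rewrite normc_real mulr_natl mulr2n lerDl.
  have := normc_subX m vx xx.
  have -> : normc (v - x%:C) = `|y|.
    rewrite (_ : v - x%:C = 0 +i* y).
      by rewrite /= expr0n add0r sqrtr_sqr.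
    by apply: complexP; rewrite ?reD ?imD ?reN ?imN /= ?subrr ?subr0.
  move=> hd.
  have hR : normc (beta * (v ^+ m.+1 - x%:C ^+ m.+1)) <= b / 2 * `|x| ^+ m.+1.
    rewrite normcM; apply: le_trans (ler_wpM2l nb0 hd) _.
    have -> : nb * (m.+1%:R * `|y| * (2 * `|x|) ^+ m) =
              (nb * m.+1%:R * 2 ^+ m) * `|y| * `|x| ^+ m by rewrite exprMn; ring.
    apply: (@le_trans _ _ (nb * m.+1%:R * 2 ^+ m * (k * `|x|) * `|x| ^+ m)).
      rewrite ler_wpM2r ?exprn_ge0// ler_wpM2l// !mulr_ge0 ?exprn_ge0//.
    by rewrite mulrA -mulrA -exprS ler_wpM2r ?exprn_ge0.
  have -> : Re (beta * v ^+ m.+1) =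
     b * `|x| ^+ m.+1 + Re (beta * (v ^+ m.+1 - x%:C ^+ m.+1)).
    rewrite mulrBr reD reN -realcX [Re (beta * (_)%:C)]reM /= mulr0 subr0.
    by rewrite -normrX ger0_norm ?exprn_even_ge0// -/b; ring.
  have h3 := le_trans (normc_Re _) hR.
  move: h3; rewrite ler_norml => /andP[h3 _].
  have h4 : 0 <= (nb * (1 + k^-1) ^+ m.+1 + b / 2 * k^-1 ^+ m.+1) * `|y| ^+ m.+1.
    rewrite mulr_ge0 ?exprn_ge0// addr_ge0// mulr_ge0 ?exprn_ge0//.
      by rewrite addr_ge0// invr_ge0 ltW.
    by rewrite divr_ge0// ltW.
    by rewrite invr_ge0 ltW.
  rewrite lerBlDr.
  have h5 : b * `|x| ^+ m.+1 = b / 2 * `|x| ^+ m.+1 + b / 2 * `|x| ^+ m.+1.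
    by rewrite -mulrDl -splitr.
  by rewrite h5; lra.
have xk : `|x| <= k^-1 * `|y| by rewrite mulrC ler_pdivlMr// mulrC ltW.
have vy : normc v <= (1 + k^-1) * `|y|.
  apply: le_trans (normc_ReIm _) _; rewrite mulrDl mul1r addrC.
  by rewrite lerD2l.
have h1 : normc (beta * v ^+ m.+1) <= nb * ((1 + k^-1) ^+ m.+1 * `|y| ^+ m.+1).
  rewrite normcM normcX ler_wpM2l// -exprMn lerXn2r ?nnegrE ?normc_ge0//.
  by rewrite mulr_ge0// addr_ge0// invr_ge0 ltW.
have h2 : b / 2 * `|x| ^+ m.+1 <= b / 2 * (k^-1 ^+ m.+1 * `|y| ^+ m.+1).
  rewrite ler_wpM2l ?divr_ge0 ?(ltW b0)// -exprMn lerXn2r ?nnegrE//.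
  by rewrite mulr_ge0// invr_ge0 ltW.
have := le_trans (normc_Re _) h1; rewrite ler_norml => /andP[h3 _].
by rewrite lerBlDr mulrDl -!mulrA; lra.
Qed.

End GaussianBounds.

(** * Bounds for shifted and truncated integrals *)

Section ContourEstimates.
Context {R : realType}.
Implicit Types (u x y c : R) (v z : R[i]) (m n q : nat).

(* The integration line is moved to Im v = d |X|^(1/(m-1)) sgn X with d small: the
   gain d |X|^(m/(m-1)) then dominates the loss C2 d^m |X|^(m/(m-1)). *)
Lemma shift_bound m (c2 C2 A : R) : (1 < m)%N -> 0 < c2 -> 0 <= C2 -> 0 < A ->
  exists C c : R, [/\ 0 <= C, 0 < c &
  forall (D : R[i] -> R[i]) (X T y B : R), ent D -> 0 <= y ->
    `|X| = y ^+ m.-1 -> 0 <= T -> A * y <= T -> 0 <= B ->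
    (forall v, `|Re v| <= T -> `|Im v| <= T -> normc (D v) <=
      B * expR (- (X * Im v) - c2 * `|Re v| ^+ m + C2 * `|Im v| ^+ m)) ->
    normc (cI `[- T, T] (fun u => D u%:C)) <= C * B * expR (- (c * y ^+ m))].
Proof.
move=> m1 c20 C20 A0.
have [Ck Ck0 HCk] := gauss_kern 0 c20 m1.
have c24 : 0 < c2 / 4 by rewrite divr_gt0.
have [Ce Ce0 HCe] := poly_le_expR 1 c24.
have Am0 : 0 < A ^+ m by rewrite exprn_gt0.
pose K := 1 + 2 * C2.
have K0 : 0 < K by rewrite ltr_pwDl// mulr_ge0.
(* The bound 1 gives d^m <= d^2, and A keeps |eta| = d y below T. The bound 1/K makes the loss C2
   |eta|^m at most half of the gain d y^m; the last one makes it at most half of c2 T^m on the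
   vertical sides. *)
pose d := Num.min (Num.min 1 A) (Num.min K^-1 (c2 * A ^+ m / K)).
have d0 : 0 < d.
  by rewrite !lt_min ltr01 A0 invr_gt0 K0 divr_gt0// mulr_gt0.
have d1 : d <= 1 by rewrite /d !ge_min lexx.
have dA : d <= A by rewrite /d !ge_min lexx !orbT.
have dK : C2 * d <= 1 / 2.
  have : d * K <= 1.
    rewrite -ler_pdivlMr// div1r; by rewrite /d !ge_min lexx !orbT.
  by rewrite /K; nra.
have dK2 : C2 * d <= c2 * A ^+ m / 2.
  have : d * K <= c2 * A ^+ m.
    rewrite -ler_pdivlMr//; by rewrite /d !ge_min lexx !orbT.
  by rewrite /K; nra.
have dm : d ^+ m <= d * d.
  rewrite -expr2; apply: ler_wiXn2l => //; exact: ltW.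
have dm1 : d ^+ m <= d by apply: le_trans dm _; rewrite ler_piMl// ltW.
(* First rate: the shifted horizontal line. Second rate: the vertical sides. *)
pose c' := Num.min (d / 2) (c2 / 4 * A ^+ m).
have c'0 : 0 < c' by rewrite lt_min divr_gt0// mulr_gt0.
exists (2 * (Ck * pi) + 4 * Ce), c'; split => //.
  by rewrite addr_ge0 ?mulr_ge0// ?pi_ge0.
move=> D X T y B eD y0 Xy T0 AyT B0 HD.
have ym0 : 0 <= y ^+ m by rewrite exprn_ge0.
have yyT : A ^+ m * y ^+ m <= T ^+ m.
  rewrite -exprMn lerXn2r ?nnegrE// mulr_ge0// ltW//.
pose eta := d * y * (if 0 <= X then 1 else -1).
have etaE : `|eta| = d * y.
  rewrite /eta normrM [X in _ * X](_ : _ = 1) ?mulr1.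
    by rewrite ger0_norm// mulr_ge0// ltW.
  by case: ifP; rewrite ?normrN normr1.
have etaT : `|eta| <= T.
  by rewrite etaE; apply: le_trans AyT; rewrite ler_wpM2r.
have Xeta : X * eta = d * y ^+ m.
  have -> : X * eta = d * y * `|X|.
    rewrite /eta; case: ifP => X0; first by rewrite ger0_norm//; ring.
    rewrite ltr0_norm; last by rewrite ltNge X0.
    by ring.
  by rewrite Xy -mulrA -exprS prednK// ltnW.
have etam : C2 * `|eta| ^+ m <= d / 2 * y ^+ m.
  rewrite etaE exprMn mulrA ler_wpM2r//.
  apply: le_trans (ler_wpM2l C20 dm) _; rewrite mulrA.
  by rewrite (_ : d / 2 = 1 / 2 * d) ?ler_wpM2r// ?ltW//; field.
have etam2 : C2 * `|eta| ^+ m <= c2 / 2 * T ^+ m.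
  rewrite etaE exprMn mulrA.
  apply: (@le_trans _ _ (C2 * d * y ^+ m)).
    by rewrite ler_wpM2r// ler_wpM2l.
  apply: (@le_trans _ _ (c2 * A ^+ m / 2 * y ^+ m)).
    by rewrite ler_wpM2r.
  rewrite (_ : _ * y ^+ m = c2 / 2 * (A ^+ m * y ^+ m)); last by field.
  by rewrite ler_wpM2l// divr_ge0// ltW.
have imE u s : Im (u%:C + s%:C * 'i) = s.
  by rewrite imD imM /= mulr1 mul0r addr0 add0r.
have reE u s : Re (u%:C + s%:C * 'i) = u.
  by rewrite reD reM /= mulr0 mul0r subrr addr0.
have S1 : normc (cI `[- T, T] (fun u => D (u%:C + eta%:C * 'i))) <=
    2 * (Ck * pi) * B * expR (- (c' * y ^+ m)).
  have -> : 2 * (Ck * pi) * B * expR (- (c' * y ^+ m)) =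
       2 * (B * expR (- (c' * y ^+ m)) * Ck * pi) by ring.
  apply: cI_dominated; first exact: measurable_itv.
  - have := @ent_ccont _ D (eta%:C * 'i) 1 eD.
    rewrite (_ : (fun t => _) = (fun u : R => D (u%:C + eta%:C * 'i)))//.
    by apply/funext => t; rewrite mulr1 addrC.
  - by rewrite !mulr_ge0 ?expR_ge0.
  - move=> u; rewrite /= in_itv /= => uT.
    have := HD (u%:C + eta%:C * 'i); rewrite reE imE => H.
    apply: le_trans (H _ etaT) _; first by rewrite ler_norml.
    rewrite -!mulrA ler_wpM2l//.
    have h := HCk u; rewrite expr0 mul1r in h.
    apply: le_trans (ler_wpM2l (expR_ge0 (- (c' * y ^+ m))) h).
    rewrite -expRD ler_expR Xeta.
    have : c' * y ^+ m <= d / 2 * y ^+ m.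
      by rewrite ler_wpM2r// /c' ge_min lexx.
    by lra.
have S2 : normc (cI `[- T, T] (fun u => D (u%:C + eta%:C * 'i)) -
    cI `[- T, T] (fun u => D u%:C)) <= 4 * Ce * B * expR (- (c' * y ^+ m)).
  (* At Re v = -T or T, half of c2 T^m compensates the growth in Im v. Of the remaining half, one
     quarter absorbs the length |eta| <= T and the other gives decay in y, because T >= A y. *)
  apply: le_trans (contour_shift (M := B * expR (- (c2 / 2 * T ^+ m))) eD T0 _) _.
    move=> s /andP[s0 s1].
    have seta : `|s * eta| <= `|eta| by rewrite normrM ger0_norm// ler_piMl.
    have h0 : 0 <= X * (s * eta).
      by rewrite mulrCA Xeta !mulr_ge0// ltW.
    have h1 : C2 * `|s * eta| ^+ m <= C2 * `|eta| ^+ m.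
      by rewrite ler_wpM2l// lerXn2r ?nnegrE.
    have T1 : `|T| = T by rewrite ger0_norm.
    have H (e : R) : `|e| = T -> normc (D (e%:C + (s * eta)%:C * 'i)) <=
       B * expR (- (c2 / 2 * T ^+ m)).
      move=> eT; have := HD (e%:C + (s * eta)%:C * 'i).
      rewrite reE imE eT => h.
      apply: le_trans (h (lexx _) (le_trans seta etaT)) _.
      rewrite ler_wpM2l// ler_expR.
      have : c2 * T ^+ m = c2 / 2 * T ^+ m + c2 / 2 * T ^+ m.
        by rewrite -mulrDl -splitr.
      by lra.
    by split; apply: H; rewrite ?normrN.
  rewrite (_ : 4 * (_ * _) = 4 * B * (`|eta| * expR (- (c2 / 2 * T ^+ m)))); last first.
    by ring.
  rewrite (_ : 4 * Ce * B * _ = 4 * B * (Ce * expR (- (c' * y ^+ m)))); last first.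
    by ring.
  rewrite ler_wpM2l ?mulr_ge0//.
  have Tm0 : 0 <= T ^+ m by rewrite exprn_ge0.
  have h1 : `|eta| <= Ce * expR (c2 / 4 * T ^+ m).
    apply: le_trans etaT _; apply: le_trans (HCe _ Tm0); rewrite expr1.
    by have := ler_1pow T0 (ltnW m1); lra.
  apply: (@le_trans _ _ (Ce * expR (c2 / 4 * T ^+ m) * expR (- (c2 / 2 * T ^+ m)))).
    by rewrite ler_wpM2r ?expR_ge0.
  rewrite -mulrA ler_wpM2l// -expRD ler_expR.
  have h2 : c' * y ^+ m <= c2 / 4 * A ^+ m * y ^+ m.
    by rewrite ler_wpM2r// /c' ge_min lexx orbT.
  have h3 : c2 / 4 * A ^+ m * y ^+ m <= c2 / 4 * T ^+ m.
    by rewrite -mulrA ler_wpM2l// ltW.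
  have h4 : c2 / 2 * T ^+ m = c2 / 4 * T ^+ m + c2 / 4 * T ^+ m.
    by field.
  by rewrite h4; lra.
have := lerD S1 S2; rewrite -!mulrDl; apply: le_trans.
apply: le_trans (normcB _ _).
by rewrite opprB addrCA subrr addr0.
Qed.

(** Half of the exponent is spent on the integrable kernel; outside [-T, T] the other half is at
    most e^(-c T^m / 2). *)
Lemma tail_bound m c : (1 < m)%N -> 0 < c -> exists2 C : R, 0 <= C &
  forall (f : R -> R[i]) (B T : R), ccont f -> 0 <= B -> 0 <= T ->
  (forall u, normc (f u) <= B * expR (- (c * `|u| ^+ m))) ->
  cintegrable setT f /\
  normc (cI setT f - cI `[- T, T] f) <= C * B * expR (- (c / 2 * T ^+ m)).
Proof.
move=> m1 c0.
have c20 : 0 < c / 2 by rewrite divr_gt0.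
have [Ck Ck0 HCk] := gauss_kern 0 c20 m1.
exists (2 * (Ck * pi)) => [|f B T cf B0 T0 Hf].
  by rewrite !mulr_ge0// pi_ge0.
have fi : cintegrable setT f.
  apply: (@cintegrable_dominated _ _ _ (B * Ck)) => // u _.
  apply: le_trans (Hf u) _; rewrite -mulrA ler_wpM2l//.
  have := HCk u; rewrite expr0 mul1r; apply: le_trans.
  rewrite ler_expR lerN2 ler_wpM2r ?exprn_ge0//; lra.
split => //.
have mT : measurable (`[- T, T] : set (measurableTypeR R)) by exact: measurable_itv.
rewrite (cI_setD mT measurableT (@subsetT _ _) fi) addrC addrA addNr add0r.
have -> : 2 * (Ck * pi) * B * expR (- (c / 2 * T ^+ m)) =
    2 * (B * expR (- (c / 2 * T ^+ m)) * Ck * pi) by ring.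
apply: cI_dominated => //.
- exact: measurableD.
- by rewrite !mulr_ge0 ?expR_ge0.
- move=> u [_]; rewrite /= in_itv /= => /negP uT.
  have {}uT : T <= `|u|.
    by rewrite leNgt; apply: contra uT; rewrite ltr_norml => /andP[/ltW-> /ltW->].
  apply: le_trans (Hf u) _; rewrite -(mulrA (B * _)) -(mulrA B) ler_wpM2l//.
  have h := HCk u; rewrite expr0 mul1r in h.
  apply: le_trans (ler_wpM2l (expR_ge0 (- (c / 2 * T ^+ m))) h).
  rewrite -expRD ler_expR.
  have h1 : c / 2 * T ^+ m <= c / 2 * `|u| ^+ m.
    by rewrite ler_wpM2l ?(ltW c20)// lerXn2r ?nnegrE.
  have h2 : c * `|u| ^+ m = c / 2 * `|u| ^+ m + c / 2 * `|u| ^+ m.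
    by rewrite -mulrDl -splitr.
  by rewrite h2; lra.
Qed.

End ContourEstimates.

(** * Derivatives of the generalized Gaussians *)

Section GeneralizedGaussian.
Context {R : realType}.
Implicit Types (u x y c : R) (v z : R[i]) (m n q : nat).

(** The integrand of 2 pi times the q-th derivative of H, for complex v: each derivative in x brings
    down one factor i v. *)
Definition Hint m (beta : R[i]) q x v : R[i] :=
  ('i * v) ^+ q * (cexp ('i * (x%:C * v)) * cexp (- (beta * v ^+ m))).

Lemma ent_Hint m beta q x : ent (Hint m beta q x).
Proof.
apply: ent_mul; first by apply: ent_exp; apply: ent_mul; [exact: ent_cst|exact: ent_id].
apply: ent_mul; apply: ent_cexp.
  by do 2 (apply: ent_mul; first exact: ent_cst); exact: ent_id.
apply: ent_opp; apply: ent_mul; first exact: ent_cst.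
by apply: ent_exp; exact: ent_id.
Qed.

Lemma normc_i : normc ('i : R[i]) = 1.
Proof. by rewrite /= expr0n add0r expr1n sqrtr1. Qed.

Lemma normc_Hint m beta q x v : normc (Hint m beta q x v) =
  normc v ^+ q * expR (- (x * Im v) - Re (beta * v ^+ m)).
Proof.
rewrite /Hint normcM normcX (normcM 'i) normc_i mul1r (normcM (cexp _)).
rewrite !normc_cexp -expRD.
have -> : Re ('i * (x%:C * v)) = - (x * Im v).
  by rewrite reM /= mul0r mul1r sub0r imM /= mul0r addr0.
by rewrite reN.
Qed.

Lemma Hint_real m beta q x u : 0 < Re beta -> ~~ odd m ->
  normc (Hint m beta q x u%:C) = `|u| ^+ q * expR (- (Re beta * `|u| ^+ m)).
Proof.
move=> b0 em; rewrite normc_Hint normc_real /= mulr0 oppr0 add0r.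
have -> : `|u| ^+ m = u ^+ m by rewrite -normrX ger0_norm// exprn_even_ge0.
by rewrite -realcX reM /= mulr0 subr0.
Qed.

Lemma Hint_kern m beta q : 0 < Re beta -> ~~ odd m -> (1 < m)%N ->
  exists2 C : R, 0 <= C & forall x u, normc (Hint m beta q x u%:C) <= C * kern u.
Proof.
move=> b0 em m1; have [C C0 HC] := gauss_kern q b0 m1.
exists C => // x u; rewrite Hint_real//; apply: le_trans (HC u).
by rewrite ler_wpM2r ?expR_ge0// lerXn2r ?nnegrE// lerDr.
Qed.

Lemma Hint_ccont m beta q x : ccont (fun u : R => Hint m beta q x u%:C).
Proof.
have -> : (fun u : R => Hint m beta q x u%:C) =
    (fun t : R => Hint m beta q x (0 + t%:C * 1)).
  by apply/funext => t; congr Hint; rewrite mulr1 add0r.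
exact: (ent_ccont 0 1 (ent_Hint m beta q x)).
Qed.

Lemma Hint_cintegrable m beta q x : 0 < Re beta -> ~~ odd m -> (1 < m)%N ->
  cintegrable setT (fun u : R => Hint m beta q x u%:C).
Proof.
move=> b0 em m1; have [C C0 HC] := Hint_kern q b0 em m1.
by apply: (@cintegrable_dominated _ _ _ C) => //; exact: Hint_ccont.
Qed.

Lemma cder_cI_Hint m beta q x : 0 < Re beta -> ~~ odd m -> (1 < m)%N ->
  cder (fun x => cI setT (fun u : R => Hint m beta q x u%:C)) x
    (cI setT (fun u : R => Hint m beta q.+1 x u%:C)).
Proof.
move=> b0 em m1; have [C C0 HC] := Hint_kern q.+1 b0 em m1.
apply: (@cder_cI _ _ (fun x u => Hint m beta q x u%:C)
  (fun x u => Hint m beta q.+1 x u%:C) (fun u => C * kern u)) => //.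
- by move=> z; exact: Hint_cintegrable.
- move=> z u _; rewrite /Hint.
  apply: cder_eq.
    apply: cderM; first exact: cder_cst.
    apply: cderM; last exact: cder_cst.
    apply: cder_cexp; apply: cderM; first exact: cder_cst.
    by apply: cderM; [exact: cder_realc|exact: cder_cst].
  by rewrite exprS; ring.
- by apply: integrable_realZ => //; exact: integrable_kern.
- by move=> u; rewrite mulr_ge0// ltW// kern_gt0.
Qed.

Lemma cderiven_Hfun (mu : nat) beta q x : 0 < Re beta -> (0 < mu)%N ->
  cderiven q (Hfun mu beta) x =
  ((2 * pi)^-1)%:C * cI setT (fun u : R => Hint (2 * mu) beta q x u%:C).
Proof.
move=> b0 mu0; set m := (2 * mu)%N.
have em : ~~ odd m by rewrite /m mul2n odd_double.
have m1 : (1 < m)%N by rewrite /m; lia.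
pose G q (x : R) : R[i] :=
  ((2 * pi)^-1)%:C * cI setT (fun u : R => Hint m beta q x u%:C).
have dG k (t : R) : cder (G k) t (G k.+1 t).
  apply: cder_eq; first apply: cderM; first exact: cder_cst.
    exact: cder_cI_Hint.
  by rewrite mul0r add0r.
have G0 : Hfun mu beta = G 0%N.
  apply/funext => t; rewrite /Hfun /G; congr (_ * _).
  rewrite /cintegral -/(cI setT _); apply: eq_cI => u _.
  by rewrite /Hint expr0 mul1r realcM realcX.
have H k : derive1n k (fun t => Re (Hfun mu beta t)) = (fun t => Re (G k t)) /\
    derive1n k (fun t => Im (Hfun mu beta t)) = (fun t => Im (G k t)).
  elim: k => [|k [IH1 IH2]]; first by rewrite G0.
  rewrite !derive1nS IH1 IH2; split; apply/funext => t; rewrite derive1E.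
    have [d1 _] := dG k t; exact: (@derive_val _ _ _ _ _ _ _ d1).
  have [_ d2] := dG k t; exact: (@derive_val _ _ _ _ _ _ _ d2).
have [h1 h2] := H q.
by rewrite /cderiven h1 h2 -/(G q x); apply: complexP.
Qed.

End GeneralizedGaussian.

(** * Flat polynomials and truncated binomial sums *)

Section PowerExpansion.
Context {R : realType}.
Implicit Types (v z w : R[i]) (m n s k : nat) (p q : {poly R[i]}).

(** Letting x tend to 0 kills the constant coefficient; dividing by x then lowers both the size and
    d by one. *)
Lemma poly_flat_eq0 q d (C e : R) : (size q <= d)%N -> 0 < e ->
  (forall x : R, 0 < x <= e -> normc q.[x%:C] <= C * x ^+ d) -> q = 0.
Proof.
elim: d q => [|d IH] q; first by rewrite leqn0 size_poly_eq0 => /eqP.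
move=> + e0 Hq.
have [q' [c qE]] : exists q' c, q = q' * 'X + c%:P.
  elim/poly_ind: q {Hq} => [|q c _]; last by exists q, c.
  by exists 0, 0; rewrite mul0r add0r.
have [N N0 HN] := ent_bounded 1 (ent_horner q').
have qx (x : R) : q.[x%:C] = q'.[x%:C] * x%:C + c by rewrite qE hornerMXaddC.
have c0 : c = 0.
  apply: Normc.eq0_normc; apply/eqP; rewrite eq_le normc_ge0 andbT.
  apply/ler_addgt0Pr => r r0; rewrite add0r.
  pose L := 1 + `|C| + N.
  have L0 : 0 < L by rewrite /L -addrA ltr_pwDl// addr_ge0.
  pose x := Num.min (Num.min 1 e) (r / L).
  have x0 : 0 < x by rewrite !lt_min ltr01 e0 divr_gt0.
  have x1 : x <= 1 by rewrite !ge_min lexx.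
  have xe : x <= e by rewrite !ge_min lexx orbT.
  have xr : x * L <= r by rewrite -ler_pdivlMr// ge_min lexx orbT.
  have h1 : normc q.[x%:C] <= `|C| * x.
    apply: le_trans (Hq x _) _; first by rewrite x0.
    apply: le_trans (_ : `|C| * x ^+ d.+1 <= _).
      by rewrite ler_wpM2r ?ler_norm// exprn_ge0// ltW.
    by rewrite ler_wpM2l// exprS ler_piMr ?exprn_ile1 ?(ltW x0).
  have h2 : normc (q'.[x%:C] * x%:C) <= N * x.
    rewrite normcM normc_real (gtr0_norm x0) ler_wpM2r ?(ltW x0)// HN//.
    by rewrite normc_real gtr0_norm.
  have -> : c = q.[x%:C] - q'.[x%:C] * x%:C by rewrite qx addrC addKr.
  apply: le_trans (normcB _ _) _; apply: le_trans xr.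
  by move: (lerD h1 h2); rewrite /L; nra.
rewrite qE size_MXaddC c0 eqxx andbT addr0 => hs.
rewrite (IH q') ?mul0r//.
  by move: hs; case: eqP => [->|_]; rewrite ?size_poly0.
move=> x /andP[x0 xe]; have := Hq x; rewrite x0 xe qx c0 addr0 => /(_ isT).
by rewrite normcM normc_real gtr0_norm// exprSr mulrA ler_pM2r.
Qed.

(** By Pascal's rule the remainders satisfy R(s+1, n+1) = R(s+1, n) + w R(s, n). The induction runs
    on the sharper bound with (1 + |w|)^n, which is compatible with this recursion; the exponential
    comes at the end. *)
Lemma binomial_tail w s n :
  normc ((1 + w) ^+ n - \sum_(k < s) 'C(n, k)%:R * w ^+ k) <=
  (n%:R * normc w) ^+ s * expR (n%:R * normc w).
Proof.
suff H : normc ((1 + w) ^+ n - \sum_(k < s) 'C(n, k)%:R * w ^+ k) <=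
    (n%:R * normc w) ^+ s * (1 + normc w) ^+ n.
  apply: le_trans H _; rewrite ler_wpM2l ?exprn_ge0 ?mulr_ge0 ?normc_ge0//.
  rewrite expRM_natl lerXn2r ?nnegrE ?addr_ge0 ?normc_ge0 ?expR_ge0//.
  exact: expR_ge1Dx.
elim: s n => [n|s IHs].
  rewrite big_ord0 subr0 expr0 mul1r normcX lerXn2r ?nnegrE ?addr_ge0 ?normc_ge0//.
  by apply: le_trans (normcD _ _) _; rewrite normc1.
elim=> [|n IHn].
  rewrite big_ord_recl big1 => [|i _]; last by rewrite bin0n mul0r.
  by rewrite !expr0 bin0 mulr1 addr0 subrr normc0 mulr_ge0 ?exprn_ge0 ?mulr_ge0 ?normc_ge0// addr_ge0 ?normc_ge0.
pose S (s n : nat) := \sum_(k < s) 'C(n, k)%:R * w ^+ k.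
have -> : (1 + w) ^+ n.+1 - S s.+1 n.+1 =
    ((1 + w) ^+ n - S s.+1 n) + w * ((1 + w) ^+ n - S s n).
  have -> : S s.+1 n.+1 = S s.+1 n + w * S s n.
    rewrite /S [LHS]big_ord_recl [X in _ = X + _]big_ord_recl !bin0 -addrA.
    congr (_ + _); rewrite mulr_sumr -big_split /=; apply: eq_bigr => i _.
    by rewrite /bump add1n binS natrD mulrDl; congr (_ + _); rewrite exprS mulrCA.
  by rewrite exprS; ring.
apply: le_trans (normcD _ _) _; rewrite normcM.
set a := normc w in IHn IHs *; have a0 : 0 <= a by exact: normc_ge0.
have n1 : n.+1%:R = n%:R + 1 :> R by rewrite -natr1.
apply: (@le_trans _ _ ((n%:R * a) ^+ s.+1 * (1 + a) ^+ n +
                       a * ((n%:R * a) ^+ s * (1 + a) ^+ n))).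
  by rewrite lerD// ler_wpM2l.
have -> : (n%:R * a) ^+ s.+1 * (1 + a) ^+ n + a * ((n%:R * a) ^+ s * (1 + a) ^+ n) =
   (n.+1%:R * a) * (n%:R * a) ^+ s * (1 + a) ^+ n by rewrite n1 exprS; ring.
rewrite [(n.+1%:R * a) ^+ s.+1]exprS.
apply: ler_pM.
- by rewrite !mulr_ge0 ?exprn_ge0// mulr_ge0.
- by rewrite exprn_ge0// addr_ge0.
- rewrite ler_wpM2l ?mulr_ge0// lerXn2r ?nnegrE ?mulr_ge0// ler_wpM2r//.
  by rewrite ler_nat.
- by rewrite ler_weXn2l// lerDl.
Qed.

Lemma horner_growth p : exists2 C : R, 0 <= C &
  forall v, normc p.[v] <= C * (1 + normc v) ^+ size p.
Proof.
exists (\sum_(i < size p) normc p`_i) => [|v].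
  by rewrite sumr_ge0// => i _; exact: normc_ge0.
rewrite horner_coef mulr_suml; apply: le_trans (normc_sum _ _ _) _.
apply: ler_sum => i _; rewrite normcM normcX ler_wpM2l ?normc_ge0//.
apply: (@le_trans _ _ ((1 + normc v) ^+ i)).
  by rewrite lerXn2r ?nnegrE ?addr_ge0 ?normc_ge0// lerDr.
by rewrite ler_weXn2l ?lerDl ?normc_ge0// ltnW.
Qed.

Lemma horner_growth_family (Q : nat -> {poly R[i]}) (S : nat) :
  exists (C : R) (M : nat), 0 <= C /\
  forall v, \sum_(i < S) normc (Q i).[v] <= C * (1 + normc v) ^+ M.
Proof.
elim: S => [|S [C [M [C0 HC]]]].
  by exists 0, 0%N; split => // v; rewrite big_ord0 mul0r.
have [C' C'0 HC'] := horner_growth (Q S).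
exists (C + C'), (M + size (Q S))%N; split => [|v]; first exact: addr_ge0.
have v1 : 1 <= 1 + normc v by rewrite lerDl normc_ge0.
rewrite big_ord_recr /= mulrDl lerD//.
  apply: le_trans (HC v) _; rewrite ler_wpM2l// ler_weXn2l// leq_addr//.
apply: le_trans (HC' v) _; rewrite ler_wpM2l// ler_weXn2l// leq_addl//.
Qed.

Lemma ffact_prod n k : (n ^_ k)%:R = \prod_(i < k) (n%:R - i%:R) :> R[i].
Proof.
elim: k => [|k IH]; first by rewrite big_ord0 ffactn0.
rewrite big_ord_recr /= -IH ffactnSr natrM.
have [kn|nk] := leqP k n; first by rewrite natrB.
by rewrite ffact_small// !mul0r.
Qed.

(* With n t^m = 1, 'C(n, k) t^(m k) = (1/k!) prod_(i < k) (1 - i t^m) is a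
   polynomial in t, so the truncated binomial sum is a polynomial in t and v. *)
Lemma binomial_scaled m s (T : {poly R[i]}) : exists B : {poly {poly R[i]}},
  forall n (t v : R[i]), n%:R * t ^+ m = 1 ->
  \sum_(k < s) 'C(n, k)%:R * ((t * v) ^+ m.+1 * T.[t * v]) ^+ k = B.[t%:P].[v].
Proof.
(* The outer variable stands for t and the inner one for v, so that [Tq] is T(t v). In this encoding
   the coefficient of t^i is a polynomial in v. *)
pose Tq : {poly {poly R[i]}} :=
  \sum_(i < size T) (T`_i *: 'X^i)%:P * 'X^i.
pose cc (z : R[i]) : {poly {poly R[i]}} := (z%:P)%:P.
pose Xm : {poly {poly R[i]}} := (('X^(m.+1) : {poly R[i]}))%:P.
pose Pk k : {poly {poly R[i]}} := \prod_(i < k) (cc 1 - cc i%:R * 'X^m).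
pose B : {poly {poly R[i]}} :=
  \sum_(k < s) cc (k`!%:R^-1) * Pk k * ('X * Xm * Tq) ^+ k.
exists B => n t v nt.
have TqE : Tq.[t%:P].[v] = T.[t * v].
  rewrite /Tq !horner_sum horner_coef; apply: eq_bigr => i _.
  rewrite hornerM hornerXn hornerC hornerM horner_exp hornerC hornerZ hornerXn.
  by rewrite exprMn mulrAC mulrA.
have ccE z : (cc z).[t%:P].[v] = z by rewrite /cc !hornerC.
have XmE : Xm.[t%:P].[v] = v ^+ m.+1 by rewrite /Xm hornerC hornerXn.
have PkE k : (Pk k).[t%:P].[v] = \prod_(i < k) (1 - i%:R * t ^+ m).
  rewrite /Pk !horner_prod; apply: eq_bigr => i _.
  rewrite hornerD hornerN hornerM hornerXn.
  rewrite hornerD hornerN hornerM horner_exp !ccE hornerC.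
  by [].
rewrite /B !horner_sum; apply: eq_bigr => k _.
have evM (P Q : {poly {poly R[i]}}) :
    (P * Q).[t%:P].[v] = P.[t%:P].[v] * Q.[t%:P].[v].
  by rewrite hornerM hornerM.
have evX (P : {poly {poly R[i]}}) : (P ^+ k).[t%:P].[v] = P.[t%:P].[v] ^+ k.
  by rewrite horner_exp horner_exp.
have XE : ('X : {poly {poly R[i]}}).[t%:P].[v] = t by rewrite hornerX hornerC.
rewrite evM evM evX evM evM ccE PkE XE XmE TqE.
have kf : (k`!)%:R != 0 :> R[i] by rewrite pnatr_eq0 -lt0n fact_gt0.
have -> : 'C(n, k)%:R = (k`!)%:R^-1 * (n ^_ k)%:R :> R[i].
  by rewrite -bin_ffact natrM mulrCA mulVf// mulr1.
have -> : \prod_(i < k) (1 - i%:R * t ^+ m) = (n ^_ k)%:R * (t ^+ m) ^+ k :> R[i].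
  have -> : (t ^+ m) ^+ k = \prod_(i < k) t ^+ m by rewrite prodr_const card_ord.
  rewrite ffact_prod -big_split /=.
  by apply: eq_bigr => i _; rewrite mulrBl nt.
rewrite -[LHS]mulrA -[RHS]mulrA; congr (_ * _).
rewrite -[RHS]mulrA; congr (_ * _).
rewrite -exprMn; congr (_ ^+ _); rewrite exprMn [t ^+ m.+1]exprS.
by move: (t ^+ m) (v ^+ m.+1) T.[t * v] => a b c; ring.
Qed.

End PowerExpansion.

(** * Expansion of g(tau v)^n in powers of tau *)

Section PowerExpansionMain.
Context {R : realType}.
Implicit Types (v z w : R[i]) (m n s k : nat) (p q : {poly R[i]}).

(** Flatness is assumed on a real segment only. There it forces the part of degree at most m of the
    Taylor polynomial of g - 1 to be O(x^(m+1)), hence zero, and the Taylor estimate then holds on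
    the complex disc. *)
Lemma taylor_flat m s (g : R[i] -> R[i]) (e M : R) : ent g -> 0 < e ->
  (forall x : R, `|x| <= e -> normc (g x%:C - 1) <= M * `|x| ^+ m.+1) ->
  exists (T : {poly R[i]}) (C : R), 0 <= C /\ forall z, normc z <= 1 ->
    normc (T.[z]) <= C /\
    normc (g z - (1 + z ^+ m.+1 * T.[z])) <= C * normc z ^+ (m.+1 + s).
Proof.
move=> eg e0 Hg.
have [p [C [C0 HC]]] := ent_taylor (m.+1 + s) eg.
pose low := take_poly m.+1 (p - 1).
pose T := drop_poly m.+1 (p - 1).
have pE z : p.[z] = 1 + low.[z] + z ^+ m.+1 * T.[z].
  have : p = 1 + (low + T * 'X^(m.+1)).
    by rewrite /low /T poly_take_drop addrC subrK.
  move=> {1}->; rewrite hornerD hornerC hornerD hornerM hornerXn addrA.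
  by rewrite (mulrC T.[z]).
have [N N0 HN] := ent_bounded 1 (ent_horner T).
have low0 : low = 0.
  apply: (@poly_flat_eq0 _ low m.+1 (C + `|M| + N) (Num.min 1 e)).
  - exact: size_take_poly.
  - by rewrite lt_min ltr01.
  move=> x /andP[x0]; rewrite le_min => /andP[x1 xe].
  have nx : normc x%:C = x by rewrite normc_real gtr0_norm.
  have xm : 0 <= x ^+ m.+1 by rewrite exprn_ge0// ltW.
  have h1 : normc (g x%:C - p.[x%:C]) <= C * x ^+ m.+1.
    apply: le_trans (HC _ _) _; first by rewrite nx.
    rewrite nx ler_wpM2l// exprD ler_piMr// exprn_ile1// ltW//.
  have h2 : normc (g x%:C - 1) <= `|M| * x ^+ m.+1.
    apply: le_trans (Hg x _) _; first by rewrite gtr0_norm.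
    by rewrite gtr0_norm// ler_wpM2r// ler_norm.
  have h3 : normc (x%:C ^+ m.+1 * T.[x%:C]) <= N * x ^+ m.+1.
    rewrite normcM normcX nx mulrC ler_wpM2r// HN// nx//.
  have -> : low.[x%:C] = (g x%:C - 1) - (g x%:C - p.[x%:C]) - x%:C ^+ m.+1 * T.[x%:C].
    by rewrite pE; ring.
  apply: le_trans (normcB _ _) _; rewrite mulrDl lerD//.
  by apply: le_trans (normcB _ _) _; rewrite mulrDl addrC lerD.
exists T, (C + N); split; first exact: addr_ge0.
move=> z z1; split; first by apply: le_trans (HN z z1) _; rewrite lerDr.
have := HC z z1; rewrite pE low0 horner0 addr0 => h.
by apply: le_trans h _; rewrite ler_wpM2r ?exprn_ge0 ?normc_ge0// lerDl.
Qed.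

(** Three errors add up: replacing g by 1 + V with V = z^(m+1) T(z), truncating the binomial sum,
    and dropping the powers of tau from s on. All are controlled by n |V| <= C1 tau |v|^(m+1) <= C1
    eps |v|^m; the factor eps in the exponent is what lets a Gaussian absorb it later. *)
Lemma power_expansion m s (g : R[i] -> R[i]) (e M : R) : (0 < m)%N -> ent g -> 0 < e ->
  (forall x : R, `|x| <= e -> normc (g x%:C - 1) <= M * `|x| ^+ m.+1) ->
  exists (Q : nat -> {poly R[i]}) (C K : R) (N : nat), [/\ 0 <= C, 0 <= K &
    forall n (tau eps : R) v, (0 < n)%N -> 0 < tau -> n%:R * tau ^+ m = 1 ->
      eps <= 1 -> tau * normc v <= eps ->
      normc (g (tau%:C * v) ^+ n - \sum_(i < s) tau%:C ^+ i * (Q i).[v]) <=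
      C * tau ^+ s * (1 + normc v) ^+ N * expR (K * eps * normc v ^+ m)].
Proof.
move=> m0 eg e0 Hg.
have [T [C1 [C10 HT]]] := taylor_flat s eg e0 Hg.
have [B HB] := binomial_scaled m s T.
(* A common length for B and the truncated sum, so that their difference is the sum over s <= i < S
   even when B has fewer than s coefficients. *)
pose S := maxn s (size B).
have [C3 [N3 [C30 HC3]]] := horner_growth_family (fun i => B`_i) S.
pose N := (m.+1 + s + m.+1 * s + N3)%N.
have hN1 : (m.+1 + s <= N)%N by rewrite /N -addnA leq_addr.
have hN2 : (m.+1 * s <= N)%N by rewrite /N addnAC leq_addl.
have hN3 : (N3 <= N)%N by rewrite /N leq_addl.
move: N hN1 hN2 hN3 => N hN1 hN2 hN3.
exists (fun i => B`_i), (C1 + C1 ^+ s + C3), (C1 + C1), N.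
split; [by rewrite !addr_ge0 ?exprn_ge0|exact: addr_ge0|].
move=> n tau eps v n0 t0 nt eps1 tv.
have tm0 : 0 < tau ^+ m by rewrite exprn_gt0.
have t1 : tau <= 1.
  rewrite leNgt; apply/negP => t1.
  have h : 1 <= tau ^+ m by rewrite exprn_ege1// ltW.
  have n1 : 1 <= n%:R :> R by rewrite ler1n.

  have h' : 1 < tau ^+ m by rewrite exprn_egt1// -lt0n.
  by move: nt; nra.
set a := normc v in tv *; have a0 : 0 <= a by exact: normc_ge0.
set z := tau%:C * v.
have nz : normc z = tau * a by rewrite /z normcM normc_real gtr0_norm.
have z1 : normc z <= 1 by rewrite nz (le_trans tv).
have [HT1 HT2] := HT z z1.
set V := z ^+ m.+1 * T.[z] in HT2.
have V_le : normc V <= C1 * (tau * a) ^+ m.+1.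
  by rewrite normcM normcX nz mulrC ler_wpM2r// exprn_ge0// mulr_ge0// ltW.
have ta0 : 0 <= tau * a by rewrite mulr_ge0// ltW.
have nt1 : n%:R * (tau * a) ^+ m.+1 = tau * a ^+ m.+1.
  by rewrite exprMn exprSr mulrA mulrA nt mul1r.
have nt2 : n%:R * (tau * a) ^+ m.+1 <= eps * a ^+ m.
  by rewrite nt1 exprS mulrA ler_wpM2r ?exprn_ge0.
have nt0 : 0 <= n%:R * (tau * a) ^+ m.+1.
  by rewrite mulr_ge0// exprn_ge0.
have a1 : 1 <= 1 + a by rewrite lerDl.
pose E := expR ((C1 + C1) * eps * a ^+ m).
have ea0 : 0 <= eps * a ^+ m := le_trans nt0 nt2.
have E1 : 1 <= E by rewrite -expR0 ler_expR -mulrA mulr_ge0// addr_ge0.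
have ts0 : 0 <= tau ^+ s by rewrite exprn_ge0// ltW.
have aN k : (k <= N)%N -> a ^+ k <= (1 + a) ^+ N.
  move=> kN; apply: (@le_trans _ _ ((1 + a) ^+ k)).
    by rewrite lerXn2r ?nnegrE ?addr_ge0// lerDr.
  by rewrite ler_weXn2l.
have H1 : normc (g z ^+ n - (1 + V) ^+ n) <= C1 * tau ^+ s * (1 + a) ^+ N * E.
  (* A common bound for |g z| and |1 + V|: one C1 bounds V, the other the Taylor error. Its n-th
     power is at most [E], and the factor n from the difference of n-th powers is absorbed by n
     tau^m = 1. *)
  pose r := 1 + (C1 + C1) * (tau * a) ^+ m.+1.
  have zm0 : 0 <= (tau * a) ^+ m.+1 by rewrite exprn_ge0.
  have Vr : normc (1 + V) <= r.
    apply: le_trans (normcD _ _) _; rewrite normc1 lerD2l.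
    apply: le_trans V_le _; rewrite ler_wpM2r// lerDl//.
  have gr : normc (g z) <= r.
    rewrite -(subrK (1 + V) (g z)); apply: le_trans (normcD _ _) _.
    rewrite addrC /r mulrDl addrA; apply: lerD.
      by apply: le_trans (normcD _ _) _; rewrite normc1 lerD2l.
    apply: le_trans HT2 _; rewrite nz exprD mulrA ler_piMr ?mulr_ge0//.
    by rewrite exprn_ile1// -nz.
  case: n n0 nt nt1 nt2 nt0 {HB} => // n _ nt nt1 nt2 nt0.
  apply: le_trans (normc_subX n gr Vr) _.
  have rE : r ^+ n <= E.
    apply: (@le_trans _ _ (r ^+ n.+1)).
      rewrite ler_weXn2l// lerDl mulr_ge0// addr_ge0//.
    apply: (@le_trans _ _ (expR ((C1 + C1) * (tau * a) ^+ m.+1) ^+ n.+1)).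
      by rewrite lerXn2r ?nnegrE ?expR_ge0 ?addr_ge0 ?mulr_ge0 ?addr_ge0// expR_ge1Dx.
    rewrite -expRM_natl ler_expR mulrCA -mulrA ler_wpM2l//.
    by rewrite addr_ge0.
  apply: ler_pM => //; rewrite ?mulr_ge0 ?normc_ge0 ?exprn_ge0 ?addr_ge0 ?mulr_ge0 ?addr_ge0//.
  apply: (@le_trans _ _ (n.+1%:R * (C1 * (tau * a) ^+ (m.+1 + s)))).
    by rewrite ler_wpM2l// -nz.
  rewrite exprD mulrCA -mulrA ler_wpM2l// mulrA nt1 exprMn.
  rewrite [leLHS](_ : _ = tau * (tau ^+ s * a ^+ (m.+1 + s))); last first.
    by rewrite (exprD a m.+1 s); ring.
  apply: (@le_trans _ _ (tau ^+ s * a ^+ (m.+1 + s))).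
    by rewrite ler_piMl// mulr_ge0// exprn_ge0.
  by rewrite ler_wpM2l ?aN.
have H2 : normc ((1 + V) ^+ n - \sum_(k < s) 'C(n, k)%:R * V ^+ k) <=
    C1 ^+ s * tau ^+ s * (1 + a) ^+ N * E.
  have nV : n%:R * normc V <= C1 * (tau * a ^+ m.+1).
    by rewrite -nt1 mulrCA ler_wpM2l.
  have nV0 : 0 <= n%:R * normc V by rewrite mulr_ge0 ?normc_ge0.
  apply: le_trans (binomial_tail V s n) _.
  apply: ler_pM; rewrite ?exprn_ge0 ?expR_ge0//; last first.
    rewrite ler_expR; apply: le_trans nV _; rewrite -nt1 -mulrA.
    by apply: ler_pM => //; rewrite lerDl.
  apply: (@le_trans _ _ ((C1 * (tau * a ^+ m.+1)) ^+ s)).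
    by rewrite lerXn2r ?nnegrE// mulr_ge0// mulr_ge0 ?exprn_ge0// ltW.
  rewrite !exprMn -exprM -mulrA ler_wpM2l ?exprn_ge0//.
  by rewrite ler_wpM2l ?aN.
have H3 : normc (\sum_(k < s) 'C(n, k)%:R * V ^+ k -
    \sum_(i < s) tau%:C ^+ i * (B`_i).[v]) <= C3 * tau ^+ s * (1 + a) ^+ N * E.
  have ntC : n%:R * tau%:C ^+ m = 1 :> R[i].
    by rewrite -realcX -(rmorph_nat (real_complex R)) -realcM nt.
  have BE : B.[(tau%:C)%:P].[v] = \sum_(i < S) tau%:C ^+ i * (B`_i).[v].
    rewrite (horner_coef_wide _ (leq_maxr s (size B))) horner_sum.
    by apply: eq_bigr => i _; rewrite hornerM horner_exp hornerC mulrC.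
  rewrite (HB n _ v ntC) BE.
  have -> : \sum_(i < S) tau%:C ^+ i * (B`_i).[v] -
     \sum_(i < s) tau%:C ^+ i * (B`_i).[v] =
     \sum_(i < S | (s <= i)%N) tau%:C ^+ i * (B`_i).[v].
    rewrite (big_ord_widen S (fun i => tau%:C ^+ i * (B`_i).[v]) (leq_maxl s (size B))).
    rewrite [X in X - _](bigID (fun i : 'I_S => (i < s)%N)) /= addrAC subrr add0r.
    by apply: eq_bigl => i; rewrite -leqNgt.
  apply: le_trans (normc_sum _ _ _) _.
  apply: (@le_trans _ _ (\sum_(i < S) tau ^+ s * normc (B`_i).[v])).
    rewrite [leRHS](bigID (fun i : 'I_S => (s <= i)%N)) /= -[leLHS]addr0.
    apply: lerD; last first.
      by apply: sumr_ge0 => i _; rewrite mulr_ge0// normc_ge0.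
    apply: ler_sum => i si.
    rewrite normcM normcX normc_real gtr0_norm// ler_wpM2r ?normc_ge0//.
    by rewrite ler_wiXn2l// ltW.
  rewrite -mulr_sumr (mulrC C3) -!mulrA ler_wpM2l//.
  apply: le_trans (HC3 v) _; rewrite ler_wpM2l//.
  apply: (@le_trans _ _ ((1 + a) ^+ N)).
    by rewrite ler_weXn2l.
  by rewrite ler_peMr// exprn_ge0// addr_ge0.
have -> : g z ^+ n - \sum_(i < s) tau%:C ^+ i * (B`_i).[v] =
  (g z ^+ n - (1 + V) ^+ n) +
  ((1 + V) ^+ n - \sum_(k < s) 'C(n, k)%:R * V ^+ k) +
  (\sum_(k < s) 'C(n, k)%:R * V ^+ k - \sum_(i < s) tau%:C ^+ i * (B`_i).[v]).
  by ring.
apply: le_trans (normcD _ _) _; rewrite -/E !mulrDl lerD//.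
by apply: le_trans (normcD _ _) _; rewrite lerD//.
Qed.

End PowerExpansionMain.

(** * Size and decay of the main terms *)

Section LocalEstimate.
Context {R : realType}.
Implicit Types (u x y c X T : R) (v z : R[i]) (m n q s : nat) (p : {poly R[i]}).

Definition gaussw m (beta : R[i]) X v : R[i] :=
  cexp ('i * (X%:C * v)) * cexp (- (beta * v ^+ m)).

Lemma ent_gaussw m beta X : ent (gaussw m beta X).
Proof.
apply: ent_mul; apply: ent_cexp.
  by do 2 (apply: ent_mul; first exact: ent_cst); exact: ent_id.
apply: ent_opp; apply: ent_mul; first exact: ent_cst.
by apply: ent_exp; exact: ent_id.
Qed.

Lemma normc_gaussw m beta X v :
  normc (gaussw m beta X v) = expR (- (X * Im v) - Re (beta * v ^+ m)).
Proof.
rewrite /gaussw (normcM (cexp _)) !normc_cexp -expRD.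
have -> : Re ('i * (X%:C * v)) = - (X * Im v).
  by rewrite reM /= mul0r mul1r sub0r imM /= mul0r addr0.
by rewrite reN.
Qed.

Lemma HintE m beta q X v : Hint m beta q X v = ('i * v) ^+ q * gaussw m beta X v.
Proof. by []. Qed.

Lemma ent_ccont_real (f : R[i] -> R[i]) : ent f -> ccont (fun u : R => f u%:C).
Proof.
move=> ef; have -> : (fun u : R => f u%:C) = (fun t : R => f (0 + t%:C * 1)).
  by apply/funext => t; rewrite mulr1 add0r.
exact: (ent_ccont 0 1 ef).
Qed.

(** The rates c1 and C1 are fixed before N and k, so the loss k caused by a polynomial factor can be
    taken to be a fraction of c1. *)
Lemma gaussw_poly_bound m beta : 0 < Re beta -> ~~ odd m -> (1 < m)%N ->
  exists c1 C1 : R, [/\ 0 < c1, 0 <= C1 &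
    forall (N : nat) (k : R), 0 < k -> exists2 B : R, 0 <= B & forall X v,
   normc (gaussw m beta X v) * (1 + normc v) ^+ N <=
   B * expR (- (X * Im v) - (c1 - k) * `|Re v| ^+ m + (C1 + k) * `|Im v| ^+ m)].
Proof.
move=> b0 em m1; have [c1 [C1 [c10 C10 HR]]] := Re_pow_ge b0 em m1.
exists c1, C1; split => // N k k0.
have [B B0 HB] := normc_poly_le_expR N k0 (ltnW m1).
exists B => // X v; rewrite normc_gaussw.
apply: (@le_trans _ _ (expR (- (X * Im v) - (c1 * `|Re v| ^+ m - C1 * `|Im v| ^+ m)) *
  (B * expR (k * (`|Re v| ^+ m + `|Im v| ^+ m))))).
  apply: ler_pM; rewrite ?expR_ge0 ?exprn_ge0 ?addr_ge0 ?normc_ge0//.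
  by rewrite ler_expR lerD2l lerN2.
rewrite mulrCA ler_wpM2l// -expRD ler_expR le_eqVlt; apply/orP; left; apply/eqP.
by ring.
Qed.

(* Up to 1/(2 pi), p(-i d/dx) applied to H, evaluated at X. *)
Definition mainp m beta X p : R[i] :=
  cI setT (fun u : R => gaussw m beta X u%:C * p.[u%:C]).

Lemma mainpE m beta X p : 0 < Re beta -> ~~ odd m -> (1 < m)%N ->
  mainp m beta X p = \sum_(q < size p)
    (p`_q / 'i ^+ q) * cI setT (fun u : R => Hint m beta q X u%:C).
Proof.
move=> b0 em m1.
have i0 : ('i : R[i]) != 0.
  by apply/eqP => h; have := @normc_i R; rewrite h normc0 => /eqP; rewrite eq_sym oner_eq0.
have -> : mainp m beta X p =
    cI setT (fun u : R => \sum_(q < size p) (p`_q / 'i ^+ q) * Hint m beta q X u%:C).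
  apply: eq_cI => u _; rewrite horner_coef mulr_sumr; apply: eq_bigr => q _.
  have h : p`_q = p`_q / 'i ^+ q * 'i ^+ q by rewrite divfK// expf_neq0.
  rewrite HintE exprMn {1}h; move: (p`_q / 'i ^+ q) (gaussw m beta X u%:C) => c G.
  by ring.
rewrite (cI_sum _ _ _).2//.
  by apply: eq_bigr => q _; rewrite cI_Z//; exact: Hint_cintegrable.
by move=> q; apply: cintegrableZ => //; exact: Hint_cintegrable.
Qed.

(** Half of Re beta absorbs the growth of p, and [tail_bound] halves what is left, whence Re beta /
    4. *)
Lemma mainp_tail m beta p : 0 < Re beta -> ~~ odd m -> (1 < m)%N ->
  exists2 B : R, 0 <= B & forall X T, 0 <= T ->
    cintegrable setT (fun u : R => gaussw m beta X u%:C * p.[u%:C]) /\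
    normc (mainp m beta X p -
           cI `[- T, T] (fun u : R => gaussw m beta X u%:C * p.[u%:C])) <=
    B * expR (- (Re beta / 4 * T ^+ m)).
Proof.
move=> b0 em m1.
have b20 : 0 < Re beta / 2 by rewrite divr_gt0.
have [C C0 HC] := tail_bound m1 b20.
have [Bp Bp0 HBp] := horner_growth p.
have [B B0 HB] := normc_poly_le_expR (size p) b20 (ltnW m1).
exists (C * (Bp * B)) => [|X T T0]; first by rewrite !mulr_ge0.
have -> : Re beta / 4 = Re beta / 2 / 2 by field.
apply: HC => //; last 1 first.
- move=> u; rewrite normcM normc_gaussw /= mulr0 oppr0 add0r.
  have -> : Re (beta * u%:C ^+ m) = Re beta * `|u| ^+ m.
    have -> : `|u| ^+ m = u ^+ m by rewrite -normrX ger0_norm// exprn_even_ge0.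
    by rewrite -realcX reM /= mulr0 subr0.
  have h := le_trans (HBp u%:C) (ler_wpM2l Bp0 (HB u%:C)).
  apply: le_trans (ler_wpM2l (expR_ge0 _) h) _.
  rewrite mulrC -!mulrA ler_wpM2l// ler_wpM2l// -expRD ler_expR /=.
  rewrite normr0 expr0n gtn_eqF ?(ltnW m1)// addr0.
  by rewrite le_eqVlt; apply/orP; left; apply/eqP; field.
- apply: (@ent_ccont_real (fun v => gaussw m beta X v * p.[v])).
  by apply: ent_mul; [exact: ent_gaussw|exact: ent_horner].
- exact: mulr_ge0.
Qed.

(** The line is cut at T = y: beyond it the tail already decays like e^(-c y^m), and inside it the
    contour shift applies with A = 1. The rate c is the same for all p, so it serves a whole family
    of polynomials. *)
Lemma mainp_bound m beta : 0 < Re beta -> ~~ odd m -> (1 < m)%N ->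
  exists2 c : R, 0 < c & forall p, exists2 C : R, 0 <= C &
    forall X y, 0 <= y -> `|X| = y ^+ m.-1 ->
    normc (mainp m beta X p) <= C * expR (- (c * y ^+ m)).
Proof.
move=> b0 em m1.
have [c1 [C1 [c10 C10 HW]]] := gaussw_poly_bound b0 em m1.
have c120 : 0 < c1 / 2 by rewrite divr_gt0.
have C20 : 0 <= C1 + c1 / 2 by rewrite addr_ge0// ltW.
have c1E : c1 - c1 / 2 = c1 / 2 by field.
have [C' [c' [C'0 c'0 HS]]] := shift_bound m1 c120 C20 ltr01.
exists (Num.min c' (Re beta / 4)) => [|p]; first by rewrite lt_min c'0 divr_gt0.
have [B B0 HB] := HW (size p) _ c120.
have [Bp Bp0 HBp] := horner_growth p.
have [C'' C''0 HT] := mainp_tail p b0 em m1.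
exists (C'' + C' * (Bp * B)); first by rewrite addr_ge0// !mulr_ge0.
move=> X y y0 xy.
have ym0 : 0 <= y ^+ m by rewrite exprn_ge0.
have [_ H1] := HT X y y0.
pose W v := gaussw m beta X v * p.[v].
have eW : ent W by apply: ent_mul; [exact: ent_gaussw|exact: ent_horner].
have H2 := HS W X y y (Bp * B) eW y0 xy y0.
rewrite mul1r in H2; have {}H2 := H2 (lexx _) (mulr_ge0 Bp0 B0).
have {}H2 : normc (cI `[- y, y] (fun u : R => W u%:C)) <=
     C' * (Bp * B) * expR (- (c' * y ^+ m)).
  apply: H2 => v _ _; rewrite normcM.
  apply: le_trans (ler_wpM2l (normc_ge0 _) (HBp v)) _.
  by rewrite mulrCA -mulrA ler_wpM2l// -{1}c1E; exact: HB.
rewrite -[X in normc X](subrK (cI `[- y, y] (fun u : R => W u%:C))).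
apply: le_trans (normcD _ _) _; rewrite mulrDl.
apply: lerD.
  apply: le_trans H1 _; rewrite ler_wpM2l// ler_expR lerN2 ler_wpM2r//.
  by rewrite ge_min lexx orbT.
apply: le_trans H2 _; rewrite ler_wpM2l ?mulr_ge0// ler_expR lerN2 ler_wpM2r//.
by rewrite ge_min lexx.
Qed.

End LocalEstimate.

(** * The local integral in the rescaled variable *)

Section LocalEstimateMain.
Context {R : realType}.
Implicit Types (u x y c X T : R) (v z : R[i]) (m n q s : nat) (p : {poly R[i]}).

(** On [-T, T] with T = eps/tau, the integrand minus its expansion is shifted as a single entire
    function [D], which carries the factor tau^s. Extending the main terms from [-T, T] to the whole
    line costs only e^(-c T^m). *)
Lemma local_estimate m (beta : R[i]) s (g : R[i] -> R[i]) (e M : R) :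
  0 < Re beta -> ~~ odd m -> (1 < m)%N -> ent g -> 0 < e ->
  (forall x : R, `|x| <= e -> normc (g x%:C - 1) <= M * `|x| ^+ m.+1) ->
  exists (Q : nat -> {poly R[i]}) (eps0 : R), 0 < eps0 /\
  forall eps A : R, 0 < eps -> eps <= eps0 -> 0 < A ->
  exists C c : R, [/\ 0 <= C, 0 < c & forall n (tau X y : R), (0 < n)%N ->
    0 < tau -> n%:R * tau ^+ m = 1 -> 0 <= y -> `|X| = y ^+ m.-1 ->
    A * y <= eps / tau ->
    normc (cI `[- (eps / tau), eps / tau]
             (fun u : R => gaussw m beta X u%:C * g (tau%:C * u%:C) ^+ n) -
           \sum_(i < s) tau%:C ^+ i * mainp m beta X (Q i)) <=
    C * tau ^+ s * expR (- (c * y ^+ m))].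
Proof.
move=> b0 em m1 eg e0 Hg.
have [Q [C1 [K [N [C10 K0 HQ]]]]] := power_expansion s (ltnW m1) eg e0 Hg.
have [c1 [D1 [c10 D10 HW]]] := gaussw_poly_bound b0 em m1.
have c14 : 0 < c1 / 4 by rewrite divr_gt0.
have c12 : 0 < c1 / 2 by rewrite divr_gt0.
have [B B0 HB] := HW N _ c14.
(* On the square |v| <= 2T, so the expansion is used with 2 eps; splitting |v|^m into real and
   imaginary parts costs 2^m. Taking eps <= c1/L keeps the resulting exponent below c1/4. The
   polynomial takes another c1/4, which leaves c1/2 for the shift. *)
pose L := 8 * (2 ^+ m * (K + 1)).
have L0 : 0 < L by rewrite !mulr_gt0 ?exprn_gt0// ltr_wpDl.
exists Q, (Num.min (1 / 2) (c1 / L)); split.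
  by rewrite lt_min !divr_gt0.
move=> eps A eps0 + A0; rewrite le_min => /andP[eps2 epsL].
have epsK : K * (2 * eps) * 2 ^+ m <= c1 / 4.
  have : eps * L <= c1 by rewrite -ler_pdivlMr.
  have : 0 <= 2 ^+ m * eps by rewrite mulr_ge0 ?exprn_ge0// ltW.
  rewrite /L; set P := 2 ^+ m; move: (K) P => k P h1 h2.
  have -> : k * (2 * eps) * P = (8 * (P * k) * eps) / 4 by field.
  rewrite ler_pM2r ?invr_gt0//; apply: le_trans h2.
  by rewrite (_ : eps * _ = 8 * (P * k) * eps + 8 * (P * eps)); [rewrite lerDl mulr_ge0|ring].
have D20 : 0 <= D1 + c1 / 2 by rewrite addr_ge0// ltW.
have [C2 [c2 [C20 c20 HS]]] := shift_bound m1 c12 D20 A0.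
have [Bt HBt] : exists Bt : nat -> R, forall i, 0 <= Bt i /\
    forall X T, 0 <= T ->
    cintegrable setT (fun u : R => gaussw m beta X u%:C * (Q i).[u%:C]) /\
    normc (mainp m beta X (Q i) -
           cI `[- T, T] (fun u : R => gaussw m beta X u%:C * (Q i).[u%:C])) <=
    Bt i * expR (- (Re beta / 4 * T ^+ m)).
  have /choice[Bt HBt] : forall i, exists Bt, 0 <= Bt /\
    forall X T, 0 <= T ->
    cintegrable setT (fun u : R => gaussw m beta X u%:C * (Q i).[u%:C]) /\
    normc (mainp m beta X (Q i) -
           cI `[- T, T] (fun u : R => gaussw m beta X u%:C * (Q i).[u%:C])) <=
    Bt * expR (- (Re beta / 4 * T ^+ m)).
    by move=> i; have [Bt h1 h2] := mainp_tail (Q i) b0 em m1; exists Bt.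
  by exists Bt.
have b8 : 0 < Re beta / 8 by rewrite divr_gt0.
have be8 : 0 < Re beta / 8 * eps ^+ m by rewrite mulr_gt0// exprn_gt0.
have [C3 C30 HC3] := poly_le_expR s be8.
pose c := Num.min c2 (Re beta / 8 * A ^+ m).
exists (C2 * (B * C1) + (\sum_(i < s) Bt i) * C3), c; split.
- by rewrite addr_ge0// ?mulr_ge0// sumr_ge0// => i _; case: (HBt i).
- by rewrite lt_min c20 mulr_gt0// exprn_gt0.
move=> n tau X y n0 t0 nt y0 Xy AyT.
set T := eps / tau in AyT *.
have T0 : 0 <= T by rewrite divr_ge0// ltW.
have tT : tau * T = eps by rewrite /T mulrC divfK// gt_eqF.
have ym0 : 0 <= y ^+ m by rewrite exprn_ge0.
have ts0 : 0 <= tau ^+ s by rewrite exprn_ge0// ltW.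
have n1 : 1 <= n%:R :> R by rewrite ler1n.
have t1 : tau <= 1.
  rewrite leNgt; apply/negP => t1.
  have h : 1 < tau ^+ m by rewrite exprn_egt1// -lt0n ltnW.
  by move: n1 h nt; clear; nra.
pose D v := gaussw m beta X v *
  (g (tau%:C * v) ^+ n - \sum_(i < s) tau%:C ^+ i * (Q i).[v]).
have eG : ent (fun v => gaussw m beta X v * g (tau%:C * v) ^+ n).
  apply: ent_mul; first exact: ent_gaussw.
  apply: ent_exp; apply: (ent_comp eg).
  by apply: ent_mul; [exact: ent_cst|exact: ent_id].
have eQ i : ent (fun v => gaussw m beta X v * (Q i).[v]).
  by apply: ent_mul; [exact: ent_gaussw|exact: ent_horner].
have eD : ent D.
  apply: ent_mul; first exact: ent_gaussw.
  apply: ent_sub.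
    apply: ent_exp; apply: (ent_comp eg).
    by apply: ent_mul; [exact: ent_cst|exact: ent_id].
  by apply: ent_sum => i; apply: ent_mul; [exact: ent_cst|exact: ent_horner].
have HD : normc (cI `[- T, T] (fun u : R => D u%:C)) <=
    C2 * (B * C1 * tau ^+ s) * expR (- (c2 * y ^+ m)).
  apply: (HS D X T y (B * C1 * tau ^+ s) eD y0 Xy T0 AyT).
    by rewrite !mulr_ge0.
  move=> v Rv Iv; rewrite normcM.
  have tv : tau * normc v <= 2 * eps.
    apply: (@le_trans _ _ (tau * (2 * T))).
      rewrite ler_wpM2l ?(ltW t0)//; apply: le_trans (normc_ReIm _) _.
      by rewrite mulr_natl mulr2n lerD.
    by rewrite mulrCA tT.
  have eps21 : 2 * eps <= 1 by move: eps2; clear; lra.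
  have h := HQ n tau (2 * eps) v n0 t0 nt eps21 tv.
  apply: le_trans (ler_wpM2l (normc_ge0 _) h) _.
  have hE : expR (K * (2 * eps) * normc v ^+ m) <=
      expR (c1 / 4 * (`|Re v| ^+ m + `|Im v| ^+ m)).
    rewrite ler_expR; apply: le_trans (ler_wpM2l _ (normc_powm_le v m)) _.
      by rewrite !mulr_ge0// ltW.
    by rewrite (mulrA (K * _)) ler_wpM2r// addr_ge0// exprn_ge0.
  have hW := HB X v.
  have -> : normc (gaussw m beta X v) * (C1 * tau ^+ s * (1 + normc v) ^+ N *
      expR (K * (2 * eps) * normc v ^+ m)) =
    (C1 * tau ^+ s) * (normc (gaussw m beta X v) * (1 + normc v) ^+ N *
      expR (K * (2 * eps) * normc v ^+ m)) by ring.
  have -> : B * C1 * tau ^+ s * expR (- (X * Im v) - c1 / 2 * `|Re v| ^+ m +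
       (D1 + c1 / 2) * `|Im v| ^+ m) = (C1 * tau ^+ s) * (B *
    expR (- (X * Im v) - c1 / 2 * `|Re v| ^+ m + (D1 + c1 / 2) * `|Im v| ^+ m)).
    by ring.
  rewrite ler_wpM2l ?mulr_ge0//.
  apply: le_trans (ler_pM _ (expR_ge0 _) hW hE) _.
    by rewrite mulr_ge0 ?normc_ge0// exprn_ge0// addr_ge0 ?normc_ge0.
  rewrite -(mulrA B) ler_wpM2l// -expRD ler_expR le_eqVlt; apply/orP; left; apply/eqP.
  by field.
have mT : measurable (`[- T, T] : set (measurableTypeR R)) by exact: measurable_itv.
have cQ i : cintegrable `[- T, T] (fun u : R => gaussw m beta X u%:C * (Q i).[u%:C]).
  by apply: ccont_cintegrable; exact: (ent_ccont_real (eQ i)).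
have IE : cI `[- T, T] (fun u : R => gaussw m beta X u%:C * g (tau%:C * u%:C) ^+ n) =
    cI `[- T, T] (fun u : R => D u%:C) + \sum_(i < s) tau%:C ^+ i *
      cI `[- T, T] (fun u : R => gaussw m beta X u%:C * (Q i).[u%:C]).
  have [h1 h2] := @cI_sum _ `[- T, T] _ (index_enum 'I_s)
    (fun (i : 'I_s) u => tau%:C ^+ i * (gaussw m beta X u%:C * (Q i).[u%:C])) mT
    (fun i => cintegrableZ _ mT (cQ i)).
  rewrite (eq_bigr (fun i : 'I_s => cI `[- T, T] (fun u =>
    tau%:C ^+ i * (gaussw m beta X u%:C * (Q i).[u%:C])))); last first.
    by move=> i _; rewrite cI_Z.
  rewrite -h2 -cI_D//.
    apply: eq_cI => u _; rewrite /D mulrBr mulr_sumr.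
    under [in RHS]eq_bigr do rewrite mulrCA.
    by rewrite subrK.
  by apply: ccont_cintegrable; exact: (ent_ccont_real eD).
rewrite IE -addrA -sumrB.
apply: le_trans (normcD _ _) _; rewrite !mulrDl; apply: lerD.
  apply: le_trans HD _.
  have -> : C2 * (B * C1) * tau ^+ s = C2 * (B * C1 * tau ^+ s) by ring.
  by rewrite ler_wpM2l ?mulr_ge0// ler_expR lerN2 ler_wpM2r// ge_min lexx.
(* Half of the exponent gives the decay in y through A y <= T. The other half is proportional to n,
   as T^m = eps^m n, and beats (2 + n)^s, which is at least tau^(-s) because n tau >= n tau^m =
   1. *)
have tail : expR (- (Re beta / 4 * T ^+ m)) <= C3 * tau ^+ s * expR (- (c * y ^+ m)).
  have AyTm : A ^+ m * y ^+ m <= T ^+ m.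
    by rewrite -exprMn lerXn2r ?nnegrE// mulr_ge0// ltW.
  have TmE : T ^+ m = eps ^+ m * n%:R.
    by rewrite /T exprMn exprVn; congr (_ * _); apply: (mulIf (_ : tau ^+ m != 0));
      rewrite ?nt ?mulVf// expf_neq0// gt_eqF.
  have h1 : 1 <= C3 * expR (Re beta / 8 * T ^+ m) * tau ^+ s.
    have := HC3 n%:R (ler0n _ _).
    rewrite TmE mulrA => h.
    apply: (@le_trans _ _ ((2 + n%:R) ^+ s * tau ^+ s)).
      rewrite -exprMn exprn_ege1//.
      have h3 : tau ^+ m <= tau by rewrite ler_iXnr ?(ltW t0)// ltnW.
      rewrite -[leLHS]nt; apply: ler_pM => //; first by rewrite exprn_ge0// ltW.
      by rewrite lerDr.
    by rewrite ler_wpM2r.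
  have h2 : expR (- (Re beta / 8 * T ^+ m)) <= expR (- (c * y ^+ m)).
    rewrite ler_expR lerN2; apply: (@le_trans _ _ (Re beta / 8 * A ^+ m * y ^+ m)).
      by rewrite ler_wpM2r// ge_min lexx orbT.
    by rewrite -mulrA ler_wpM2l// ltW.
  have -> : expR (- (Re beta / 4 * T ^+ m)) =
     expR (- (Re beta / 8 * T ^+ m)) * expR (- (Re beta / 8 * T ^+ m)).
    by rewrite -expRD; congr expR; field.
  apply: ler_pM; rewrite ?expR_ge0//.
  rewrite expRN -[leLHS]mul1r ler_pdivrMr ?expR_gt0//.
  by rewrite mulrAC.
apply: le_trans (normc_sum _ _ _) _.
rewrite -!mulrA mulr_suml; apply: ler_sum => i _; rewrite -mulrBr normcM normcX normc_real.
have [Bt0 /(_ X T T0)[_ hB]] := HBt i.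
rewrite gtr0_norm// normcBC.
apply: (@le_trans _ _ (1 * (Bt i * expR (- (Re beta / 4 * T ^+ m))))).
  apply: ler_pM; rewrite ?exprn_ge0 ?normc_ge0 ?(ltW t0)//.
  by rewrite exprn_ile1// ltW.
by rewrite mul1r ler_wpM2l// mulrA.
Qed.

End LocalEstimateMain.

(** * Fourier representation and support of the Green function; angles on the circle *)

Section GreenFourier.
Context {R : realType}.
Implicit Types (a : int -> R[i]) (u x t : R) (v z w : R[i]) (j l : int) (n : nat).

(** For S carrying the support of a, this is the symbol at e^(-iv), with v allowed to be complex. *)
Definition fseries (S : seq int) a v : R[i] :=
  \sum_(l <- S) a l * cexp (l%:~R * (- 'i * v)).

Lemma ent_fseries S a : ent (fseries S a).
Proof.
apply: ent_sum => l; apply: ent_mul; first exact: ent_cst.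
apply: ent_cexp; apply: ent_mul; first exact: ent_cst.
by apply: ent_mul; [exact: ent_cst|exact: ent_id].
Qed.

Lemma finite_supportE a : finite_set [set j | a j != 0] ->
  exists S : seq int, forall w : int -> R[i],
    \sum_(l \in [set: int]) a l * w l = \sum_(l <- S) a l * w l.
Proof.
move=> fa; exists (finmap.enum_fset (fset_set [set j | a j != 0])) => w.
apply: fsbigTE => l; rewrite in_fset_set// => h.
have -> : a l = 0 by apply/eqP/negPn/negP => h'; move: h; rewrite mem_set.
by rewrite mul0r.
Qed.

Lemma normc_cexp_i x : normc (cexp (- 'i * x%:C)) = 1.
Proof. by rewrite normc_cexp reM reN imN /= oppr0 mul0r mulr0 subrr expR0. Qed.

Lemma cexp_Ni t : cexp (- 'i * t%:C) = cos t -i* sin t.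
Proof.
rewrite /cexp; have -> : - 'i * t%:C = 0 -i* t :> R[i].
  by apply: complexP; rewrite ?reM ?imM ?reN ?imN /=; ring.
by rewrite /= expR0 mul1r cosN sinN.
Qed.

Lemma cexp_period j (t0 : R) :
  cexp (j%:~R * (- 'i * (t0 + 2 * pi)%:C)) = cexp (j%:~R * (- 'i * t0%:C)) :> R[i].
Proof.
rewrite realcD (mulrDr (- 'i)) (mulrDr j%:~R) cexpD -[RHS]mulr1; congr (_ * _).
rewrite -cexpMz cexp_Ni mulr_natl cos2pi sin2pi oppr0.
by rewrite (_ : 1 +i* 0 = 1 :> R[i]) ?exp1rz.
Qed.

Lemma fourier_dirac (t0 : R) j :
  cI `[t0, t0 + 2 * pi] (fun u => cexp (j%:~R * (- 'i * u%:C))) =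
  (2 * pi)%:C * dirac_seq R j.
Proof.
have pi2 : 0 <= 2 * pi :> R by rewrite mulr_ge0// pi_ge0.
have le : t0 <= t0 + 2 * pi by rewrite lerDl.
have [->|j0] := eqVneq j 0.
  rewrite /dirac_seq eqxx mulr1 (@cI_FTC _ (fun u => u%:C)) //.
  - by apply: complexP; rewrite ?reD ?imD ?reN ?imN /= ?subrr// addrAC subrr add0r.
  - exact: (@ent_ccont_real _ (fun v => cexp (0%:~R * (- 'i * v))))
      (ent_cexp (ent_mul (ent_cst _) (ent_mul (ent_cst _) ent_id))).
  - move=> t; apply: cder_eq (cder_realc t) _.
    by rewrite mul0r cexp0.
rewrite /dirac_seq (negbTE j0) mulr0.
have i0 : ('i : R[i]) != 0.
  by apply/eqP => h; have := @normc_i R; rewrite h normc0 => /eqP; rewrite eq_sym oner_eq0.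
have c0 : j%:~R * - 'i != 0 :> R[i].
  by rewrite mulf_neq0// ?intr_eq0// oppr_eq0.
rewrite (@cI_FTC _ (fun u => (j%:~R * - 'i)^-1 * cexp (j%:~R * (- 'i * u%:C)))) //.
- by rewrite cexp_period subrr.
- exact: (@ent_ccont_real _ (fun v => cexp (j%:~R * (- 'i * v))))
      (ent_cexp (ent_mul (ent_cst _) (ent_mul (ent_cst _) ent_id))).
- move=> t; apply: cder_eq.
    apply: cderM; first exact: cder_cst.
    apply: cder_cexp; apply: cderM; first exact: cder_cst.
    by apply: cderM; [exact: cder_cst|exact: cder_realc].
  rewrite mul0r add0r mul0r add0r mul0r add0r mulr1 mulrA mulVf ?mul1r//.
Qed.

(** Each application of [conv_op] multiplies the integrand by the symbol. The starting point t0 of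
    the period is free, so that the period can later be placed with all tangency angles in its
    interior. *)
Lemma green_fourier S a (t0 : R) n j :
  (forall w : int -> R[i], \sum_(l \in [set: int]) a l * w l = \sum_(l <- S) a l * w l) ->
  cI `[t0, t0 + 2 * pi]
    (fun u => fseries S a u%:C ^+ n * cexp (j%:~R * (- 'i * u%:C))) =
  (2 * pi)%:C * green a n j.
Proof.
move=> HS; elim: n j => [|n IH] j.
  rewrite -[green a 0 j]/(dirac_seq R j) -(fourier_dirac t0).
  by apply: eq_cI => u _; rewrite expr0 mul1r.
rewrite /green iterS /conv_op HS mulr_sumr.
have mI : measurable (`[t0, t0 + 2 * pi] : set (measurableTypeR R)).
  exact: measurable_itv.
have iF l : cintegrable `[t0, t0 + 2 * pi]
    (fun u => fseries S a u%:C ^+ n * cexp ((j + l)%:~R * (- 'i * u%:C))).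
  apply: ccont_cintegrable.
  apply: (@ent_ccont_real _ (fun v => fseries S a v ^+ n * cexp ((j + l)%:~R * (- 'i * v)))).
  apply: ent_mul; first by apply: ent_exp; exact: ent_fseries.
  exact: (ent_cexp (ent_mul (ent_cst _) (ent_mul (ent_cst _) ent_id))).
have [_ h2] := @cI_sum _ `[t0, t0 + 2 * pi] _ S
    (fun l u => a l * (fseries S a u%:C ^+ n * cexp ((j + l)%:~R * (- 'i * u%:C)))) mI
    (fun l => cintegrableZ _ mI (iF l)).
rewrite (eq_bigr (fun l => cI `[t0, t0 + 2 * pi] (fun u =>
  a l * (fseries S a u%:C ^+ n * cexp ((j + l)%:~R * (- 'i * u%:C)))))); last first.
  by move=> l _; rewrite cI_Z// IH mulrCA.
rewrite -h2; apply: eq_cI => u _.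
rewrite exprS -mulrA {1}/fseries mulr_suml; apply: eq_bigr => l _.
rewrite rmorphD /= mulrDl cexpD.
by move: (cexp (l%:~R * (- 'i * u%:C))) (cexp (j%:~R * (- 'i * u%:C)))
  (fseries S a u%:C ^+ n) => x y b; ring.
Qed.

(** Finite speed of propagation: each step enlarges the support by at most L on either side. *)
Lemma green_vanish S a (L : nat) n j :
  (forall w : int -> R[i], \sum_(l \in [set: int]) a l * w l = \sum_(l <- S) a l * w l) ->
  (forall l, l \in S -> (absz l <= L)%N) -> (n * L < absz j)%N -> green a n j = 0.
Proof.
move=> HS HL; elim: n j => [|n IH] j.
  rewrite mul0n => j0; rewrite /green /= /dirac_seq.
  by rewrite (_ : (j == 0) = false)//; apply/negbTE; rewrite -absz_gt0.
move=> jn; rewrite /green iterS /conv_op HS big_seq big1// => l lS.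
rewrite -[iter n _ _ _]/(green a n (j + l)) IH ?mulr0//.
by have := HL l lS; move: jn; rewrite mulSn; lia.
Qed.

(** The arc cosine lies in [0, pi], where e^(-i theta) has nonpositive imaginary part; for Im w > 0
    the angle is reflected to 2 pi minus it. *)
Lemma angle_exists w : normc w = 1 ->
  exists theta : R, 0 <= theta < 2 * pi /\ w = cexp (- 'i * theta%:C).
Proof.
move=> w1; have ab : Re w ^+ 2 + Im w ^+ 2 = 1 by rewrite -normc_sqr w1 expr1n.
have a1 : -1 <= Re w <= 1.
  rewrite -ler_norml -(@ler_pXn2r _ 2)// ?nnegrE// real_normK ?num_real// expr1n.
  by rewrite -ab lerDl sqr_ge0.
have sq : Num.sqrt (1 - Re w ^+ 2) = `|Im w|.
  by rewrite -ab addrC addKr sqrtr_sqr.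
have ca : cos (acos (Re w)) = Re w by rewrite acosK.
have sa : sin (acos (Re w)) = `|Im w| by rewrite sin_acos.
have p0 := pi_gt0 R.
have [im|im] := leP (Im w) 0.
  exists (acos (Re w)); split.
    by rewrite acos_ge0// (le_lt_trans (acos_lepi a1))//; lra.
  by rewrite cexp_Ni ca sa ler0_norm// opprK; case: (w).
exists (2 * pi - acos (Re w)); split.
  have h1 := acos_lepi a1.
  have h2 : 0 < acos (Re w).
    rewrite acos_gt0//; move/andP: a1 => [-> h]; rewrite lt_neqAle h andbT.
    apply/negP => /eqP h'; move: ab; rewrite h' expr1n => ab'.
    have /eqP : Im w ^+ 2 = 0 by apply: (addrI 1); rewrite addr0.
    by rewrite sqrf_eq0 gt_eqF.
  by apply/andP; split; lra.
rewrite cexp_Ni.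
have -> : cos (2 * pi - acos (Re w)) = Re w.
  by rewrite cosB mulr_natl cos2pi sin2pi mul1r mul0r addr0 ca.
have -> : sin (2 * pi - acos (Re w)) = - `|Im w|.
  by rewrite sinB mulr_natl cos2pi sin2pi mul1r mul0r sub0r sa.
by rewrite opprK gtr0_norm//; case: (w).
Qed.

(** With d = |s - t|, cos d = 1 - 2 sin(d/2)^2 equals 1, while sin(d/2) > 0 for 0 < d/2 < pi. *)
Lemma angle_unique (s t : R) : `|s - t| < 2 * pi ->
  cexp (- 'i * s%:C) = cexp (- 'i * t%:C) :> R[i] -> s = t.
Proof.
move=> st.
rewrite !cexp_Ni => -[cc /oppr_inj ss].
have c1 : cos (s - t) = 1 by rewrite cosB cc ss -!expr2 cos2Dsin2.
apply/eqP; rewrite -subr_eq0; apply/negPn/negP => d0.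
have h : cos `|s - t| = 1 by rewrite cos_norm.
have d1 : 0 < `|s - t| by rewrite normr_gt0.
move: st h d1; move: `|s - t| => d dp.
rewrite (_ : d = (d / 2) *+ 2); last by rewrite -mulr_natr divfK.
move: dp; set e := d / 2 => dp; rewrite cos_mulr2n cos2sin2 => h e0.
have : 0 < sin e.
  rewrite sin_gt0_pi//; move: e0 dp; rewrite /e -mulr_natr divfK// => h1 h2.
  by rewrite divr_gt0//= ltr_pdivrMr// mulrC.
move=> s0; move: h.
have := exprn_gt0 2 s0; rewrite mulr2n; lra.
Qed.

End GreenFourier.

(** * The symbol near a tangency point *)

Section TangencyPoint.
Context {R : realType}.
Implicit Types (a : int -> R[i]) (u x t : R) (v z w : R[i]) (j l : int) (n : nat).

Lemma poly_diff_poly (N : nat) (c : nat -> R[i]) (f : R -> R[i]) x :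
  poly_diff (\poly_(q < N) (c q)%:P) f x = \sum_(q < N) c q * cderiven q f x.
Proof.
rewrite /poly_diff; set P := \poly_(q < N) (c q)%:P.
have PN : (size P <= N)%N := size_poly _ _.
have PE q : (q < N)%N -> P`_q = (c q)%:P by move=> qN; rewrite coef_poly qN.
rewrite [RHS](bigID (fun q : 'I_N => (q < size P)%N)) /= [X in _ = _ + X]big1.
  rewrite addr0 -(big_ord_widen N (fun q => c q * cderiven q f x) PN).
  apply: eq_bigr => q _; rewrite PE; last exact: leq_trans (ltn_ord q) PN.
  have [->|c0] := eqVneq (c q) 0; first by rewrite size_poly0 big_ord0 mul0r.
  by rewrite size_polyC c0 big_ord1 coefC eqxx expr0 mulr1.
move=> q; rewrite -leqNgt => /leq_sizeP/(_ q (leqnn _)); rewrite PE// => /eqP.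
by rewrite polyC_eq0 => /eqP ->; rewrite mul0r.
Qed.

Lemma normc_cexp_sub1 w : normc w <= 1 ->
  normc (cexp w - 1) <= 2 * (expR 1 * normc w).
Proof.
move=> w1; pose h t := cexp (t%:C * w).
have dh t : cder h t (w * h t).
  apply: cder_eq.
    apply: cder_cexp; apply: cderM; [exact: cder_realc|exact: cder_cst].
  by rewrite mulr0 addr0 mul1r.
have -> : cexp w - 1 = h 1 - h 0 by rewrite /h mul1r mul0r cexp0.
apply: le_trans (cder_mean_value (M := expR 1 * normc w) ler01 dh _) _.
  move=> t /andP[t0 t1]; rewrite (normcM w) mulrC ler_wpM2r ?normc_ge0//.
  rewrite /h normc_cexp ler_expR (le_trans (ler_norm _))//.
  apply: le_trans (normc_Re _) _; rewrite (normcM t%:C) normc_real ger0_norm//.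
  by rewrite mulr_ile1 ?normc_ge0.
by rewrite subr0 mulr1.
Qed.

(* The function g with F(kappa e^{-i zeta}) = z e^{i alpha zeta - beta zeta^m} g(zeta). *)
Definition reduced (F : R[i] -> R[i]) (theta : R) z (alpha : R) (beta : R[i])
    (m : nat) v : R[i] :=
  z^-1 * F (theta%:C + v) * cexp (- ('i * (alpha%:C * v)) + beta * v ^+ m).

Lemma ent_reduced F theta z alpha beta m : ent F ->
  ent (reduced F theta z alpha beta m).
Proof.
move=> eF; apply: ent_mul.
  apply: ent_mul; first exact: ent_cst.
  by apply: (ent_comp eF); apply: ent_add; [exact: ent_cst|exact: ent_id].
apply: ent_cexp; apply: ent_add.
  by apply: ent_opp; do 2 (apply: ent_mul; first exact: ent_cst); exact: ent_id.
by apply: ent_mul; [exact: ent_cst|apply: ent_exp; exact: ent_id].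
Qed.

(** At a small real x the reduced symbol is exactly exp(r(-x)). The argument is -x because F is
    evaluated at e^(-ix), and the beta term keeps its sign because m is even. *)
Lemma reduced_flat (F : R[i] -> R[i]) (theta : R) kappa z (alpha : R) (beta : R[i])
    m (sym : R[i] -> R[i]) : ~~ odd m -> z != 0 ->
  kappa = cexp (- 'i * theta%:C) ->
  (forall x : R, F x%:C = sym (cexp (- 'i * x%:C))) ->
  (exists (r : R -> R[i]) (M : R), \forall xi \near nbhs (0 : R),
      `|r xi| <= (M * `|xi| ^+ m.+1)%:C /\
      sym (kappa * cexp ('i%C * xi%:C)) =
        z * cexp (- ('i%C * (alpha * xi)%:C) - beta * (xi ^+ m)%:C + r xi)) ->
  exists e M : R, 0 < e /\ forall x : R, `|x| <= e ->
    normc (reduced F theta z alpha beta m x%:C - 1) <= M * `|x| ^+ m.+1.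
Proof.
move=> em z0 kE FE [r [M /nbhs_ballP[e0 /= e00 He]]].
(* The last bound makes |r| at most 1, where |exp(r) - 1| is at most a multiple of |r|; e0/2 lies
   inside the open ball of the expansion. *)
pose e := Num.min (Num.min 1 (e0 / 2)) (1 + `|M|)^-1.
have M1 : 0 < 1 + `|M| by rewrite ltr_pwDl.
have e_gt0 : 0 < e by rewrite !lt_min ltr01 divr_gt0// invr_gt0.
exists e, (2 * (expR 1 * M)); split => // x xe.
have x1 : `|x| <= 1 by apply: le_trans xe _; rewrite !ge_min lexx.
have xe0 : `|x| < e0.
  apply: (@le_lt_trans _ _ (e0 / 2)); last by rewrite ltr_pdivrMr// ltr_pMr// ltr1n.
  by apply: le_trans xe _; rewrite !ge_min lexx orbT.
have xM : `|x| * (1 + `|M|) <= 1.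
  by rewrite -ler_pdivlMr// div1r; apply: le_trans xe _; rewrite ge_min lexx orbT.
have [] := He (- x); first by rewrite /ball /= sub0r opprK.
rewrite normcE lecR normrN => hr hs.
have xm : (- x) ^+ m = x ^+ m.
  by rewrite exprNn -signr_odd (negbTE em) expr0 mul1r.
have gE : reduced F theta z alpha beta m x%:C = cexp (r (- x)).
  rewrite /reduced -realcD FE realcD (mulrDr (- 'i)) cexpD -kE.
  have -> : cexp (- 'i * x%:C) = cexp ('i%C * (- x)%:C).
    by congr cexp; rewrite rmorphN /= mulrN mulNr.
  rewrite hs (mulrA z^-1) mulVf// mul1r -cexpD; congr cexp.
  rewrite xm realcX; have -> : (alpha * - x)%:C = - (alpha%:C * x%:C).
    by rewrite mulrN rmorphN /= realcM.
  by rewrite complexiE; ring.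
have rM : normc (r (- x)) <= `|M| * `|x| ^+ m.+1.
  by apply: le_trans hr _; rewrite ler_wpM2r ?ler_norm// exprn_ge0.
rewrite gE; apply: le_trans (normc_cexp_sub1 _) _.
  apply: le_trans rM _; apply: le_trans xM; rewrite exprS mulrCA.
  rewrite ler_wpM2l//.
  apply: (@le_trans _ _ (`|M| * 1)); last by rewrite mulr1 lerDr.
  by rewrite ler_wpM2l// exprn_ile1.
by rewrite -!mulrA ler_wpM2l// ler_wpM2l ?expR_ge0.
Qed.

End TangencyPoint.

(** * The estimate at one tangency point, in the original variables *)

Section PointEstimate.
Context {R : realType}.
Implicit Types (u x t : R) (v z w : R[i]) (j l : int) (n s mu : nat).

Definition point_main (P : nat -> {poly {poly R[i]}}) (kappa z : R[i]) (alpha : R)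
    mu (beta : R[i]) s n j : R[i] :=
  \sum_(1 <= sigma < s.+1)
    z ^+ n * kappa ^ j / (n%:R `^ (sigma%:R / (2 * mu)%:R))%:C
    * poly_diff (P sigma) (Hfun mu beta) (Xvar alpha mu n j).

Definition point_error (alpha : R) mu s (C c : R) n j : R :=
  C / n%:R `^ (s.+1%:R / (2 * mu)%:R)
  * expR (- (c * `|Xvar alpha mu n j| `^ ((2 * mu)%:R / ((2 * mu)%:R - 1)))).

(** With [scaling_root], this trades every real power in the theorem for natural powers of tau and
    y. *)
Lemma scaling_factor n m : (0 < n)%N -> (0 < m)%N -> exists tau : R,
  [/\ 0 < tau, n%:R * tau ^+ m = 1, tau^-1 = n%:R `^ (m%:R^-1) &
   forall k : nat, (n%:R `^ (k%:R / m%:R))^-1 = tau ^+ k].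
Proof.
move=> n0 m0; have n0' : 0 < n%:R :> R by rewrite ltr0n.
have nu0 : 0 < (n%:R : R) `^ (m%:R^-1) by exact: powR_gt0.
exists (n%:R `^ (m%:R^-1))^-1; split.
- by rewrite invr_gt0.
- rewrite exprVn -powR_mulrn ?ltW// -powRrM mulVf ?pnatr_eq0 -?lt0n//.
  by rewrite powRr1 ?ler0n// divff// gt_eqF.
- by rewrite invrK.
- by move=> k; rewrite exprVn mulrC powRrM powR_mulrn// ltW.
Qed.

Lemma scaling_root (x : R) m : (1 < m)%N -> exists y : R,
  [/\ 0 <= y, `|x| = y ^+ m.-1 & `|x| `^ (m%:R / (m%:R - 1)) = y ^+ m].
Proof.
move=> m1; have mE : m%:R - 1 = m.-1%:R :> R by rewrite -[in LHS](prednK (ltnW m1)) -natr1 addrK.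
have m10 : m.-1%:R != 0 :> R by rewrite pnatr_eq0; case: (m) m1 => [|[]].
exists (`|x| `^ (m.-1%:R^-1)); split; first exact: powR_ge0.
  by rewrite -powR_mulrn ?powR_ge0// -powRrM mulVf// powRr1.
by rewrite mE mulrC powRrM powR_mulrn// powR_ge0.
Qed.

Lemma scaling_factor_le1 n m (tau : R) : (0 < m)%N -> (0 < n)%N -> 0 < tau ->
  n%:R * tau ^+ m = 1 -> tau <= 1.
Proof.
move=> m0 n0 t0 nt; have n1 : 1 <= n%:R :> R by rewrite ler1n.
rewrite leNgt; apply/negP => t1.
have h : 1 < tau ^+ m by rewrite exprn_egt1// -lt0n.
by move: n1 h nt; clear; nra.
Qed.

(** When n tau^m = 1 the right-hand side is |alpha - j/n|: tau y measures how far j/n is from the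
    velocity alpha. *)
Lemma scaled_root_pow n j m mu (alpha tau y : R) : (1 < m)%N -> 0 < tau ->
  tau^-1 = n%:R `^ ((2 * mu)%:R^-1) -> `|Xvar alpha mu n j| = y ^+ m.-1 ->
  (tau * y) ^+ m.-1 = tau ^+ m * `|n%:R * alpha - j%:~R|.
Proof.
move=> m1 t0 tE Xy; rewrite exprMn -Xy /Xvar -tE invrK normrM (gtr0_norm t0).
by rewrite -[in tau ^+ m](prednK (ltnW m1)) exprS; ring.
Qed.

Lemma scaled_root_le n j m mu (alpha tau y Lb : R) : (1 < m)%N -> (0 < n)%N ->
  0 < tau -> 0 <= y -> n%:R * tau ^+ m = 1 ->
  tau^-1 = n%:R `^ ((2 * mu)%:R^-1) -> `|Xvar alpha mu n j| = y ^+ m.-1 ->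
  `|n%:R * alpha - j%:~R| <= Lb * n%:R -> tau * y <= 1 + `|Lb|.
Proof.
move=> m1 n0 t0 y0 nt tE Xy nj.
have ty0 : 0 <= tau * y by rewrite mulr_ge0// ltW.
have [ty1|ty1] := leP (tau * y) 1; first by apply: le_trans ty1 _; rewrite lerDl.
apply: (@le_trans _ _ ((tau * y) ^+ m.-1)).
  by rewrite ler_eXnr ?(ltW ty1)//; case: (m) m1 => [|[]].
rewrite (scaled_root_pow m1 t0 tE Xy).
apply: (@le_trans _ _ `|Lb|); last by rewrite lerDr.
apply: (@le_trans _ _ (tau ^+ m * (`|Lb| * n%:R))).
  rewrite ler_wpM2l ?exprn_ge0 ?(ltW t0)//; apply: le_trans nj _.
  by rewrite ler_wpM2r// ler_norm.
by rewrite mulrCA (mulrC (tau ^+ m)) nt mulr1.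
Qed.

(** The second conclusion compares the local integral with the main terms for j of order n; the
    third bounds the main terms alone for remote j. The threshold eps0 precedes Lb and eps, so one
    eps can be chosen for all tangency points. *)
Lemma point_estimate (F : R[i] -> R[i]) (theta : R) kappa z (alpha : R) mu
    (beta : R[i]) s (e M : R) :
  ent F -> kappa = cexp (- 'i * theta%:C) -> normc z = 1 ->
  (0 < mu)%N -> 0 < Re beta -> 0 < e ->
  (forall x : R, `|x| <= e ->
    normc (reduced F theta z alpha beta (2 * mu) x%:C - 1) <= M * `|x| ^+ (2 * mu).+1) ->
  exists (P : nat -> {poly {poly R[i]}}) (eps0 : R), [/\ 0 < eps0,
    (forall eps Lb : R, 0 < eps -> eps <= eps0 -> exists C c : R, [/\ 0 <= C, 0 < c &
      forall n j, (0 < n)%N -> `|n%:R * alpha - j%:~R| <= Lb * n%:R ->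
        normc (((2 * pi)^-1)%:C * cI `[theta - eps, theta + eps]
            (fun u : R => F u%:C ^+ n * cexp (j%:~R * (- 'i * u%:C))) -
          point_main P kappa z alpha mu beta s n j)
        <= point_error alpha mu s C c n j]) &
    (exists C c : R, [/\ 0 <= C, 0 < c & forall n j, (0 < n)%N ->
        n%:R <= `|n%:R * alpha - j%:~R| ->
        normc (point_main P kappa z alpha mu beta s n j)
        <= point_error alpha mu s C c n j])].
Proof.
move=> eF kE z1 mu0 b0 e0 Hg; set m := (2 * mu)%N in Hg *.
have em : ~~ odd m by rewrite /m mul2n odd_double.
have m1 : (1 < m)%N by rewrite /m; lia.
have m0 : (0 < m)%N := ltnW m1.
have k1 : normc kappa = 1 by rewrite kE normc_cexp_i.
have z0 : z != 0.
  by apply/eqP => h; move: z1; rewrite h normc0 => /eqP; rewrite eq_sym oner_eq0.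
have pi2 : 0 < 2 * pi :> R by rewrite mulr_gt0// pi_gt0.
have eg := ent_reduced theta z alpha beta m eF.
set g := reduced F theta z alpha beta m in Hg eg.
have [Q [eps0 [eps00 HQ]]] := local_estimate s b0 em m1 eg e0 Hg.
(* A factor u^q under the integral is (d/dx)^q divided by i^q. The index is sigma - 1 because the
   Jacobian supplies one power of tau. *)
pose P (sigma : nat) : {poly {poly R[i]}} :=
  \poly_(q < size (Q sigma.-1)) (((Q sigma.-1)`_q / 'i ^+ q)%:P).
have mainE n j (tau : R) : 0 < tau -> tau^-1 = n%:R `^ (m%:R^-1) ->
    (forall k : nat, (n%:R `^ (k%:R / m%:R))^-1 = tau ^+ k) ->
    point_main P kappa z alpha mu beta s n j =
    z ^+ n * kappa ^ j * (tau * (2 * pi)^-1)%:C *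
      \sum_(i < s) tau%:C ^+ i * mainp m beta (Xvar alpha mu n j) (Q i).
  move=> t0 tE tk; rewrite /point_main big_add1 /= big_mkord mulr_sumr.
  apply: eq_bigr => i _; rewrite poly_diff_poly -realcV tk.
  rewrite (mainpE _ _ b0 em m1).
  under eq_bigr do rewrite cderiven_Hfun// mulrCA.
  rewrite -mulr_sumr realcX realcM exprS.
  by move: (\sum_(_ < _) _) (kappa ^ j) (z ^+ n) => x y w; ring.
have XE n j (tau : R) : tau^-1 = n%:R `^ (m%:R^-1) ->
    Xvar alpha mu n j = (n%:R * alpha - j%:~R) * tau.
  by move=> tE; rewrite /Xvar -tE invrK.
have norm1 n j : normc (z ^+ n * kappa ^ j) = 1.
  by rewrite normcM normcX z1 expr1n mul1r normc_zpow.
exists P, eps0; split => //.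
- move=> eps Lb eps_gt0 epsle.
  pose L1 := 1 + `|Lb|.
  have L10 : 0 < L1 by rewrite ltr_pwDl.
  have A0 : 0 < eps / L1 by rewrite divr_gt0.
  have [C [c [C0 c0 H]]] := HQ eps (eps / L1) eps_gt0 epsle A0.
  exists (C * (2 * pi)^-1), c; split => //.
    by rewrite mulr_ge0// invr_ge0 ltW.
  move=> n j n0 nj.
  have [tau [t0 nt tE tk]] := scaling_factor n0 m0.
  have [y [y0 Xy Xm]] := scaling_root (Xvar alpha mu n j) m1.
  rewrite /point_error -/m Xm tk (mainE n j tau t0 tE tk).
  have AyT : eps / L1 * y <= eps / tau.
    rewrite -mulrA ler_wpM2l ?(ltW eps_gt0)// mulrC ler_pdivrMr// mulrC.
    rewrite -ler_pdivrMr ?invr_gt0// invrK mulrC.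
    exact: scaled_root_le nt tE Xy nj.
  have h := H n tau (Xvar alpha mu n j) y n0 t0 nt y0 Xy AyT.
  have tT : tau * (eps / tau) = eps by rewrite mulrC divfK// gt_eqF.
  (* Substitution t = theta + tau u. The linear exponents combine to i (n alpha - j) tau u = i X u,
     and n tau^m = 1 turns n beta (tau u)^m into beta u^m. *)
  have IE : cI `[theta - eps, theta + eps]
      (fun u : R => F u%:C ^+ n * cexp (j%:~R * (- 'i * u%:C))) =
    z ^+ n * kappa ^ j * tau%:C * cI `[- (eps / tau), eps / tau]
      (fun u : R => gaussw m beta (Xvar alpha mu n j) u%:C * g (tau%:C * u%:C) ^+ n).
    have -> : theta - eps = theta + tau * (- (eps / tau)) by rewrite mulrN tT.
    have -> : theta + eps = theta + tau * (eps / tau) by rewrite tT.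
    have mI : measurable (`[- (eps / tau), eps / tau] : set (measurableTypeR R)).
      exact: measurable_itv.
    have eW : ent (fun v => gaussw m beta (Xvar alpha mu n j) v * g (tau%:C * v) ^+ n).
      apply: ent_mul; first exact: ent_gaussw.
      apply: ent_exp; apply: (ent_comp eg).
      by apply: ent_mul; [exact: ent_cst|exact: ent_id].
    have eV : ent (fun v => F v ^+ n * cexp (j%:~R * (- 'i * v))).
      apply: ent_mul; first exact: ent_exp.
      exact: (ent_cexp (ent_mul (ent_cst _) (ent_mul (ent_cst _) ent_id))).
    rewrite cI_affine//; last 2 first.
    - by rewrite ge0_cp// divr_ge0// ltW.
    - exact: (ent_ccont_real eV).
    rewrite (mulrC (_ * kappa ^ j)) -mulrA; congr (_ * _).
    rewrite -cI_Z//; last exact/ccont_cintegrable/(ent_ccont_real eW).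
    apply: eq_cI => u _.
    rewrite /g /reduced /gaussw realcD realcM.
    set w := F (theta%:C + tau%:C * u%:C).
    rewrite (exprMn n (z^-1 * w)) (exprMn n z^-1 w) (exprMn m tau%:C) cexpMn exprVn (mulrDr (- 'i)) (mulrDr j%:~R) cexpD kE cexpMz.
    have zn0 : z ^+ n != 0 by rewrite expf_neq0.
    have ntC : n%:R * tau%:C ^+ m = 1 :> R[i].
      by rewrite -realcX -(rmorph_nat (real_complex R)) -realcM nt.
    have -> : cexp ('i * ((Xvar alpha mu n j)%:C * u%:C)) * cexp (- (beta * u%:C ^+ m)) *
        ((z ^+ n)^-1 * w ^+ n * cexp (n%:R * (- ('i * (alpha%:C * (tau%:C * u%:C))) +
           beta * (tau%:C ^+ m * u%:C ^+ m)))) =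
       (z ^+ n)^-1 * w ^+ n * cexp (j%:~R * (- 'i * (tau%:C * u%:C))).
      rewrite mulrC -[LHS]mulrA -!cexpD; congr (_ * cexp _).
      have -> : n%:R * (- ('i * (alpha%:C * (tau%:C * u%:C))) +
         beta * (tau%:C ^+ m * u%:C ^+ m)) =
         - (n%:R * 'i * alpha%:C * tau%:C * u%:C) +
         beta * (n%:R * tau%:C ^+ m) * u%:C ^+ m :> R[i] by ring.
      rewrite ntC (XE n j tau tE) realcM rmorphB /= realcM rmorph_nat rmorph_int.
      by ring.
    move: (cexp (j%:~R * (- 'i * (tau%:C * u%:C)))) => q.
    move: (cexp (j%:~R * (- 'i * theta%:C))) (w ^+ n) => p W.
    move: (z ^+ n) zn0 => Z Z0.
    by field.
  rewrite IE.
  have -> : (2 * pi)^-1%:C * (z ^+ n * kappa ^ j * tau%:C *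
      cI `[- (eps / tau), eps / tau]
      (fun u : R => gaussw m beta (Xvar alpha mu n j) u%:C * g (tau%:C * u%:C) ^+ n)) -
    z ^+ n * kappa ^ j * (tau * (2 * pi)^-1)%:C *
      (\sum_(i < s) tau%:C ^+ i * mainp m beta (Xvar alpha mu n j) (Q i)) =
    (z ^+ n * kappa ^ j) * ((tau * (2 * pi)^-1)%:C * (cI `[- (eps / tau), eps / tau]
      (fun u : R => gaussw m beta (Xvar alpha mu n j) u%:C * g (tau%:C * u%:C) ^+ n) -
      \sum_(i < s) tau%:C ^+ i * mainp m beta (Xvar alpha mu n j) (Q i))).
    rewrite realcM; move: (cI _ _) (\sum_(i < s) _) (z ^+ n * kappa ^ j) => x x' w.
    by move: ((2 * pi)^-1%:C) => p; ring.
  rewrite normcM norm1 mul1r normcM normc_real ger0_norm; last first.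
    by rewrite mulr_ge0 ?invr_ge0// ltW.
  apply: le_trans (ler_wpM2l _ h) _; first by rewrite mulr_ge0 ?invr_ge0// ltW.
  rewrite exprS le_eqVlt; apply/orP; left; apply/eqP.
  by move: ((2 * pi)^-1) (expR _) => p q; ring.
have [c c0 Hc] := mainp_bound b0 em m1.
have /choice[B HB] : forall i, exists C : R, 0 <= C /\
    forall X y, 0 <= y -> `|X| = y ^+ m.-1 ->
    normc (mainp m beta X (Q i)) <= C * expR (- (c * y ^+ m)).
  by move=> i; have [C h1 h2] := Hc (Q i); exists C.
have c2 : 0 < c / 2 by rewrite divr_gt0.
have [C3 C30 HC3] := poly_le_expR s c2.
have SB0 : 0 <= \sum_(i < s) B i by rewrite sumr_ge0// => i _; case: (HB i).
exists ((2 * pi)^-1 * (\sum_(i < s) B i) * C3), (c / 2); split => //.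
  by rewrite !mulr_ge0// invr_ge0 ltW.
move=> n j n0 nj.
have [tau [t0 nt tE tk]] := scaling_factor n0 m0.
have [y [y0 Xy Xm]] := scaling_root (Xvar alpha mu n j) m1.
rewrite /point_error -/m Xm tk (mainE n j tau t0 tE tk).
have n1 : 1 <= n%:R :> R by rewrite ler1n.
have tm0 : 0 < tau ^+ m by rewrite exprn_gt0.
have t1 := scaling_factor_le1 m0 n0 t0 nt.
(* Here |alpha - j/n| >= 1, so tau y >= 1 and y^m = n (tau y)^m >= n. Half of the decay in y
   therefore also yields e^(-c n / 2), which pays for tau^s in [key]. *)
have ym : n%:R <= y ^+ m.
  have ty1 : 1 <= (tau * y) ^+ m.-1.
    by rewrite (scaled_root_pow m1 t0 tE Xy) -[leLHS]nt mulrC ler_wpM2l// ltW.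
  have ty : 1 <= tau * y.
    rewrite leNgt; apply/negP => ty; move: ty1; rewrite leNgt exprn_ilt1//.
    - by case: (m) m1 => [|[]].
    - by rewrite mulr_ge0// ltW.
  have : 1 <= (tau * y) ^+ m by rewrite exprn_ege1.
  rewrite exprMn => h; rewrite -[leLHS]mulr1.
  apply: le_trans (ler_wpM2l (ler0n _ n) h) _.
  by rewrite mulrA nt mul1r.
have key : expR (- (c * y ^+ m)) <= C3 * tau ^+ s * expR (- (c / 2 * y ^+ m)).
  have -> : - (c * y ^+ m) = - (c / 2 * y ^+ m) - c / 2 * y ^+ m by field.
  rewrite expRD mulrC ler_wpM2r ?expR_ge0// expRN.
  rewrite -[leLHS]mul1r ler_pdivrMr ?expR_gt0//.
  apply: (@le_trans _ _ (tau ^+ s * (2 + n%:R) ^+ s)).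
    rewrite -exprMn exprn_ege1// mulrC -[leLHS]nt.
    apply: ler_pM => //; first exact: ltW.
      by rewrite lerDr.
    by rewrite ler_iXnr// ltW.
  rewrite -(mulrA C3) (mulrCA C3) ler_wpM2l ?exprn_ge0 ?(ltW t0)//.
  apply: le_trans (HC3 _ (ler0n _ n)) _.
  by rewrite ler_wpM2l// ler_expR ler_wpM2l// ltW.
rewrite normcM (normcM (z ^+ n * _)) norm1 mul1r normc_real ger0_norm; last first.
  by rewrite mulr_ge0 ?invr_ge0// ltW.
have hs : normc (\sum_(i < s) tau%:C ^+ i * mainp m beta (Xvar alpha mu n j) (Q i)) <=
    (\sum_(i < s) B i) * (C3 * tau ^+ s * expR (- (c / 2 * y ^+ m))).
  apply: le_trans (normc_sum _ _ _) _; rewrite mulr_suml; apply: ler_sum => i _.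
  have [Bi0 hB] := HB i.
  rewrite normcM normcX normc_real gtr0_norm//.
  apply: (@le_trans _ _ (1 * (B i * expR (- (c * y ^+ m))))).
    apply: ler_pM; rewrite ?exprn_ge0 ?normc_ge0 ?(ltW t0)//; last exact: hB.
    by rewrite exprn_ile1// ltW.
  by rewrite mul1r ler_wpM2l.
apply: le_trans (ler_wpM2l _ hs) _; first by rewrite mulr_ge0 ?invr_ge0// ltW.
rewrite exprS le_eqVlt; apply/orP; left; apply/eqP.
by move: ((2 * pi)^-1) (expR _) (\sum_(_ < _) _) => p q r; ring.
Qed.

End PointEstimate.

(** * Partition of the period and the exponentially small part *)

Section Assembly.
Context {R : realType}.
Implicit Types (u x t : R) (v z w : R[i]) (j l : int) (n s mu : nat).

Lemma finite_pos_min (T : finType) (h : T -> R) : (forall k, 0 < h k) ->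
  exists2 d : R, 0 < d & forall k, d <= h k.
Proof.
move=> h0; suff [d d0 Hd] : exists2 d : R, 0 < d & forall k, k \in enum T -> d <= h k.
  by exists d => // k; apply: Hd; rewrite mem_enum.
elim: (enum T) => [|k r [d d0 Hd]]; first by exists 1.
exists (Num.min (h k) d); first by rewrite lt_min h0.
move=> l; rewrite inE => /predU1P[->|/Hd lr]; first by rewrite ge_min lexx.
by rewrite ge_min lr orbT.
Qed.

Lemma cI_partition (D : set (measurableTypeR R)) (I : eqType) (r : seq I)
    (J : I -> set (measurableTypeR R)) (f : R -> R[i]) : measurable D ->
  (forall i, measurable (J i)) -> (forall i, J i `<=` D) -> uniq r ->
  (forall i k, i != k -> J i `&` J k `<=` set0) -> cintegrable D f ->
  let E := D `\` \big[setU/set0]_(i <- r) J i in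
  [/\ measurable E, (forall u, E u -> forall i, i \in r -> ~ J i u) &
   cI D f = \sum_(i <- r) cI (J i) f + cI E f].
Proof.
move=> mD mJ JD + dJ fi; elim: r => [|k r IH] /=.
  by rewrite !big_nil setD0 add0r.
move=> /andP[kr /IH[mE HE EE]]; rewrite !big_cons.
set U := \big[setU/set0]_(i <- r) J i in mE HE EE *.
have -> : D `\` (J k `|` U) = (D `\` U) `\` J k by rewrite setUC setDDl.
(* Since k does not recur in r, [J k] is disjoint from every interval already removed. *)
have JkE : J k `<=` D `\` U.
  move=> u Jku; split; first exact: (JD k u Jku).
  rewrite /U; elim: (r) kr => [|i r' IHr]; first by rewrite big_nil => _ [].
  rewrite inE negb_or big_cons => /andP[ki kr'] [Ji|]; last exact: IHr.
  exact: (dJ k i ki u (conj Jku Ji)).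
split.
- exact: measurableD.
- move=> u [Du nJ] i; rewrite inE => /predU1P[->|ir].
    by move=> h; apply: nJ; left.
  by apply: (HE u) => //; split => // h; apply: nJ; right.
- rewrite EE (@cI_setD _ (J k) (D `\` U))//.
    by rewrite addrCA addrA.
  by apply: (cintegrableS mE mD _ fi); exact: subDsetl.
Qed.

Lemma point_error_ge0 (alpha : R) mu s (C c : R) n j : 0 <= C ->
  0 <= point_error alpha mu s C c n j.
Proof.
by move=> C0; rewrite /point_error !mulr_ge0 ?expR_ge0// invr_ge0 powR_ge0.
Qed.

Lemma point_error_le (alpha : R) mu s (C C' c c' : R) n j : C <= C' -> 0 <= C ->
  c' <= c -> point_error alpha mu s C c n j <= point_error alpha mu s C' c' n j.
Proof.
move=> CC C0 cc; rewrite /point_error; apply: ler_pM; rewrite ?expR_ge0//.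
- by rewrite mulr_ge0// invr_ge0 powR_ge0.
- by rewrite ler_wpM2r// invr_ge0 powR_ge0.
- by rewrite ler_expR lerN2 ler_wpM2r// powR_ge0.
Qed.

(** rho^n <= e^(-(1 - rho) n). Half of this exponent beats tau^(-(s+1)); the other half gives the
    decay in X, because y^m <= (1 + |Lb|)^m n in this range of j. *)
Lemma geometric_le_point_error (rho alpha Lb : R) mu s : (0 < mu)%N ->
  0 <= rho -> rho < 1 -> exists C c : R, [/\ 0 <= C, 0 < c &
    forall n j, (0 < n)%N -> `|n%:R * alpha - j%:~R| <= Lb * n%:R ->
      rho ^+ n <= point_error alpha mu s C c n j].
Proof.
move=> mu0 rho0 rho1; set m := (2 * mu)%N.
have m1 : (1 < m)%N by rewrite /m; lia.
have m0 : (0 < m)%N := ltnW m1.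
pose r := 1 - rho; have r0 : 0 < r by rewrite subr_gt0.
have r2 : 0 < r / 2 by rewrite divr_gt0.
have [C3 C30 HC3] := poly_le_expR s.+1 r2.
pose L1 := 1 + `|Lb|.
have L10 : 0 < L1 by rewrite ltr_pwDl.
exists C3, (r / 2 / L1 ^+ m); split => //.
  by rewrite divr_gt0// exprn_gt0.
move=> n j n0 nj.
have [tau [t0 nt tE tk]] := scaling_factor (R := R) n0 m0.
have [y [y0 Xy Xm]] := scaling_root (Xvar alpha mu n j) m1.
rewrite /point_error -/m Xm tk.
have ty := scaled_root_le m1 n0 t0 y0 nt tE Xy nj.
have n1 : 1 <= n%:R :> R by rewrite ler1n.
have t1 := scaling_factor_le1 m0 n0 t0 nt.
have ym : y ^+ m <= n%:R * L1 ^+ m.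
  have -> : y ^+ m = n%:R * (tau * y) ^+ m by rewrite exprMn mulrA nt mul1r.
  by rewrite ler_wpM2l// lerXn2r ?nnegrE ?(ltW L10)// mulr_ge0// ltW.
have h1 : rho ^+ n <= expR (- (r / 2 * n%:R)) * expR (- (r / 2 * n%:R)).
  rewrite -expRD (_ : _ + _ = n%:R * (- r)); last by field.
  rewrite expRM_natl lerXn2r ?nnegrE ?expR_ge0//.
  by have := expR_ge1Dx (- r); rewrite /r opprB addrC subrK.
apply: le_trans h1 _; apply: ler_pM; rewrite ?expR_ge0//.
  rewrite expRN -[leLHS]mul1r ler_pdivrMr ?expR_gt0//.
  apply: (@le_trans _ _ (tau ^+ s.+1 * (2 + n%:R) ^+ s.+1)).
    rewrite -exprMn exprn_ege1// mulrC -[leLHS]nt.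
    apply: ler_pM => //; first by rewrite exprn_ge0// ltW.
      by rewrite lerDr.
    by rewrite ler_iXnr// ltW.
  rewrite mulrAC [leRHS]mulrC ler_wpM2l ?exprn_ge0 ?(ltW t0)//.
  exact: HC3.
have L1m : 0 < L1 ^+ m by rewrite exprn_gt0.
rewrite ler_expR lerN2; apply: (le_trans (ler_wpM2l _ ym)).
  by rewrite divr_ge0// ltW.
by rewrite mulrCA divfK ?gt_eqF// mulrC.
Qed.

Lemma ent_max_lt1 (F : R[i] -> R[i]) (A : set R) : ent F -> compact A ->
  (forall u, A u -> normc (F u%:C) < 1) ->
  exists rho : R, [/\ 0 <= rho, rho < 1 & forall u, A u -> normc (F u%:C) <= rho].
Proof.
move=> eF cA HA; have [A0|/set0P nA0] := eqVneq A set0.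
  by exists 0; split => // u; rewrite A0.
have [cR cIm] := ent_ccont_real eF.
pose h u := Re (F u%:C) * Re (F u%:C) + Im (F u%:C) * Im (F u%:C).
have ch : continuous h.
  by move=> u; apply: cvgD; apply: cvgM; [exact: cR|exact: cR|exact: cIm|exact: cIm].
have [c cA' Hc] := compact_EVT_max nA0 cA (continuous_subspaceT ch).
exists (normc (F c%:C)); split; first exact: normc_ge0.
  exact: HA (set_mem cA').
move=> u Au; rewrite -(@ler_pXn2r _ 2)// ?nnegrE ?normc_ge0// !normc_sqr !expr2.
exact: Hc (mem_set Au).
Qed.

Lemma compact_away (I : Type) (theta : I -> R) (a b eps : R) :
  compact [set u | a <= u <= b /\ forall k, eps <= `|u - theta k|].
Proof.
rewrite (_ : [set u | _] = `[a, b] `&`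
    \bigcap_(k in setT) ((fun u : R => `|u - theta k|) @^-1` [set x | eps <= x])).
  apply: compact_closedI; first exact: segment_compact.
  apply: closed_bigI => k _; apply: preimage_closed; last exact: closed_ge.
  move=> u _; apply: cvg_norm; apply: cvgB; [exact: cvg_id|exact: cvg_cst].
apply/seteqP; split => u /=; rewrite in_itv /=.
  by move=> [-> h]; split => // k _; exact: h.
by move=> [-> h]; split => // k; exact: (h k Logic.I).
Qed.

End Assembly.

Theorem theorem1 (R : realType) (a : int -> R[i]) (K : nat)
    (kappa z : 'I_K -> R[i]) (alpha : 'I_K -> R) (mu : 'I_K -> nat)
    (beta : 'I_K -> R[i])
    (ha : ell1 a) (hA1 : assumption_A1 a)
    (hA2 : assumption_A2 a kappa z alpha mu beta)
    (hA3 : assumption_A3 z alpha) :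
  forall s : 'I_K -> nat,
  exists (P : 'I_K -> nat -> {poly {poly R[i]}}) (C c : R),
    [/\ 0 < C, 0 < c &
    forall (n : nat) (j : int), (0 < n)%N ->
      `| green a n j -
         \sum_(k < K) \sum_(1 <= sigma < (s k).+1)
           z k ^+ n * kappa k ^ j
             / (n%:R `^ (sigma%:R / (2 * mu k)%:R))%:C
           * poly_diff (P k sigma) (Hfun (mu k) (beta k))
               (Xvar (alpha k) (mu k) n j) |
      <= (\sum_(k < K)
            C / n%:R `^ ((s k).+1%:R / (2 * mu k)%:R)
            * expR (- (c * `|Xvar (alpha k) (mu k) n j|
                           `^ ((2 * mu k)%:R / ((2 * mu k)%:R - 1)))))%:C ].
Proof.
case: hA2 => K0 kinj kcirc _ zcirc lt1 _ mu0 beta0 hexp s.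
have [S HS] := finite_supportE hA1.1.
pose F := fseries S a.
have eF : ent F by exact: ent_fseries.
have FE v : F v = symbol a (cexp (- 'i * v)).
  rewrite /symbol (HS (fun l => cexp (- 'i * v) ^ l)).
  by apply: eq_bigr => l _; rewrite cexpMz.
have kn k : normc (kappa k) = 1.
  by have := kcirc k; rewrite normcE => -[].
have zn k : normc (z k) = 1.
  by have := zcirc k; rewrite normcE => -[].
have pi0 : 0 < pi :> R := pi_gt0 R.
have /choice[theta Htheta] : forall k, exists t : R,
    0 <= t < 2 * pi /\ kappa k = cexp (- 'i * t%:C).
  by move=> k; exact: angle_exists (kn k).
have z0 k : z k != 0.
  by apply/eqP => h; have := zn k; rewrite h normc0 => /eqP; rewrite eq_sym oner_eq0.
have /choice[P HP] : forall k, exists P : nat -> {poly {poly R[i]}},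
  exists eps0 : R, [/\ 0 < eps0,
    (forall eps Lb : R, 0 < eps -> eps <= eps0 -> exists C c : R, [/\ 0 <= C, 0 < c &
      forall n j, (0 < n)%N -> `|n%:R * alpha k - j%:~R| <= Lb * n%:R ->
        normc (((2 * pi)^-1)%:C * cI `[theta k - eps, theta k + eps]
            (fun u : R => F u%:C ^+ n * cexp (j%:~R * (- 'i * u%:C))) -
          point_main P (kappa k) (z k) (alpha k) (mu k) (beta k) (s k) n j)
        <= point_error (alpha k) (mu k) (s k) C c n j]) &
    (exists C c : R, [/\ 0 <= C, 0 < c & forall n j, (0 < n)%N ->
        n%:R <= `|n%:R * alpha k - j%:~R| ->
        normc (point_main P (kappa k) (z k) (alpha k) (mu k) (beta k) (s k) n j)
        <= point_error (alpha k) (mu k) (s k) C c n j])].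
  move=> k.
  have em : ~~ odd (2 * mu k) by rewrite mul2n odd_double.
  have [e [M [e0 Hg]]] := reduced_flat em (z0 k) (Htheta k).2 (fun x => FE x%:C) (hexp k).
  exact: point_estimate eF (Htheta k).2 (zn k) (mu0 k) (beta0 k) e0 Hg.
have /choice[eps0 Heps0] := HP.
have [d d0 Hd] : exists2 d : R, 0 < d & forall k, d <= 2 * pi - theta k.
  by apply: finite_pos_min => k; have [/andP[_ h] _] := Htheta k; rewrite subr_gt0.
have [d1 d10 Hd1] : exists2 d : R, 0 < d & forall k, d <= eps0 k.
  by apply: finite_pos_min => k; have [] := Heps0 k.
have theta_inj k l : theta k = theta l -> k = l.
  by move=> h; apply: kinj; rewrite (Htheta k).2 (Htheta l).2 h.
(* Minimal distance between distinct angles; the value 1 on the diagonal keeps the family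
   positive. *)
have [d2 d20 Hd2] : exists2 d : R, 0 < d &
    forall kl : 'I_K * 'I_K, d <= if kl.1 == kl.2 then 1 else `|theta kl.1 - theta kl.2|.
  apply: finite_pos_min => -[k l] /=; case: eqVneq => // kl.
  by rewrite normr_gt0 subr_eq0; apply: contra kl => /eqP/theta_inj ->.
(* In turn: the local estimates apply, the intervals fit into the period, and they are disjoint.
   Dividing by 3 makes 2 eps strictly less than d2, as closed intervals require. *)
pose eps := Num.min (Num.min d1 (d / 2)) (d2 / 3).
have eps_gt0 : 0 < eps by rewrite !lt_min d10 !divr_gt0.
have eps1 : eps <= d1 by rewrite !ge_min lexx.
have eps2 : eps <= d / 2 by rewrite !ge_min lexx orbT.
have eps3 : eps <= d2 / 3 by rewrite ge_min lexx orbT.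
(* The angles lie in [0, 2 pi - d], so a period starting at -d/2 leaves a margin d/2 at both ends,
   including for an angle equal to 0. *)
pose t0 := - (d / 2).
pose D : set (measurableTypeR R) := `[t0, t0 + 2 * pi]%classic.
pose J k : set (measurableTypeR R) := `[theta k - eps, theta k + eps]%classic.
have mD : measurable D by exact: measurable_itv.
have mJ k : measurable (J k) by exact: measurable_itv.
have JD k : J k `<=` D.
  move=> u; rewrite /J /D /= !in_itv /= => /andP[u1 u2].
  have [/andP[th0 _] _] := Htheta k; have := Hd k; move: eps2 u1 u2 th0.
  by rewrite /t0; clear; move: (theta k) eps (pi : R) => th e p; lra.
have dJ k l : k != l -> J k `&` J l `<=` set0.
  move=> kl u []; rewrite /J /= !in_itv /= => /andP[u1 u2] /andP[u3 u4].
  have := Hd2 (k, l); rewrite /= (negbTE kl) ler_normr => /orP[] h;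
    by move: u1 u2 u3 u4 eps3 eps_gt0 h; clear; move: (theta k) (theta l) eps => a b e; lra.
(* The weak inequality makes this set compact; it contains the period minus the closed intervals. *)
pose A : set R := [set u | t0 <= u <= t0 + 2 * pi /\ forall k, eps <= `|u - theta k|].
have cA : compact A by exact: compact_away.
have HA u : A u -> normc (F u%:C) < 1.
  move=> [u01 Au]; rewrite FE.
  have h1 : `|cexp (- 'i * u%:C)| = 1 :> R[i] by rewrite normcE normc_cexp_i.
  have := lt1 _ h1; rewrite normcE ltcR; apply => k.
  apply/negP => /eqP; rewrite (Htheta k).2 => /angle_unique h.
  have := Au k; rewrite h ?subrr ?normr0 ?leNgt ?eps_gt0//.
  have [/andP[th0 _] _] := Htheta k; have := Hd k; move: u01 d0 th0.
  rewrite /t0 ltr_norml; clear; move: (theta k) (pi : R) => th p /andP[h1 h2] d0 th0 h3.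
  by apply/andP; split; lra.
have [rho [rho0 rho1 Hrho]] := ent_max_lt1 eF cA HA.
pose L0 := (\max_(l <- S) absz l)%N.
have HL0 l : l \in S -> (absz l <= L0)%N.
  by move=> lS; rewrite /L0; exact: leq_bigmax_seq.
pose al := \sum_(k < K) `|alpha k|.
have al0 : 0 <= al by rewrite sumr_ge0.
have Hal k : `|alpha k| <= al.
  by rewrite /al (bigD1 k)//= lerDl sumr_ge0.
(* If |j| > n N0, then |j| > n L0, so the Green function vanishes, and |n alpha_k - j| >= n, so the
   main terms are small. Otherwise |n alpha_k - j| <= n Lb for every k. *)
pose N0 := (L0 + (Num.bound al).+1)%N.
have HN0 k : `|alpha k| + 1 <= N0%:R.
  rewrite /N0 natrD -natr1 addrA lerD2r.
  apply: le_trans (Hal k) _; apply: le_trans (ltW (archi_boundP al0)) _.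
  by rewrite lerDr.
pose Lb := al + N0%:R.
have /choice[C1 HC1] : forall k, exists C1 : R, exists c : R, [/\ 0 <= C1, 0 < c &
      forall n j, (0 < n)%N -> `|n%:R * alpha k - j%:~R| <= Lb * n%:R ->
        normc (((2 * pi)^-1)%:C * cI (J k)
            (fun u : R => F u%:C ^+ n * cexp (j%:~R * (- 'i * u%:C))) -
          point_main (P k) (kappa k) (z k) (alpha k) (mu k) (beta k) (s k) n j)
        <= point_error (alpha k) (mu k) (s k) C1 c n j].
  move=> k; have [_ H _] := Heps0 k.
  exact: (H eps Lb eps_gt0 (le_trans eps1 (Hd1 k))).
have /choice[c1 Hc1] := HC1.
have /choice[C2 HC2] : forall k, exists C2 : R, exists c : R, [/\ 0 <= C2, 0 < c &
      forall n j, (0 < n)%N -> n%:R <= `|n%:R * alpha k - j%:~R| ->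
        normc (point_main (P k) (kappa k) (z k) (alpha k) (mu k) (beta k) (s k) n j)
        <= point_error (alpha k) (mu k) (s k) C2 c n j].
  by move=> k; have [_ _] := Heps0 k.
have /choice[c2 Hc2] := HC2.
(* The contribution away from the tangency points is charged to a single term of the error sum. *)
pose k0 : 'I_K := Ordinal K0.
have [C3 [c3 [C30 c30 HC3]]] :=
  geometric_le_point_error (alpha k0) Lb (s k0) (mu0 k0) rho0 rho1.
have [ca ca0 Hca] : exists2 d : R, 0 < d & forall k, d <= Num.min (c1 k) (c2 k).
  apply: finite_pos_min => k; rewrite lt_min.
  by have [_ -> _] := Hc1 k; have [_ -> _] := Hc2 k.
(* An upper bound of 1/kern on the period, so that a constant bound becomes a multiple of [kern]. *)
pose M := 1 + (`|t0| + 2 * pi) ^+ 2.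
have M0 : 0 < M by rewrite ltr_pwDl// sqr_ge0.
pose C4 := (2 * pi)^-1 * (2 * (M * pi)) * C3.
have C40 : 0 <= C4.
  by rewrite /C4 !mulr_ge0 ?invr_ge0 ?mulr_ge0// ?ltW.
(* The summand 1 only ensures positivity; [C1], [C2] and [C4] account for the local integrals, the
   remote j and the rest of the period. *)
pose C := 1 + \sum_(k < K) (C1 k + C2 k) + C4.
have C120 k : 0 <= C1 k + C2 k.
  by rewrite addr_ge0//; [have [] := Hc1 k|have [] := Hc2 k].
have HC k : C1 k + C2 k <= \sum_(k < K) (C1 k + C2 k).
  by rewrite (bigD1 k)//= lerDl sumr_ge0.
pose c := Num.min ca c3.
have cc1 k : c <= c1 k.
  by rewrite /c ge_min (le_trans (Hca k))// ge_min lexx.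
have cc2 k : c <= c2 k.
  by rewrite /c ge_min (le_trans (Hca k))// ge_min lexx orbT.
exists P, C, c; split.
- by rewrite /C -addrA ltr_pwDl// addr_ge0// sumr_ge0.
- by rewrite lt_min ca0.
move=> n j n0.
rewrite normcE lecR.
change (normc (green a n j - \sum_(k < K)
    point_main (P k) (kappa k) (z k) (alpha k) (mu k) (beta k) (s k) n j) <=
  \sum_(k < K) point_error (alpha k) (mu k) (s k) C c n j).
have [jn|jn] := leqP (absz j) (n * N0); last first.
  rewrite (green_vanish HS HL0); last first.
    by apply: leq_ltn_trans jn; rewrite leq_mul2l leq_addr orbT.
  rewrite sub0r normcN; apply: le_trans (normc_sum _ _ _) _.
  apply: ler_sum => k _.
  have [C20 c20 H] := Hc2 k; have [C10 _ _] := Hc1 k.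
  apply: le_trans (H n j n0 _) _.
    have jR : (n * N0)%:R <= `|j%:~R| :> R.
      by rewrite -intr_norm -natr_absz ler_nat ltnW.
    have h := HN0 k; have hn : 0 < n%:R :> R by rewrite ltr0n.
    have h2 : `|n%:R * alpha k| = n%:R * `|alpha k| by rewrite normrM gtr0_norm.
    have h3 : `|j%:~R| - `|n%:R * alpha k| <= `|n%:R * alpha k - j%:~R| :> R.
      by rewrite distrC; exact: lerB_dist.
    apply: le_trans h3; rewrite h2 lerBrDr; apply: le_trans jR; rewrite natrM.
    by rewrite -{1}(mulr1 n%:R) -mulrDr ler_wpM2l// addrC.
  apply: point_error_le => //; have := HC k; rewrite /C.
  by move: C10 C20 C40; clear; lra.
have nj k : `|n%:R * alpha k - j%:~R| <= Lb * n%:R.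
  apply: le_trans (ler_normB _ _) _; rewrite /Lb mulrDl; apply: lerD.
    by rewrite normrM ger0_norm// mulrC ler_wpM2r.
  by rewrite -intr_norm -natr_absz -natrM ler_nat mulnC.
pose f (u : R) := F u%:C ^+ n * cexp (j%:~R * (- 'i * u%:C)).
have cf : ccont f.
  apply: (@ent_ccont_real _ (fun v => F v ^+ n * cexp (j%:~R * (- 'i * v)))).
  apply: ent_mul; first exact: ent_exp.
  exact: (ent_cexp (ent_mul (ent_cst _) (ent_mul (ent_cst _) ent_id))).
have [mE HE DE] := @cI_partition _ D _ (index_enum 'I_K) J f mD mJ JD
  (index_enum_uniq _) dJ (ccont_cintegrable _ _ cf).
set E := D `\` _ in mE HE DE.
have gE : green a n j = ((2 * pi)^-1)%:C * cI D f.
  rewrite /D /f (green_fourier t0 n j HS) mulrA -realcM mulVf ?mul1r//.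
  by rewrite gt_eqF// mulr_gt0.
have IE : normc (cI E f) <= 2 * (rho ^+ n * M * pi).
  apply: cI_dominated => //; first by rewrite mulr_ge0 ?exprn_ge0// ltW.
  move=> u Eu; rewrite /f normcM normcX.
  have -> : normc (cexp (j%:~R * (- 'i * u%:C))) = 1.
    by rewrite -cexpMz normc_zpow// normc_cexp_i.
  have Du : t0 <= u <= t0 + 2 * pi by case: Eu => + _; rewrite /D /= in_itv.
  have Au : A u.
    split => // k; have := HE u Eu k (mem_index_enum k); rewrite /J /= in_itv /= => /negP h.
    rewrite leNgt; apply: contra h; rewrite ltr_distl => /andP[h1 h2].
    by rewrite !ltW.
  rewrite mulr1 /kern ler_pdivlMr ?ltr_pwDl ?sqr_ge0//.
  apply: ler_pM; rewrite ?exprn_ge0 ?normc_ge0 ?addr_ge0 ?sqr_ge0//.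
    by rewrite lerXn2r ?nnegrE ?normc_ge0 ?Hrho.
  rewrite /M lerD2l -(real_normK (num_real u)) lerXn2r ?nnegrE ?addr_ge0 ?mulr_ge0 ?(ltW pi0)//.
  move: Du; rewrite /t0 normrN (gtr0_norm (_ : 0 < d / 2)) ?divr_gt0// ler_norml.
  by move: d0 pi0; clear; move: (pi : R) => p d0 p0 /andP[h1 h2]; apply/andP; split; lra.
have -> : green a n j - \sum_(k < K)
    point_main (P k) (kappa k) (z k) (alpha k) (mu k) (beta k) (s k) n j =
  \sum_(k < K) (((2 * pi)^-1)%:C * cI (J k) f -
    point_main (P k) (kappa k) (z k) (alpha k) (mu k) (beta k) (s k) n j) +
  ((2 * pi)^-1)%:C * cI E f.
  by rewrite gE DE mulrDr mulr_sumr sumrB addrAC.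
apply: le_trans (normcD _ _) _.
have h1 : normc (\sum_(k < K) (((2 * pi)^-1)%:C * cI (J k) f -
    point_main (P k) (kappa k) (z k) (alpha k) (mu k) (beta k) (s k) n j)) <=
  \sum_(k < K) point_error (alpha k) (mu k) (s k) (C1 k) c n j.
  apply: le_trans (normc_sum _ _ _) _; apply: ler_sum => k _.
  have [C10 _ H] := Hc1 k; apply: le_trans (H n j n0 (nj k)) _.
  exact: point_error_le.
have h2 : normc (((2 * pi)^-1)%:C * cI E f) <=
  \sum_(k < K) point_error (alpha k) (mu k) (s k) C4 c n j.
  have p20 : 0 <= (2 * pi)^-1 :> R by rewrite invr_ge0 mulr_ge0// ltW.
  apply: (@le_trans _ _ (point_error (alpha k0) (mu k0) (s k0) C4 c3 n j)).
    rewrite normcM normc_real ger0_norm//.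
    apply: le_trans (ler_wpM2l p20 IE) _.
    have -> : point_error (alpha k0) (mu k0) (s k0) C4 c3 n j =
      (2 * pi)^-1 * (2 * (M * pi)) * point_error (alpha k0) (mu k0) (s k0) C3 c3 n j.
      by rewrite /point_error /C4 -!mulrA.
    have -> : (2 * pi)^-1 * (2 * (rho ^+ n * M * pi)) =
       (2 * pi)^-1 * (2 * (M * pi)) * rho ^+ n.
      by move: ((2 * pi)^-1) => p; move: (pi : R) => q; ring.
    rewrite ler_wpM2l//; last exact: HC3.
    by rewrite !mulr_ge0// ltW.
  apply: (@le_trans _ _ (point_error (alpha k0) (mu k0) (s k0) C4 c n j)).
    by apply: point_error_le => //; rewrite /c ge_min lexx orbT.
  rewrite (bigD1 k0)//= lerDl sumr_ge0// => k _; exact: point_error_ge0.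
apply: le_trans (lerD h1 h2) _; rewrite -big_split /=; apply: ler_sum => k _.
have [C10 _ _] := Hc1 k; have [C20 _ _] := Hc2 k.
rewrite /point_error -!mulrDl; apply: ler_wpM2r; first exact: expR_ge0.
apply: ler_wpM2r; first by rewrite invr_ge0 powR_ge0.
by have := HC k; rewrite /C; move: C20; clear; lra.
Qed.
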